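(* Assume $\psi,\phi\in L^2(\mathbb{R})$ with $\widehat\psi,\widehat\phi,X\widehat\psi,X\widehat\phi\in W^{3,1}\cap W^{3,2}$. Set $$C_1(\psi,\phi)=\frac{2|A|}{|A|-1}\sqrt{\sigma_1(\psi,\phi)\,\tau_1(\psi,\phi)},$$ $$C_2(\psi,\phi)=\frac{4|A|(2|A|+1)}{|A|^2-1}\sqrt[3]{\sigma_2(\psi,\phi)\,\tau_2(\psi,\phi)^2},$$ $$C_3(\psi,\phi)=\frac{4|A|(2|A|+1)}{|A|^2-1}\sqrt[3]{\sigma_3(\psi,\phi)\,\tau_3(\psi,\phi)^2}.$$ Then the wavelet frame kernel $K(x,y)=B\sum_{j,k\in\mathbb{Z}}\psi_{j,k}(x)\overline{\phi_{j,k}(y)}$ satisfies, with $C_i=C_i(\psi,\phi)$ and provided these constants are finite: (1a) $|K(x,y)|\le C_1\frac1{|x-y|}$ whenever $x\neq y$; (1b) $|K(x_0,y)-K(x,y)|\le C_2\frac{|x-x_0|}{|x-y|^2}$ whenever $|x-x_0|\le\frac12|x-y|$; (1c) $|K(x,y_0)-K(x,y)|\le C_3\frac{|y_0-y|}{|x-y|^2}$ whenever $|y_0-y|\le\frac12|x-y|$.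
   Context: Function spaces are over $\mathbb{R}$ with complex-valued functions; $W^{k,p}=W^{k,p}(\mathbb{R})$ is the usual Sobolev space; $X(\xi)=\xi$; $\widehat f(\xi)=\int_{\mathbb{R}}f(x)e^{-2\pi i\xi x}\,dx$. Functions with integrable Fourier transform are identified with their continuous representatives. Fixed real numbers $A,B$ with $|A|>1$, $B>0$; $\psi_{j,k}(x)=|A|^{j/2}\psi(A^jx-Bk)$, $\phi_{j,k}(x)=|A|^{j/2}\phi(A^jx-Bk)$ for $j,k\in\mathbb{Z}$. The kernel $K$ is considered for $x\ne y$. Define (values in $[0,\infty]$) $\sigma_1(\psi,\phi)=\sum_{l\in\mathbb{Z}}\|\widehat\psi(\cdot)\overline{\widehat\phi(\cdot+lB^{-1})}\|_{L^1}$, $\sigma_2(\psi,\phi)=2\pi\sum_{l\in\mathbb{Z}}\|X(\cdot)\widehat\psi(\cdot)\overline{\widehat\phi(\cdot+lB^{-1})}\|_{L^1}$, $\sigma_3(\psi,\phi)=2\pi\sum_{l\in\mathbb{Z}}\|X(\cdot)\widehat\psi(\cdot+lB^{-1})\overline{\widehat\phi(\cdot)}\|_{L^1}$, $\tau_1(\psi,\phi)=\frac1{4\pi^2}\sum_{l\in\mathbb{Z}}\|[\widehat\psi(\cdot)\overline{\widehat\phi(\cdot+lB^{-1})}]''\|_{L^1}$, $\tau_2(\psi,\phi)=\frac1{4\pi^2}\sum_{l\in\mathbb{Z}}\|[X(\cdot)\widehat\psi(\cdot)\overline{\widehat\phi(\cdot+lB^{-1})}]'''\|_{L^1}$, $\tau_3(\psi,\phi)=\frac1{4\pi^2}\sum_{l\in\mathbb{Z}}\|[X(\cdot)\widehat\psi(\cdot+lB^{-1})\overline{\widehat\phi(\cdot)}]'''\|_{L^1}$.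 *)

(* Defs.v *)
From HB Require Import structures.
From mathcomp Require Import all_boot all_order all_algebra.
From mathcomp Require Import all_classical all_reals all_analysis.
From mathcomp Require Import complex.

Set Implicit Arguments.
Unset Strict Implicit.
Unset Printing Implicit Defensive.

Import Order.TTheory GRing.Theory Num.Theory.
Import numFieldNormedType.Exports.

Local Open Scope classical_set_scope.
Local Open Scope ring_scope.
Local Open Scope complex_scope.

(** Measurability, continuity, integrability and integrals of complex-valued
    functions are taken on the real and imaginary parts; the real-valued modulus
    is [normc]. *)
Section complex_valued.
Context {R : realType}.
Local Notation C := R[i].
Local Notation Re := (@complex.Re R).
Local Notation Im := (@complex.Im R).
Local Notation normc := (@ComplexField.Normc.normc R).
Local Notation mu := (@lebesgue_measure R).
Implicit Types f g h : R -> C.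

Definition cmeasurable f :=
  measurable_fun [set: R] (Re \o f) /\
  measurable_fun [set: R] (Im \o f).

Definition ccontinuous f :=
  continuous (Re \o f) /\ continuous (Im \o f).

Definition clocally_integrable f :=
  locally_integrable [set: R] (Re \o f) /\
  locally_integrable [set: R] (Im \o f).

Definition cintegral (D : set R) f : C :=
  Rintegral mu D (Re \o f) +i* Rintegral mu D (Im \o f).

Definition cLnorm (p : R) f : \bar R :=
  Lnorm mu p%:E (fun x => (normc (f x))%:E).

Definition in_Lp (p : R) f := cmeasurable f /\ (cLnorm p f < +oo)%E.

Definition expi (t : R) : C := cos t +i* sin t.

(** [g] represents the Fourier-Plancherel transform of [f] in L^2:
    [g] is the L^2-limit, as [n] tends to infinity, of
    [xi |-> \int_(-n)^n f(x) exp(-2 pi i xi x) dx]. *)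
Definition truncated_fourier (n : nat) f (xi : R) : C :=
  cintegral `[- n%:R, n%:R] (fun x => f x * expi (- (2 * pi * xi * x))).

Definition is_fourier f g :=
  [/\ in_Lp 2 f, in_Lp 2 g &
      cLnorm 2 (fun xi => truncated_fourier n f xi - g xi) @[n --> \oo]
        --> (0 : \bar R)].

(** Real-valued test functions suffice for weak derivatives of complex-valued
    functions, by linearity. *)
Definition test_function (t : R -> R) :=
  (forall n x, derivable (derive1n n t) x 1) /\ compact (closure [set x | t x != 0]).

Definition is_weak_derivative (m : nat) f h :=
  [/\ clocally_integrable f, clocally_integrable h &
      forall t : R -> R, test_function t ->
        cintegral setT (fun x => f x * (derive1n m t x)%:C) =
        (-1) ^+ m * cintegral setT (fun x => h x * (t x)%:C)].

(** Weak derivatives are unique up to null sets; the value is a chosen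
    representative (and [0] when there is no weak derivative). *)
Definition weak_derivative (m : nat) f : R -> C :=
  xget (fun=> 0) [set h | is_weak_derivative m f h].

Definition sobolev (k : nat) (p : R) f :=
  in_Lp p f /\
  forall m, (m <= k)%N -> exists2 h, is_weak_derivative m f h & in_Lp p h.

Definition mulX f (xi : R) : C := xi%:C * f xi.

(** Unordered sums of complex families; [csum] is meaningful under
    [csummable], i.e. absolute convergence. *)
Definition csummable (I : choiceType) (u : I -> C) :=
  summable [set: I] (fun i => (normc (u i))%:E).

Definition rsum (I : choiceType) (v : I -> R) : R :=
  fine (\esum_(i in [set: I]) ((EFin \o v)^\+ i) -
        \esum_(i in [set: I]) ((EFin \o v)^\- i))%E.

Definition csum (I : choiceType) (u : I -> C) : C :=
  rsum (Re \o u) +i* rsum (Im \o u).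

End complex_valued.

Section wavelet_frame.
Context {R : realType}.
Local Notation C := R[i].
Implicit Types (A B : R) (f psi phi psih phih : R -> C) (l j k : int).

Definition wavelet A B f j k (x : R) : C :=
  (`|A| `^ (j%:~R / 2))%:C * f (A ^ j * x - B * k%:~R).

Definition kernel_term A B psi phi (x y : R) (jk : int * int) : C :=
  wavelet A B psi jk.1 jk.2 x * conjc (wavelet A B phi jk.1 jk.2 y).

Definition frame_kernel A B psi phi (x y : R) : C :=
  B%:C * csum (kernel_term A B psi phi x y).

(** Below, [psih] and [phih] stand for the Fourier transforms of [psi] and
    [phi]. *)
Definition prod1 B psih phih l (xi : R) : C :=
  psih xi * conjc (phih (xi + l%:~R * B^-1)).

Definition prod2 B psih phih l (xi : R) : C :=
  xi%:C * psih xi * conjc (phih (xi + l%:~R * B^-1)).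

Definition prod3 B psih phih l (xi : R) : C :=
  xi%:C * psih (xi + l%:~R * B^-1) * conjc (phih xi).

Local Open Scope ereal_scope.

Definition sigma1 B psih phih : \bar R :=
  \esum_(l in [set: int]) cLnorm 1 (prod1 B psih phih l).

Definition sigma2 B psih phih : \bar R :=
  (2 * pi)%:E * \esum_(l in [set: int]) cLnorm 1 (prod2 B psih phih l).

Definition sigma3 B psih phih : \bar R :=
  (2 * pi)%:E * \esum_(l in [set: int]) cLnorm 1 (prod3 B psih phih l).

Definition tau1 B psih phih : \bar R :=
  ((4 * pi ^+ 2)^-1)%:E *
  \esum_(l in [set: int]) cLnorm 1 (weak_derivative 2 (prod1 B psih phih l)).

Definition tau2 B psih phih : \bar R :=
  ((4 * pi ^+ 2)^-1)%:E *
  \esum_(l in [set: int]) cLnorm 1 (weak_derivative 3 (prod2 B psih phih l)).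

Definition tau3 B psih phih : \bar R :=
  ((4 * pi ^+ 2)^-1)%:E *
  \esum_(l in [set: int]) cLnorm 1 (weak_derivative 3 (prod3 B psih phih l)).

Definition const1 A B psih phih : \bar R :=
  (2 * `|A| / (`|A| - 1))%:E * sqrte (sigma1 B psih phih * tau1 B psih phih).

Definition const2 A B psih phih : \bar R :=
  (4 * `|A| * (2 * `|A| + 1) / (`|A| ^+ 2 - 1))%:E *
  (sigma2 B psih phih * tau2 B psih phih ^+ 2) `^ (3^-1).

Definition const3 A B psih phih : \bar R :=
  (4 * `|A| * (2 * `|A| + 1) / (`|A| ^+ 2 - 1))%:E *
  (sigma3 B psih phih * tau3 B psih phih ^+ 2) `^ (3^-1).

End wavelet_frame.

(* Main.v *)
Require Import Defs.
From HB Require Import structures.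
From mathcomp Require Import all_boot all_order all_algebra.
From mathcomp Require Import all_classical all_reals all_analysis.
From mathcomp Require Import measurable_realfun.
From mathcomp Require Import complex ring lra zify.

(** For a fixed dilation index [j] put [u = A^j x], [v = A^j y] and
    [F s = psi (s + u) * conj (phi (s + v))].  The Fourier coefficients of the
    [B]-periodization of [F] are, up to phases, the values [c_l (u - v)], where
    [c_l] is the inverse Fourier transform of [prod1 l].  By Poisson summation,
    the sum over the translations is at most [\sum_l |c_l (u - v)|], that is at
    most [sigma1] and, integrating by parts twice, at most [tau1 / |u - v|^2].
    Hence [|K (x, y)|] is at most
    [\sum_j |A|^j min (sigma1, tau1 / (|A|^(2j) |x - y|^2))], which is bounded by
    two geometric series, split where the two bounds cross.

    For the increment in the first variable, [c_l t0 - c_l t] is an integral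
    over the segment from [t] to [t0] of the derivative of [c_l], which is
    [2 pi i] times the inverse transform of [prod2 l]; since [|t0 - t| <= |t| / 2]
    the segment stays at distance at least [|t| / 2] from [0], which costs the
    factor [8] in the bound by [tau2].  The second variable follows from
    [K_(psi, phi) (x, y) = conj (K_(phi, psi) (y, x))].

    Poisson summation is used only as an upper bound on the value at [0] of the
    periodization, obtained by testing against the Fejér kernel. *)

Set Implicit Arguments.
Unset Strict Implicit.
Unset Printing Implicit Defensive.

Import Order.TTheory GRing.Theory Num.Theory.
Import numFieldNormedType.Exports.

Local Open Scope classical_set_scope.
Local Open Scope ring_scope.
Local Open Scope complex_scope.

(** * Complex-valued functions and integrals *)

Local Notation normc := ComplexField.Normc.normc.
Local Notation Re := complex.Re.
Local Notation Im := complex.Im.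

Section complex_modulus.
Context {R : realType}.
Implicit Types (z w : R[i]) (x t : R).

(** The hypotheses on the transforms are weak or hold almost everywhere, while the conclusion
    concerns every pair of points. Weak derivatives are therefore converted into [absc], the
    representation of a function as the integral of its derivative from infinity; for it the Leibniz
    rule is a case of Fubini. The values of [psi] and [phi] are recovered from the L^2-limit
    defining the transform by Abel means and continuity. The Poisson bound controls the sums over
    translations with their cancellations, so absolute convergence of the double series is a
    separate matter: it comes from a decay of order [1 / (1 + x^2)], itself a consequence of
    inversion and of two derivatives of the transform. Origin of the constants: differentiating a
    coefficient gives [2 pi] and three integrations by parts give [(2 pi)^-3], whence the same
    [1 / (4 pi^2)] in all three [tau]. The [8] enters squared under a cube root and becomes [4].
    With [a = |A|], the two geometric series contribute [a^2 / (a^2 - 1)] and [a / (a - 1)], whose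
    sum is [a (2 a + 1) / (a^2 - 1)]. *)

Lemma normcE z : normc z = Num.sqrt (Re z ^+ 2 + Im z ^+ 2).
Proof. by case: z. Qed.

Lemma normc_ge0 z : 0 <= normc z.
Proof. by rewrite normcE sqrtr_ge0. Qed.

Lemma sqr_normc z : normc z ^+ 2 = Re z ^+ 2 + Im z ^+ 2.
Proof. by rewrite normcE sqr_sqrtr// addr_ge0// sqr_ge0. Qed.

Lemma normcM z w : normc (z * w) = normc z * normc w.
Proof. exact: ComplexField.Normc.normcM. Qed.

Lemma normcD z w : normc (z + w) <= normc z + normc w.
Proof. exact: le_normcD. Qed.

Lemma normcN z : normc (- z) = normc z.
Proof. by rewrite !normcE; case: z => a b /=; rewrite !sqrrN. Qed.

Lemma normcB z w : normc (z - w) <= normc z + normc w.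
Proof. by rewrite -[normc w]normcN; exact: normcD. Qed.

Lemma normcBC z w : normc (z - w) = normc (w - z).
Proof. by rewrite -normcN opprB. Qed.

Lemma normc_conj z : normc (conjc z) = normc z.
Proof. by rewrite !normcE; case: z => a b /=; rewrite sqrrN. Qed.

Lemma normc_real x : normc (x%:C) = `|x|.
Proof. by rewrite normcE /= expr0n addr0 sqrtr_sqr. Qed.

Lemma normc0 : normc (0 : R[i]) = 0.
Proof. exact: ComplexField.Normc.normc0. Qed.

Lemma normc_eq0 z : normc z = 0 -> z = 0.
Proof. exact: ComplexField.Normc.eq0_normc. Qed.

Lemma normc_expi t : normc (expi t) = 1.
Proof. by rewrite normcE /= cos2Dsin2 sqrtr1. Qed.

Lemma normRe_le z : `|Re z| <= normc z.
Proof. by rewrite normcE -sqrtr_sqr ler_wsqrtr// lerDl sqr_ge0. Qed.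

Lemma normIm_le z : `|Im z| <= normc z.
Proof. by rewrite normcE -sqrtr_sqr ler_wsqrtr// lerDr sqr_ge0. Qed.

Lemma normc_le_ReIm z : normc z <= `|Re z| + `|Im z|.
Proof.
rewrite -(@ler_pXn2r _ 2)// ?nnegrE ?normc_ge0 ?addr_ge0// sqr_normc.
rewrite -(real_normK (num_real (Re z))) -(real_normK (num_real (Im z))).
by have := mulr_ge0 (normr_ge0 (Re z)) (normr_ge0 (Im z)); nra.
Qed.

Lemma normc_sum (I : Type) (r : seq I) (P : pred I) (F : I -> R[i]) :
  normc (\sum_(i <- r | P i) F i) <= \sum_(i <- r | P i) normc (F i).
Proof.
elim/big_ind2 : _ => [|z x w y zx wy|//]; first by rewrite normc0.
by rewrite (le_trans (normcD _ _))// lerD.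
Qed.

Lemma expiD s t : expi (s + t) = expi s * expi t.
Proof.
rewrite /expi cosD sinD; apply/eqP; rewrite eq_complex /=.
by rewrite eqxx /= addrC.
Qed.

Lemma expi0 : expi 0 = 1 :> R[i].
Proof. by rewrite /expi cos0 sin0. Qed.

Lemma conj_expi t : conjc (expi t) = expi (- t).
Proof. by rewrite /expi cosN sinN. Qed.

Lemma ReD z w : Re (z + w) = Re z + Re w. Proof. by case: z w => ? ? []. Qed.
Lemma ImD z w : Im (z + w) = Im z + Im w. Proof. by case: z w => ? ? []. Qed.
Lemma ReN z : Re (- z) = - Re z. Proof. by case: z. Qed.
Lemma ImN z : Im (- z) = - Im z. Proof. by case: z. Qed.
Lemma ReM z w : Re (z * w) = Re z * Re w - Im z * Im w.
Proof. by case: z w => ? ? []. Qed.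
Lemma ImM z w : Im (z * w) = Re z * Im w + Im z * Re w.
Proof. by case: z w => ? ? []. Qed.
Lemma Re_conj z : Re (conjc z) = Re z. Proof. by case: z. Qed.
Lemma Im_conj z : Im (conjc z) = - Im z. Proof. by case: z. Qed.

Lemma mul_conjc z : conjc z * z = (normc z ^+ 2)%:C.
Proof.
rewrite sqr_normc; apply/eqP; rewrite eq_complex ReM ImM Re_conj Im_conj/=.
by apply/andP; split; apply/eqP; ring.
Qed.

End complex_modulus.

Section complex_measurable.
Context {d} {T : measurableType d} {R : realType}.
Implicit Types (f g : T -> R[i]) (h : T -> R).

Definition cmfun f := measurable_fun [set: T] (fun x => Re (f x)) /\
  measurable_fun [set: T] (fun x => Im (f x)).

Lemma cmfunD f g : cmfun f -> cmfun g -> cmfun (fun x => f x + g x).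
Proof.
move=> [fr fi] [gr gi]; split.
  by under eq_fun do rewrite ReD; exact: measurable_funD.
by under eq_fun do rewrite ImD; exact: measurable_funD.
Qed.

Lemma cmfunN f : cmfun f -> cmfun (fun x => - f x).
Proof.
move=> [fr fi]; split.
  by under eq_fun do rewrite ReN; exact: measurableT_comp.
by under eq_fun do rewrite ImN; exact: measurableT_comp.
Qed.

Lemma cmfunB f g : cmfun f -> cmfun g -> cmfun (fun x => f x - g x).
Proof. by move=> mf mg; apply: cmfunD => //; exact: cmfunN. Qed.

Lemma cmfunM f g : cmfun f -> cmfun g -> cmfun (fun x => f x * g x).
Proof.
move=> [fr fi] [gr gi]; split.
  by under eq_fun do rewrite ReM; apply: measurable_funB; exact: measurable_funM.
by under eq_fun do rewrite ImM; apply: measurable_funD; exact: measurable_funM.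
Qed.

Lemma cmfun_conj f : cmfun f -> cmfun (fun x => conjc (f x)).
Proof.
move=> [fr fi]; split; first by under eq_fun do rewrite Re_conj.
by under eq_fun do rewrite Im_conj; exact: measurableT_comp.
Qed.

Lemma cmfun_cst z : cmfun (fun=> z).
Proof. by split; exact: measurable_cst. Qed.

Lemma cmfun_real h : measurable_fun [set: T] h -> cmfun (fun x => (h x)%:C).
Proof. by move=> mh; split => //=; exact: measurable_cst. Qed.

Lemma cmfun_expi h : measurable_fun [set: T] h -> cmfun (fun x => expi (h x)).
Proof.
move=> mh; split => /=.
  by apply: (measurableT_comp _ mh); apply: continuous_measurable_fun; exact: continuous_cos.
by apply: (measurableT_comp _ mh); apply: continuous_measurable_fun; exact: continuous_sin.
Qed.

Lemma cmfun_sum (I : Type) (r : seq I) (F : I -> T -> R[i]) :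
  (forall i, cmfun (F i)) -> cmfun (fun x => \sum_(i <- r) F i x).
Proof.
move=> mF; elim: r => [|i r ih].
  by under [X in cmfun X]eq_fun do rewrite big_nil; exact: cmfun_cst.
by under [X in cmfun X]eq_fun do rewrite big_cons; exact: cmfunD.
Qed.

Lemma measurable_normc f : cmfun f -> measurable_fun [set: T] (fun x => normc (f x)).
Proof.
move=> [fr fi]; under eq_fun do rewrite normcE.
have ms : measurable_fun [set: R] (@Num.sqrt R).
  by apply: continuous_measurable_fun; exact: sqrt_continuous.
exact: (measurableT_comp ms (measurable_funD (measurable_funX 2 fr) (measurable_funX 2 fi))).
Qed.

End complex_measurable.

Lemma cmfun_comp {d d'} {T : measurableType d} {T' : measurableType d'} {R : realType}
  (f : T' -> R[i]) (g : T -> T') : cmfun f -> measurable_fun [set: T] g ->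
  cmfun (fun x => f (g x)).
Proof.
move=> [fr fi] mg; split; first exact: (measurableT_comp fr mg).
exact: (measurableT_comp fi mg).
Qed.

Section complex_integral.
Context {R : realType}.
Local Notation mu := (@lebesgue_measure R).
Implicit Types (f g : R -> R[i]) (h : R -> R).

Definition rint h := Rintegral mu [set: R] h.
Definition rintegrable h := mu.-integrable [set: R] (EFin \o h).
Definition cint f := cintegral [set: R] f.
(** Integrability is attached to the modulus, so that domination is a single pointwise inequality;
    [cintegrableP] passes back from the two parts. *)
Definition cintegrable f := cmfun f /\ rintegrable (fun x => normc (f x)).

Lemma cintE f : cint f = rint (fun x => Re (f x)) +i* rint (fun x => Im (f x)).
Proof. by []. Qed.

Local Instance ae_lebesgue_filter : Filter (nbhs (almost_everywhere mu)).
Proof. exact: ae_filter_ringOfSetsType. Qed.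

Lemma ae_imply (P Q : R -> Prop) : (forall x, P x -> Q x) ->
  {ae mu, forall x, P x} -> {ae mu, forall x, Q x}.
Proof. by move=> PQ; apply: filterS => x; exact: PQ. Qed.

Lemma ae_imply2 (P Q S : R -> Prop) : (forall x, P x -> Q x -> S x) ->
  {ae mu, forall x, P x} -> {ae mu, forall x, Q x} -> {ae mu, forall x, S x}.
Proof. by move=> PQS; apply: filterS2 => x; exact: PQS. Qed.

Lemma rintegrable_measurable h : rintegrable h -> measurable_fun [set: R] h.
Proof. by move=> /measurable_int /measurable_EFinP. Qed.

Lemma le_rintegrable h k : measurable_fun [set: R] h ->
  (forall x, `|h x| <= k x) -> rintegrable k -> rintegrable h.
Proof.
move=> mh hk; apply: le_integrable => //; first exact/measurable_EFinP.
by move=> x _ /=; rewrite lee_fin (le_trans (hk x))// ler_norm.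
Qed.

Lemma rintegrableD h k : rintegrable h -> rintegrable k ->
  rintegrable (fun x => h x + k x).
Proof. by move=> ih ik; exact: (integrableD _ ih ik). Qed.

Lemma rintegrableZl c h : rintegrable h -> rintegrable (fun x => c * h x).
Proof. by move=> ih; exact: (integrableZl _ c ih). Qed.

Lemma rintD h k : rintegrable h -> rintegrable k ->
  rint (fun x => h x + k x) = rint h + rint k.
Proof. by move=> ih ik; exact: RintegralD. Qed.

Lemma rintB h k : rintegrable h -> rintegrable k ->
  rint (fun x => h x - k x) = rint h - rint k.
Proof. by move=> ih ik; exact: RintegralB. Qed.

Lemma rintZl c h : rintegrable h -> rint (fun x => c * h x) = c * rint h.
Proof. by move=> ih; exact: RintegralZl. Qed.

Lemma rintN h : rintegrable h -> rint (fun x => - h x) = - rint h.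
Proof.
move=> ih; rewrite -mulN1r -rintZl//; congr rint.
by apply/funext => x; rewrite mulN1r.
Qed.

Lemma le_rint h k : rintegrable h -> rintegrable k -> (forall x, h x <= k x) ->
  rint h <= rint k.
Proof. by move=> ih ik hk; apply: le_Rintegral => //. Qed.

Lemma rint_ge0 h : (forall x, 0 <= h x) -> 0 <= rint h.
Proof. by move=> h0; exact: Rintegral_ge0. Qed.

Lemma rint_EFin h : rintegrable h -> (\int[mu]_x (h x)%:E)%E = (rint h)%:E.
Proof. by move=> ih; rewrite fineK//; exact: integrable_fin_num. Qed.

Lemma rintegrableP h : measurable_fun [set: R] h ->
  (\int[mu]_x (`|h x|)%:E < +oo)%E -> rintegrable h.
Proof. by move=> mh hoo; apply/integrableP; split => //; exact/measurable_EFinP. Qed.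

Lemma le_cintegrable f h : cmfun f -> (forall x, normc (f x) <= h x) ->
  rintegrable h -> cintegrable f.
Proof.
move=> mf fh ih; split => //; apply: le_rintegrable ih; first exact: measurable_normc.
by move=> x; rewrite ger0_norm ?normc_ge0.
Qed.

Lemma cintegrable_Re f : cintegrable f -> rintegrable (fun x => Re (f x)).
Proof.
by move=> [[mr mi] nf]; apply: le_rintegrable nf => // x; exact: normRe_le.
Qed.

Lemma cintegrable_Im f : cintegrable f -> rintegrable (fun x => Im (f x)).
Proof.
by move=> [[mr mi] nf]; apply: le_rintegrable nf => // x; exact: normIm_le.
Qed.

Lemma cintegrableP f : rintegrable (fun x => Re (f x)) ->
  rintegrable (fun x => Im (f x)) -> cintegrable f.
Proof.
move=> fr fi; apply: (@le_cintegrable _ (fun x => `|Re (f x)| + `|Im (f x)|)).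
- by split; exact: rintegrable_measurable.
- by move=> x; exact: normc_le_ReIm.
- by apply: rintegrableD; exact: integrable_norm.
Qed.

Lemma cintegrableD f g : cintegrable f -> cintegrable g ->
  cintegrable (fun x => f x + g x).
Proof.
move=> [mf nf] [mg ng]; apply: le_cintegrable (rintegrableD nf ng).
  exact: cmfunD.
by move=> x; exact: normcD.
Qed.

Lemma cintegrableB f g : cintegrable f -> cintegrable g ->
  cintegrable (fun x => f x - g x).
Proof.
move=> [mf nf] [mg ng]; apply: le_cintegrable (rintegrableD nf ng).
  exact: cmfunB.
by move=> x; exact: normcB.
Qed.

Lemma cintegrableN f : cintegrable f -> cintegrable (fun x => - f x).
Proof.
move=> [mf nf]; apply: le_cintegrable nf; first exact: cmfunN.
by move=> x; rewrite normcN.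
Qed.

Lemma cintegrableMb f g (M : R) : cintegrable f -> cmfun g ->
  (forall x, normc (g x) <= M) -> cintegrable (fun x => f x * g x).
Proof.
move=> [mf nf] mg gM; apply: (le_cintegrable _ _ (rintegrableZl M nf)).
  exact: cmfunM.
by move=> x; rewrite normcM mulrC ler_wpM2r ?normc_ge0.
Qed.

Lemma cintegrableZ (c : R[i]) f : cintegrable f -> cintegrable (fun x => c * f x).
Proof.
move=> [mf nf]; apply: (le_cintegrable _ _ (rintegrableZl (normc c) nf)).
  by apply: cmfunM => //; exact: cmfun_cst.
by move=> x; rewrite normcM.
Qed.

Lemma cintegrable_conj f : cintegrable f -> cintegrable (fun x => conjc (f x)).
Proof.
move=> [mf nf]; apply: le_cintegrable nf; first exact: cmfun_conj.
by move=> x; rewrite normc_conj.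
Qed.

Lemma cintegrable0 : cintegrable (fun=> 0).
Proof.
apply: (@le_cintegrable _ (fun=> 0)); first exact: cmfun_cst.
  by move=> x; rewrite normc0.
exact: integrable0.
Qed.

Lemma cintegrable_sum (I : Type) (r : seq I) (F : I -> R -> R[i]) :
  (forall i, cintegrable (F i)) -> cintegrable (fun x => \sum_(i <- r) F i x).
Proof.
move=> iF; elim: r => [|i r ih].
  by under [X in cintegrable X]eq_fun do rewrite big_nil; exact: cintegrable0.
by under [X in cintegrable X]eq_fun do rewrite big_cons; exact: cintegrableD.
Qed.

Lemma cintegrable_real h : rintegrable h -> cintegrable (fun x => (h x)%:C).
Proof. by move=> ih; apply: cintegrableP => //=; exact: integrable0. Qed.

Lemma cintD f g : cintegrable f -> cintegrable g ->
  cint (fun x => f x + g x) = cint f + cint g.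
Proof.
move=> jf jg; rewrite !cintE; apply/eqP; rewrite eq_complex/=.
have [fr fi] := (cintegrable_Re jf, cintegrable_Im jf).
have [gr gi] := (cintegrable_Re jg, cintegrable_Im jg).
rewrite -!rintD//.
by apply/andP; split; apply/eqP; congr rint; apply/funext => x;
  rewrite ?ReD ?ImD.
Qed.

Lemma cintZ (c : R[i]) f : cintegrable f -> cint (fun x => c * f x) = c * cint f.
Proof.
move=> jf; have [fr fi] := (cintegrable_Re jf, cintegrable_Im jf).
rewrite !cintE; apply/eqP; rewrite eq_complex ReM ImM/=.
rewrite -!rintZl// -rintB; try exact: rintegrableZl.
rewrite -rintD; try exact: rintegrableZl.
by apply/andP; split; apply/eqP; congr rint; apply/funext => x;
  rewrite ?ReM ?ImM.
Qed.

Lemma cintN f : cintegrable f -> cint (fun x => - f x) = - cint f.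
Proof.
move=> jf; rewrite -mulN1r -cintZ//; congr cint.
by apply/funext => x; rewrite mulN1r.
Qed.

Lemma cintB f g : cintegrable f -> cintegrable g ->
  cint (fun x => f x - g x) = cint f - cint g.
Proof. by move=> jf jg; rewrite cintD ?cintN//; exact: cintegrableN. Qed.

Lemma cintZr (c : R[i]) f : cintegrable f -> cint (fun x => f x * c) = cint f * c.
Proof.
move=> jf; rewrite mulrC -cintZ//; congr cint.
by apply/funext => x; rewrite mulrC.
Qed.

Lemma cint0 : cint (fun=> 0) = 0.
Proof.
rewrite -[RHS](mul0r (cint (fun=> 0))) -(cintZ _ cintegrable0).
by rewrite mul0r.
Qed.

Lemma cint_sum (I : Type) (r : seq I) (F : I -> R -> R[i]) :
  (forall i, cintegrable (F i)) ->
  cint (fun x => \sum_(i <- r) F i x) = \sum_(i <- r) cint (F i).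
Proof.
move=> iF; elim: r => [|i r ih].
  rewrite big_nil -[RHS]cint0; congr cint.
  by apply/funext => x; rewrite big_nil.
rewrite big_cons -ih -cintD//; last exact: cintegrable_sum.
by congr cint; apply/funext => x; rewrite big_cons.
Qed.

Lemma cint_conj f : cintegrable f -> cint (fun x => conjc (f x)) = conjc (cint f).
Proof.
move=> jf; rewrite !cintE /= -rintN; last exact: cintegrable_Im.
by congr (_ +i* _); congr rint; apply/funext => x; rewrite ?Re_conj ?Im_conj.
Qed.

Lemma cint_real h : cint (fun x => (h x)%:C) = (rint h)%:C.
Proof.
rewrite cintE; congr (_ +i* _) => /=.
by rewrite /rint Rintegral_cst// mul0r.
Qed.

(* Rotating the integral onto the positive half-line reduces the modulus to a
   real part. *)
Lemma normc_cint f : cintegrable f -> normc (cint f) <= rint (fun x => normc (f x)).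
Proof.
move=> jf; have [z0|z0] := eqVneq (normc (cint f)) 0.
  by rewrite z0; apply: rint_ge0 => x; exact: normc_ge0.
set z := cint f in z0 *; pose c := (normc z)^-1%:C * conjc z.
have cz : c * z = (normc z)%:C.
  rewrite /c -mulrA mul_conjc; apply/eqP; rewrite eq_complex ReM ImM/=.
  by rewrite !(mul0r, mulr0) subr0 addr0 eqxx andbT expr2 mulKf.
have nc : normc c = 1.
  by rewrite normcM normc_real normc_conj ger0_norm ?invr_ge0 ?normc_ge0// mulVf.
have jcf : cintegrable (fun x => c * f x) by exact: cintegrableZ.
have -> : normc z = Re (cint (fun x => c * f x)) by rewrite cintZ// cz.
apply: le_rint; [exact: cintegrable_Re|by case: jf|move=> x].
by rewrite (le_trans (ler_norm _))// (le_trans (normRe_le _))// normcM nc mul1r.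
Qed.

Lemma normc_cint_le f h : cmfun f -> rintegrable h -> (forall x, normc (f x) <= h x) ->
  normc (cint f) <= rint h.
Proof.
move=> mf ih fh; have jf := le_cintegrable mf fh ih.
by rewrite (le_trans (normc_cint jf))// le_rint//; case: jf.
Qed.

Lemma ae_eq_rint h k : measurable_fun [set: R] h -> measurable_fun [set: R] k ->
  {ae mu, forall x, h x = k x} -> rint h = rint k.
Proof.
move=> mh mk hk; rewrite /rint /Rintegral; congr fine.
apply: ae_eq_integral => //; [exact/measurable_EFinP|exact/measurable_EFinP|].
by apply: ae_imply hk => x /= ->.
Qed.

Lemma ae_eq_cint f g : cmfun f -> cmfun g -> {ae mu, forall x, f x = g x} ->
  cint f = cint g.
Proof.
move=> [fr fi] [gr gi] fg; rewrite !cintE; congr (_ +i* _).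
  by apply: ae_eq_rint => //; apply: ae_imply fg => x ->.
by apply: ae_eq_rint => //; apply: ae_imply fg => x ->.
Qed.

Lemma measurable_shift (a : R) : measurable_fun [set: R] (fun x : R => x + a).
Proof. exact: measurable_funD. Qed.

Let T := measurableTypeR R.

Let measurable_shiftT (a : R) : measurable_fun [set: T] ((fun x => x + a) : T -> T).
Proof. exact: measurable_shift. Qed.


(** Lebesgue measure is determined by its values on half-open intervals, and a translation preserves
    their lengths. *)
Lemma lebesgue_measure_shift (a : R) (A : set T) : measurable A ->
  pushforward mu ((fun x => x + a) : T -> T) A = mu A.
Proof.
move=> mA; apply/esym/lebesgue_measure_unique => //=.
move=> _ [[b c]] _ <-.
rewrite /pushforward (_ : _ @^-1` _ = `]b - a, c - a]%classic); last first.
  by apply/seteqP; split => x /=; rewrite !in_itv/= ltrBlDr lerBrDr.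
rewrite /= !lebesgue_measure_itv/= !lte_fin ltrD2r; case: ifPn => // _.
by rewrite -!EFinB opprB addrA subrK.
Qed.

Lemma measurable_comp_shift h (a : R) : measurable_fun [set: R] h ->
  measurable_fun [set: R] (fun x => h (x + a)).
Proof. by move=> mh; exact: (measurableT_comp mh (measurable_shift a)). Qed.

Lemma rintegrable_shift h (a : R) : rintegrable h -> rintegrable (fun x => h (x + a)).
Proof.
move=> ih; have mh := rintegrable_measurable ih.
apply: rintegrableP; first exact: measurable_comp_shift.
have ms := measurable_shiftT a.
have mah : measurable_fun [set: T] (fun x => (`|h x|)%:E).
  by apply/measurable_EFinP; exact: measurableT_comp.
pose m : {measure set T -> \bar R} := mu.
have H := ge0_integral_pushforward ms m measurableT mah
  ltac:(by move=> y _; rewrite lee_fin).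
move/integrableP : ih => [_]; apply: le_lt_trans.
rewrite le_eqVlt; apply: predU1l; apply: etrans (esym H) _.
by apply: eq_measure_integral => A mA _ /=; exact: lebesgue_measure_shift.
Qed.

Lemma rint_shift h (a : R) : rintegrable h -> rint (fun x => h (x + a)) = rint h.
Proof.
move=> ih; rewrite /rint /Rintegral; congr fine.
have mh := rintegrable_measurable ih.
have ms := measurable_shiftT a.
have mEh : measurable_fun [set: T] (EFin \o h) by exact/measurable_EFinP.
pose m : {measure set T -> \bar R} := mu.
have /= <- := @integral_pushforward _ _ _ _ _ _ ms m setT _ mEh
  (rintegrable_shift a ih) measurableT.
by apply: eq_measure_integral => //= A mA _; exact: lebesgue_measure_shift.
Qed.

Lemma cintegrable_shift f (a : R) : cintegrable f -> cintegrable (fun x => f (x + a)).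
Proof.
move=> jf; apply: cintegrableP.
  exact: (rintegrable_shift a (cintegrable_Re jf)).
exact: (rintegrable_shift a (cintegrable_Im jf)).
Qed.

Lemma cint_shift f (a : R) : cintegrable f -> cint (fun x => f (x + a)) = cint f.
Proof.
move=> jf; rewrite !cintE; congr (_ +i* _).
  exact: (rint_shift a (cintegrable_Re jf)).
exact: (rint_shift a (cintegrable_Im jf)).
Qed.

(** The limit inherits the majorant pointwise, so the differences are dominated by [2 * h].
    Convergence of complex values is expressed by the modulus of the difference, a real sequence. *)
Lemma cint_dominated (fn : nat -> R -> R[i]) f h : (forall n, cmfun (fn n)) -> cmfun f ->
  rintegrable h -> (forall n x, normc (fn n x) <= h x) ->
  (forall x, normc (fn n x - f x) @[n --> \oo] --> 0) ->
  cintegrable f /\ normc (cint (fn n) - cint f) @[n --> \oo] --> 0.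
Proof.
move=> mfn mf ih fnh fnf.
have fh x : normc (f x) <= h x.
  apply/ler_addgt0Pr => e e0.
  have /cvgrPdist_lt/(_ _ e0)[N _ /(_ N (leqnn N))] := fnf x.
  rewrite sub0r normrN ger0_norm ?normc_ge0// => fe.
  have -> : f x = fn N x - (fn N x - f x) by rewrite opprB addrC subrK.
  by rewrite (le_trans (normcB _ _))// lerD// ltW.
have jf := le_cintegrable mf fh ih.
have jfn n := le_cintegrable (mfn n) (fnh n) ih.
split=> //.
have jd n : cintegrable (fun x => fn n x - f x) by exact: cintegrableB.
have dle n : normc (cint (fn n) - cint f) <= rint (fun x => normc (fn n x - f x)).
  by rewrite -cintB//; exact: normc_cint.
have [_ _ dc] := @dominated_convergence _ _ R mu [set: R] measurableT
  (fun n x => (normc (fn n x - f x))%:E) (cst 0%E) (fun x => (2 * h x)%:E)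
  (fun n => (measurable_EFinP _ _).2 (measurable_normc (cmfunB (mfn n) mf)))
  (measurable_cst _)
  ltac:(by apply: aeW => x _; apply: cvg_EFin; [exact: nearW|exact: fnf])
  (rintegrableZl 2 ih)
  ltac:(by apply: aeW => x n _ /=; rewrite lee_fin ger0_norm ?normc_ge0//
    mulr_natl mulr2n (le_trans (normcB _ _))// lerD).
rewrite integral0 in dc.
have rc : rint (fun x => normc (fn n x - f x)) @[n --> \oo] --> 0.
  by apply: (fine_cvg dc).
apply: (squeeze_cvgr _ (cvg_cst 0) rc).
by apply: nearW => n; rewrite normc_ge0 dle.
Qed.

End complex_integral.

Section complex_fubini.
Context {R : realType}.
Local Notation mu := (@lebesgue_measure R).
Implicit Types (f g : R -> R[i]) (F G : R -> R) (h : R * R -> R) (H : R * R -> R[i]).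

Lemma measurable_pair1 (x : R) : measurable_fun [set: R] (fun y : R => (x, y)).
Proof. exact: measurable_pair1. Qed.

Lemma measurable_pair2 (y : R) : measurable_fun [set: R] (fun x : R => (x, y)).
Proof. exact: measurable_pair2. Qed.

Let T := measurableTypeR R.

(** A majorant of product form makes the mass of each section at most a constant times [|F x|], and
    Tonelli's criterion applies. *)
Lemma prod_rintegrable h F G : measurable_fun [set: R * R] h ->
  rintegrable F -> rintegrable G -> (forall x y, `|h (x, y)| <= F x * G y) ->
  (mu \x mu)%E.-integrable [set: R * R] (EFin \o h).
Proof.
move=> mh iF iG hFG.
have mEh : measurable_fun [set: T * T] (EFin \o h) by exact/measurable_EFinP.
apply: (iffRL (integrable12ltyP _ _ mEh)).
have hFG' x y : `|h (x, y)| <= `|F x| * `|G y|.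
  by rewrite (le_trans (hFG x y))// -normrM ler_norm.
have mG x : measurable_fun [set: R] (fun y => (`|F x| * `|G y|)%:E).
  apply/measurable_EFinP; apply: measurable_funM; first exact: measurable_cst.
  by apply: measurableT_comp => //; exact: rintegrable_measurable.
have mah : measurable_fun [set: T * T] (fun z => (`|h z|)%:E).
  by apply/measurable_EFinP; exact: measurableT_comp.
have inG x : (\int[mu]_y `|(EFin \o h) (x, y)| <=
    (`|F x| * rint (fun y => `|G y|))%:E)%E.
  have iG' : rintegrable (fun y => `|F x| * `|G y|).
    by apply: rintegrableZl; exact: integrable_norm.
  rewrite -rintZl; last exact: integrable_norm.
  rewrite -rint_EFin//; apply: ge0_le_integral => //=.
  - apply/measurable_EFinP; apply: measurableT_comp => //.
    exact: (measurableT_comp mh (measurable_pair1 x)).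
  - exact: mG.
  - by move=> y _; rewrite lee_fin.
have iF' : rintegrable (fun x => `|F x| * rint (fun y => `|G y|)).
  rewrite (_ : (fun x => _) = (fun x => rint (fun y => `|G y|) * `|F x|)).
    by apply: rintegrableZl; exact: integrable_norm.
  by apply/funext => x; rewrite mulrC.
apply: (@le_lt_trans _ _ (\int[mu]_x (`|F x| * rint (fun y => `|G y|))%:E)%E); last first.
  by rewrite rint_EFin// ltry.
have rG : 0 <= rint (fun y => `|G y|) by apply: rint_ge0.
apply: ge0_le_integral => //=.
- by move=> x _; apply: integral_ge0.
- exact: (measurable_fun_fubini_tonelli_F _ mah).
- by apply/measurable_EFinP; exact: rintegrable_measurable.
- by move=> x _; exact: inG.
Qed.

Lemma section_rintegrable h F G x : measurable_fun [set: R * R] h ->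
  rintegrable G -> (forall x y, `|h (x, y)| <= F x * G y) ->
  rintegrable (fun y => h (x, y)).
Proof.
move=> mh iG hFG; apply: (@le_rintegrable _ _ (fun y => F x * G y)) => //.
  exact: (measurableT_comp mh (measurable_pair1 x)).
exact: rintegrableZl.
Qed.

Lemma swap_measurable h : measurable_fun [set: R * R] h ->
  measurable_fun [set: R * R] (fun z => h (z.2, z.1)).
Proof. by move=> mh; apply: (measurableT_comp mh); exact: measurable_swap. Qed.

Lemma rfubini h F G : measurable_fun [set: R * R] h ->
  rintegrable F -> rintegrable G -> (forall x y, `|h (x, y)| <= F x * G y) ->
  rint (fun x => rint (fun y => h (x, y))) = rint (fun y => rint (fun x => h (x, y))).
Proof.
move=> mh iF iG hFG.
have := Fubini (prod_rintegrable mh iF iG hFG).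
move=> /(congr1 fine).
rewrite (@eq_integral _ _ _ mu _ (fun x => (rint (fun y => h (x, y)))%:E)); last first.
  by move=> x _; rewrite /= (rint_EFin (section_rintegrable x mh iG hFG)).
move=> H; apply: (etrans H); congr fine; apply: eq_integral => y _.
rewrite /= (@rint_EFin _ (fun x => h (x, y)))//.
apply: (@section_rintegrable (fun z => h (z.2, z.1)) G F y (swap_measurable mh) iF).
by move=> x z /=; rewrite mulrC.
Qed.

Lemma rintegrable_rint h F G : measurable_fun [set: R * R] h ->
  rintegrable F -> rintegrable G -> (forall x y, `|h (x, y)| <= F x * G y) ->
  rintegrable (fun x => rint (fun y => h (x, y))).
Proof.
move=> mh iF iG hFG.
have := integrable_fubini_F (prod_rintegrable mh iF iG hFG).
apply: eq_integrable => // x _; rewrite /fubini_F /=.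
by rewrite (rint_EFin (section_rintegrable x mh iG hFG)).
Qed.

Lemma cfubini H F G : cmfun H -> rintegrable F -> rintegrable G ->
  (forall x y, normc (H (x, y)) <= F x * G y) ->
  cint (fun x => cint (fun y => H (x, y))) = cint (fun y => cint (fun x => H (x, y))).
Proof.
move=> [mr mi] iF iG HFG; rewrite !cintE /=; congr (_ +i* _).
  apply: (rfubini mr iF iG) => x y; exact: le_trans (normRe_le _) (HFG x y).
apply: (rfubini mi iF iG) => x y; exact: le_trans (normIm_le _) (HFG x y).
Qed.

Lemma cintegrable_cint H F G : cmfun H -> rintegrable F -> rintegrable G ->
  (forall x y, normc (H (x, y)) <= F x * G y) ->
  cintegrable (fun x => cint (fun y => H (x, y))).
Proof.
move=> [mr mi] iF iG HFG; apply: cintegrableP => /=.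
  apply: (rintegrable_rint mr iF iG) => x y; exact: le_trans (normRe_le _) (HFG x y).
apply: (rintegrable_rint mi iF iG) => x y; exact: le_trans (normIm_le _) (HFG x y).
Qed.

(** A bounded kernel leaves a majorant of product form. The kernels met below are characters,
    indicators of half-planes, and characters along a segment. *)
Lemma cfubini_kernel f g (k : R * R -> R[i]) (M : R) :
  cintegrable f -> cintegrable g -> cmfun k -> (forall z, normc (k z) <= M) ->
  cint (fun x => f x * cint (fun y => g y * k (x, y))) =
  cint (fun y => g y * cint (fun x => f x * k (x, y))).
Proof.
move=> jf jg mk kM; pose H z := f z.1 * (g z.2 * k z).
have mH : cmfun H.
  apply: cmfunM; first exact: (cmfun_comp jf.1 measurable_fst).
  by apply: cmfunM => //; exact: (cmfun_comp jg.1 measurable_snd).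
have HM x y : normc (H (x, y)) <= normc (f x) * (M * normc (g y)).
  by rewrite !normcM ler_wpM2l ?normc_ge0// mulrC ler_wpM2r// normc_ge0.
have iG := rintegrableZl M jg.2.
transitivity (cint (fun x => cint (fun y => H (x, y)))).
  congr cint; apply/funext => x; rewrite -cintZ//.
  apply: (cintegrableMb jg (M := M)) => //.
  exact: (cmfun_comp mk (measurable_pair1 x)).
rewrite (cfubini mH jf.2 iG HM); congr cint; apply/funext => y.
rewrite -cintZ//; first by congr cint; apply/funext => x; rewrite /H /=; ring.
apply: (cintegrableMb jf (M := M)) => //.
exact: (cmfun_comp mk (measurable_pair2 y)).
Qed.

Lemma cintegrable_kernel f g (k : R * R -> R[i]) (M : R) :
  cintegrable f -> cintegrable g -> cmfun k -> (forall z, normc (k z) <= M) ->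
  cintegrable (fun x => f x * cint (fun y => g y * k (x, y))).
Proof.
move=> jf jg mk kM; pose H z := f z.1 * (g z.2 * k z).
have mH : cmfun H.
  apply: cmfunM; first exact: (cmfun_comp jf.1 measurable_fst).
  by apply: cmfunM => //; exact: (cmfun_comp jg.1 measurable_snd).
have HM x y : normc (H (x, y)) <= normc (f x) * (M * normc (g y)).
  by rewrite !normcM ler_wpM2l ?normc_ge0// mulrC ler_wpM2r// normc_ge0.
have := cintegrable_cint mH jf.2 (rintegrableZl M jg.2) HM.
congr cintegrable; apply/funext => x; rewrite -cintZ//.
apply: (cintegrableMb jg (M := M)) => //.
exact: (cmfun_comp mk (measurable_pair1 x)).
Qed.

End complex_fubini.

(** * Smooth functions *)

Section smooth_functions.
Context {R : realType}.
Implicit Types (f g t u : R -> R) (x y a b c : R).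

Definition smooth f := forall n x, derivable (derive1n n f) x 1.

Lemma der_add f g x a b : is_derive x 1 f a -> is_derive x 1 g b ->
  is_derive x 1 (fun y => f y + g y) (a + b).
Proof. by move=> df dg; exact: is_deriveD. Qed.

Lemma der_mul f g x a b : is_derive x 1 f a -> is_derive x 1 g b ->
  is_derive x 1 (fun y => f y * g y) (a * g x + f x * b).
Proof.
move=> df dg; apply: is_derive_eq (is_deriveM df dg) _.
by rewrite /GRing.scale /=; ring.
Qed.

Lemma der_comp f g x a b : is_derive (g x) 1 f a -> is_derive x 1 g b ->
  is_derive x 1 (fun y => f (g y)) (a * b).
Proof. by move=> df dg; exact: (is_derive1_comp df dg). Qed.

Lemma der_cst c x : is_derive x 1 (fun=> c : R) 0.
Proof. exact: is_derive_cst. Qed.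

Lemma der_affine a b x : is_derive x 1 (fun y => a * y + b) a.
Proof.
apply: is_derive_eq (der_add (der_mul (der_cst a x) (is_derive_id _ _)) (der_cst b x)) _.
by rewrite mul0r mulr1 add0r addr0.
Qed.

Lemma der_derive1 f x a : is_derive x 1 f a -> derivable f x 1 /\ derive1 f x = a.
Proof. by move=> df; split; [exact: ex_derive|rewrite derive1E derive_val]. Qed.

Lemma derive1_der f x : derivable f x 1 -> is_derive x 1 f (derive1 f x).
Proof. by move=> df; rewrite derive1E; exact: derivableP. Qed.

Lemma der_continuous f g : (forall x, is_derive x 1 f (g x)) -> continuous f.
Proof.
move=> df x; apply/differentiable_continuous/derivable1_diffP.
exact: (der_derive1 (df x)).1.
Qed.

Inductive algebra_gen (G : (R -> R) -> Prop) : (R -> R) -> Prop :=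
| gen_base f : G f -> algebra_gen G f
| gen_cst c : algebra_gen G (fun=> c)
| gen_add f g : algebra_gen G f -> algebra_gen G g -> algebra_gen G (fun x => f x + g x)
| gen_mul f g : algebra_gen G f -> algebra_gen G g -> algebra_gen G (fun x => f x * g x).

(* A set of functions whose derivatives lie in the algebra it generates spans
   an algebra closed under differentiation. *)
Lemma smooth_algebra (G : (R -> R) -> Prop) f :
  (forall g, G g -> exists2 g', algebra_gen G g' & forall x, is_derive x 1 g (g' x)) ->
  algebra_gen G f -> smooth f.
Proof.
move=> HG.
have H g : algebra_gen G g ->
    exists2 g', algebra_gen G g' & forall x, is_derive x 1 g (g' x).
  elim=> {g} [g /HG //|c|g h Gg [g' Gg' dg] Gh [h' Gh' dh]|g h Gg [g' Gg' dg] Gh [h' Gh' dh]].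
  - by exists (fun=> 0); [exact: gen_cst|move=> x; exact: der_cst].
  - by exists (fun x => g' x + h' x); [exact: gen_add|move=> x; exact: der_add].
  - exists (fun x => g' x * h x + g x * h' x); last by move=> x; exact: der_mul.
    by apply: gen_add; apply: gen_mul.
move=> Gf n; have [h -> /H[h' _ dh] x] : exists2 h, derive1n n f = h & algebra_gen G h.
  elim: n => [|n [h hE /H[h' Gh' dh]]]; first by exists f.
  exists h' => //; rewrite derive1nS hE; apply/funext => x.
  exact: (der_derive1 (dh x)).2.
exact: (der_derive1 (dh x)).1.
Qed.

Lemma smooth_derivable f x : smooth f -> derivable f x 1.
Proof. by move=> sf; exact: (sf 0%N x). Qed.

Lemma smooth_der f x : smooth f -> is_derive x 1 f (derive1 f x).
Proof. by move=> sf; apply: derive1_der; exact: smooth_derivable. Qed.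

Lemma smooth_derive1 f : smooth f -> smooth (derive1 f).
Proof. by move=> sf n x; rewrite -derive1Sn; exact: sf. Qed.

Lemma smooth_primitive f g : (forall x, is_derive x 1 f (g x)) -> smooth g -> smooth f.
Proof.
move=> df sg [|n] x; first exact: (der_derive1 (df x)).1.
rewrite derive1Sn (_ : derive1 f = g); first exact: sg.
by apply/funext => y; exact: (der_derive1 (df y)).2.
Qed.

Lemma smooth_continuous f : smooth f -> continuous f.
Proof. by move=> sf; apply: (@der_continuous _ (derive1 f)) => x; exact: smooth_der. Qed.

Lemma smooth_mul f g : smooth f -> smooth g -> smooth (fun x => f x * g x).
Proof.
move=> sf sg; apply: (@smooth_algebra smooth); last by apply: gen_mul; exact: gen_base.
move=> h sh; exists (derive1 h); first by apply: gen_base; exact: smooth_derive1.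
by move=> x; exact: smooth_der.
Qed.

Lemma smooth_affine f a b : smooth f -> smooth (fun x => f (a * x + b)).
Proof.
move=> sf; apply: (@smooth_algebra
    (fun g => exists2 h, smooth h & g = fun x => h (a * x + b))); last first.
  by apply: gen_base; exists f.
move=> _ [h sh ->]; exists (fun x => derive1 h (a * x + b) * a).
  apply: gen_mul; last exact: gen_cst.
  by apply: gen_base; exists (derive1 h) => //; exact: smooth_derive1.
by move=> x; apply: der_comp; [exact: smooth_der|exact: der_affine].
Qed.

Lemma der_cos_affine a x : is_derive x 1 (fun y => cos (a * y)) (- a * sin (a * x)).
Proof.
have d : is_derive x 1 (fun y => a * y) a.
  by have := der_affine a 0 x; under eq_fun do rewrite addr0.
by apply: is_derive_eq (der_comp (is_derive_cos (a * x)) d) _; ring.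
Qed.

Lemma der_sin_affine a x : is_derive x 1 (fun y => sin (a * y)) (a * cos (a * x)).
Proof.
have d : is_derive x 1 (fun y => a * y) a.
  by have := der_affine a 0 x; under eq_fun do rewrite addr0.
by apply: is_derive_eq (der_comp (is_derive_sin (a * x)) d) _; ring.
Qed.

Lemma smooth_cos_sin a : smooth (fun x => cos (a * x)) /\ smooth (fun x => sin (a * x)).
Proof.
pose G f := f = (fun x => cos (a * x)) \/ f = (fun x => sin (a * x)).
have HG f : G f -> exists2 f', algebra_gen G f' & forall x, is_derive x 1 f (f' x).
  case=> ->.
    exists (fun x => (- a) * sin (a * x)); last by move=> x; exact: der_cos_affine.
    by apply: gen_mul; [exact: gen_cst|apply: gen_base; right].
  exists (fun x => a * cos (a * x)); last by move=> x; exact: der_sin_affine.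
  by apply: gen_mul; [exact: gen_cst|apply: gen_base; left].
by split; apply: (smooth_algebra HG); apply: gen_base; [left|right].
Qed.

(** The classical flat function [exp (- 1 / x)]; the factor [x^-k] makes the family closed under
    differentiation up to linear combinations. *)
Definition flat (k : nat) (x : R) : R :=
  if 0 < x then x^-1 ^+ k * expR (- x^-1) else 0.

Lemma flat_ge0 k x : 0 <= flat k x.
Proof.
by rewrite /flat; case: ifPn => // x0; rewrite mulr_ge0 ?expR_ge0// exprn_ge0// invr_ge0 ltW.
Qed.

(** With [y = x^-1], the exponential series gives [y ^ k / k! <= exp y]; the larger factorial is
    slack. *)
Lemma flat_le k x : flat k x <= k.+1`!%:R.
Proof.
rewrite /flat; case: ifPn => [x0|_]; last by rewrite ler0n.
have y0 : 0 <= x^-1 by rewrite invr_ge0 ltW.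
rewrite expRN ler_pdivrMr ?expR_gt0//.
case: k => [|k]; first by rewrite expr0 mul1r -expR0 ler_expR.
have := expR_ge1Dxn k y0.
have f0 : 0 < k.+1`!%:R :> R by rewrite ltr0n fact_gt0.
rewrite -lerBrDl ler_pdivrMr// => h; apply: (le_trans h).
rewrite [leRHS]mulrC ler_pM//; last by rewrite ler_nat factS leq_pmull.
  by rewrite subr_ge0 -expR0 ler_expR.
by rewrite gerBl.
Qed.

Lemma flat0_le1 x : flat 0 x <= 1.
Proof. exact: flat_le. Qed.

Lemma flatS k x : flat k x = flat k.+1 x * x.
Proof.
rewrite /flat; case: ifPn => [x0|_]; last by rewrite mul0r.
rewrite exprS -[LHS]mul1r -(@mulVf _ x) ?gt_eqF//.
by move: x^-1 (expR _) => y z; ring.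
Qed.

Lemma flat_le0 k x : x <= 0 -> flat k x = 0.
Proof. by move=> x0; rewrite /flat ifF// le_gtF. Qed.

Lemma der_flat k x : is_derive x 1 (flat k) (flat k.+2 x - k%:R * flat k.+1 x).
Proof.
have [x0|x0|->] := ltgtP x 0.
- rewrite !flat_le0 ?ltW// mulr0 subr0.
  apply: (near_eq_is_derive _ (der_cst 0 x)).
  near=> z; rewrite flat_le0// ltW//.
  by near: z; exact: lt_nbhsl.
- have V : is_derive x 1 (fun y : R => y^-1) (- x ^- 2).
    apply: is_derive_eq (is_deriveV _ (is_derive_id x 1)) _; first by rewrite gt_eqF.
    by rewrite /GRing.scale /= mulr1.
  have P : is_derive x 1 (fun y : R => y^-1 ^+ k) (k%:R * x^-1 ^+ k.-1 * - x ^- 2).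
    have -> : (fun y : R => y^-1 ^+ k) = (fun y : R => y^-1) ^+ k.
      by apply/funext => y; rewrite exprfctE.
    exact: is_deriveX.
  have N : is_derive x 1 (fun y : R => - y^-1) (x ^- 2).
    by apply: is_derive_eq (is_deriveN V) _; rewrite opprK.
  have E := @der_comp expR (fun y => - y^-1) x _ _ (is_derive_expR (- x^-1)) N.
  apply: (near_eq_is_derive _ (is_derive_eq (der_mul P E) _)).
    near=> z; rewrite /flat ifT//; near: z; exact: lt_nbhsr.
  rewrite /flat !ifT// -exprVn; case: k {P} => [|k] /=.
    by rewrite !expr0; ring.
  by rewrite !exprS expr0; ring.
(* At the origin the difference quotient is [flat k.+1], which equals [flat k.+2 z * z] and so tends
   to [0] because [flat k.+2] is bounded. *)
- rewrite !flat_le0// mulr0 subr0; apply/is_derive1_caratheodory.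
  exists (flat k.+1); split; last by rewrite flat_le0.
    by move=> z; rewrite [flat k 0]flat_le0// !subr0 flatS.
  apply/cvgrPdist_le => e e0; rewrite [flat _ 0]flat_le0//.
  near=> z; rewrite sub0r normrN flatS normrM ger0_norm ?flat_ge0//.
  have F0 : 0 < k.+3`!%:R :> R by rewrite ltr0n fact_gt0.
  apply: (@le_trans _ _ (k.+3`!%:R * `|z|)); first by rewrite ler_wpM2r// flat_le.
  rewrite mulrC -ler_pdivlMr//.
  near: z; apply: (@cvgr0_norm_le _ _ _ _ _ id) => //; last by rewrite divr_gt0.
Unshelve. all: by end_near. Qed.

Lemma smooth_flat k : smooth (flat k).
Proof.
apply: (@smooth_algebra (fun f => exists k, f = flat k)); last by apply: gen_base; exists k.
move=> _ [n ->]; exists (fun x => flat n.+2 x + (- n%:R) * flat n.+1 x); last first.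
  by move=> x; rewrite mulNr; exact: der_flat.
apply: gen_add; first by apply: gen_base; exists n.+2.
by apply: gen_mul; [exact: gen_cst|apply: gen_base; exists n.+1].
Qed.

Lemma cvg_flat0 (un : nat -> R) : un n @[n --> \oo] --> +oo ->
  flat 0 (un n) @[n --> \oo] --> (1 : R).
Proof.
move=> uoo.
have Voo : (un n)^-1 @[n --> \oo] --> (0 : R).
  apply/gtr0_cvgV0 => //.
  by have /cvgryPgt/(_ 0) := uoo.
have E : expR (- (un n)^-1) @[n --> \oo] --> (1 : R).
  rewrite -[X in _ --> X]expR0 -oppr0.
  by apply: continuous_cvg; [exact: continuous_expR|exact: cvgN].
apply: cvg_trans E; apply: near_eq_cvg.
have /cvgryPgt/(_ 0) := uoo; apply: filterS => n n0.
by rewrite /flat n0 expr0 mul1r.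
Qed.

Lemma cvg_flat2 (un : nat -> R) : un n @[n --> \oo] --> +oo ->
  flat 2 (un n) @[n --> \oo] --> (0 : R).
Proof.
move=> uoo.
have Voo : (un n)^-1 @[n --> \oo] --> (0 : R).
  apply/gtr0_cvgV0 => //.
  by have /cvgryPgt/(_ 0) := uoo.
apply: (squeeze_cvgr _ (cvg_cst 0) (_ : (2`!%:R * (un n)^-1) @[n --> \oo] --> _)).
  have /cvgryPgt/(_ 0) := uoo; apply: filterS => n n0.
  rewrite flat_ge0 /= ler_pdivlMr// -flatS; exact: flat_le.
by rewrite -[X in _ --> X](mulr0 (2`!%:R)); exact: cvgMr.
Qed.

Lemma test_functionP t a b : smooth t -> (forall x, t x != 0 -> a <= x <= b) ->
  test_function t.
Proof.
move=> st tab; split=> //.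
have sub : closure [set x | t x != 0] `<=` `[a, b]%classic.
  apply: (subset_trans (closure_subset _)) (_ : closure `[a, b] `<=` _).
    by move=> x /= /tab xab; rewrite in_itv.
  by rewrite -(closure_id `[a, b]).1//; exact: interval_closed.
by apply: (subclosed_compact _ (@segment_compact R a b)) => //; exact: closed_closure.
Qed.

End smooth_functions.

(** * Weak derivatives of integrable functions *)

Section weak_derivatives.
Context {R : realType}.
Local Notation mu := (@lebesgue_measure R).
Implicit Types (f g h w : R -> R[i]) (t u : R -> R) (s x y a b : R).

Lemma clim_unique (z : nat -> R[i]) (v w : R[i]) :
  normc (z n - v) @[n --> \oo] --> 0 -> normc (z n - w) @[n --> \oo] --> 0 -> v = w.
Proof.
move=> zv zw; apply/eqP; rewrite -subr_eq0; apply/eqP/normc_eq0.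
apply/eqP; rewrite eq_le normc_ge0 andbT.
have : normc (z n - v) + normc (z n - w) @[n --> \oo] --> 0.
  by rewrite -[X in _ --> X]addr0; exact: cvgD.
move=> cv; apply: (cvgr_to_ge cv); apply: nearW => n.
have -> : v - w = (z n - w) - (z n - v) by ring.
by rewrite [leRHS]addrC; exact: normcB.
Qed.

(** The kernel of integration over half-lines. In [x] it cuts to the right of [s], in [s] to the
    left of [x]; Fubini exchanges the two readings, and this exchange is how integration by parts is
    carried out. *)
Definition below s x : R := (s < x)%R%:R.

Lemma cvg_normc_scale (z : R[i]) (a : nat -> R) (b : R) : a n @[n --> \oo] --> b ->
  normc (z * (a n)%:C - z * b%:C) @[n --> \oo] --> 0.
Proof.
move=> ab; rewrite (_ : (fun n => _) = (fun n => normc z * `|a n - b|)); last first.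
  by apply/funext => n; rewrite -mulrBr -rmorphB normcM normc_real.
rewrite -[X in _ --> X](mulr0 (normc z)); apply: cvgMr.
have c0 : a n - b @[n --> \oo] --> b - b by apply: cvgB => //; exact: cvg_cst.
by rewrite subrr in c0; exact/norm_cvg0P.
Qed.

Lemma below_le1 s x : `|below s x| <= 1.
Proof. by rewrite /below; case: (s < x); rewrite ?normr1 ?normr0. Qed.

Lemma measurable_lt_pair : measurable_fun [set: R * R] (fun z => below z.1 z.2).
Proof.
have -> : (fun z : R * R => below z.1 z.2) = fun z => if z.1 < z.2 then 1 else 0.
  by apply/funext => z; rewrite /below; case: ifP.
apply: measurable_fun_ifT => //.
by apply: measurable_fun_ltr; [exact: measurable_fst|exact: measurable_snd].
Qed.

Lemma measurable_lt1 x : measurable_fun [set: R] (fun s => below s x).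
Proof. exact: (measurableT_comp measurable_lt_pair (measurable_pair2 x)). Qed.

Lemma measurable_lt2 s : measurable_fun [set: R] (fun x => below s x).
Proof. exact: (measurableT_comp measurable_lt_pair (measurable_pair1 s)). Qed.

Lemma rintegrable_lt u x : rintegrable u -> rintegrable (fun s => u s * below s x).
Proof.
move=> iu; apply: (@le_rintegrable _ _ (fun s => `|u s|)); last exact: integrable_norm.
  apply: measurable_funM; [exact: rintegrable_measurable|exact: measurable_lt1].
by move=> s; rewrite normrM ler_piMr// below_le1.
Qed.

Lemma Rintegral_Ny u x : rintegrable u ->
  Rintegral mu `]-oo, x] u = rint (fun s => u s * below s x).
Proof.
move=> iu; rewrite -Rintegral_itv_bndo_bndc; last first.
  exact: (integrableS measurableT).
rewrite Rintegral_mkcond; congr rint; apply/funext => s.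
rewrite patchE /below; case: ifPn.
  by rewrite inE /= in_itv/= => ->; rewrite mulr1.
by rewrite notin_setE /= in_itv/= => /negP/negbTE ->; rewrite mulr0.
Qed.

Lemma der_primitive u x : rintegrable u -> continuous u ->
  is_derive x 1 (fun y => rint (fun s => u s * below s y)) (u x).
Proof.
move=> iu cu; under eq_fun do rewrite -Rintegral_Ny//.
have xx1 : x < x + 1 by rewrite ltrDl.
have iu1 : mu.-integrable [set` Interval -oo%O (BRight (x + 1))] (EFin \o u).
  exact: (integrableS measurableT).
have [dF dE] := @continuous_FTC1 R u -oo%O x (x + 1) xx1 iu1 (ltNyr _) (cu x).
by rewrite -dE; exact: derive1_der.
Qed.

Definition bump_function t := [/\ smooth t, forall x, 0 <= t x <= 1 &
  exists ab : R * R, forall x, t x != 0 -> ab.1 <= x <= ab.2].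

Lemma bump_test t : bump_function t -> test_function t.
Proof. by move=> [st _ [[a b] tab]]; exact: test_functionP tab. Qed.

Lemma smooth_measurable t : smooth t -> measurable_fun [set: R] t.
Proof. by move=> st; apply: continuous_measurable_fun; exact: smooth_continuous. Qed.

Lemma bump_rintegrable t : bump_function t -> rintegrable t.
Proof.
move=> [st t01 [[a b] /= tab]].
apply: (@le_rintegrable _ _ (\1_`[a, b])); first exact: smooth_measurable.
  move=> x; rewrite indicE; have [tx0|/tab xab] := eqVneq (t x) 0.
    by rewrite tx0 normr0.
  rewrite mem_set ?in_itv//=; have /andP[t0 t1] := t01 x.
  by rewrite ger0_norm.
exact: integrable_indic_itv.
Qed.

Lemma cvg_shift_natr (c x : R) : (c * x + n%:R : R) @[n --> \oo] --> +oo.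
Proof.
apply/cvgryPge => M; near=> n; rewrite -lerBlDl.
by near: n; exact: nbhs_infty_ger.
Unshelve. all: by end_near. Qed.

(** The first factor cuts off below [- n], the second above [x]. For [y < x] both arguments tend to
    infinity with [n], so these bumps converge to the indicator of the half-line to the left of
    [x]. *)
Definition half_line_bump x (n : nat) y : R :=
  flat 0 (1 * y + n%:R) * flat 0 (- n%:R * y + n%:R * x).

Lemma half_line_bumpP x n : bump_function (half_line_bump x n).
Proof.
split.
- by apply: smooth_mul; apply: smooth_affine; exact: smooth_flat.
- move=> y; rewrite mulr_ge0 ?flat_ge0//=.
  by rewrite mulr_ile1 ?flat_ge0 ?flat0_le1.
- exists (- n%:R, x) => y /=; apply: contraR; rewrite /half_line_bump negb_and -!ltNge.
  case/orP => [yn|xy].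
    by rewrite flat_le0 ?mul0r// mul1r -lerBrDr sub0r ltW.
  rewrite [X in _ * X]flat_le0 ?mulr0// mulNr addrC subr_le0.
  by rewrite ler_wpM2l// ltW.
Qed.

Lemma cvg_half_line_bump x y :
  half_line_bump x n y @[n --> \oo] --> below y x.
Proof.
rewrite /half_line_bump /below; have [yx|xy] := ltP y x; last first.
  under eq_fun do rewrite [X in _ * X]flat_le0 ?mulr0 1?mulNr 1?addrC ?subr_le0 ?ler_wpM2l//.
  exact: cvg_cst.
rewrite -[X in _ --> X](mulr1 1); apply: cvgM; apply: cvg_flat0.
  exact: cvg_shift_natr.
have xy0 : 0 < x - y by rewrite subr_gt0.
apply/cvgryPge => M; near=> n; rewrite mulNr addrC -mulrBr -ler_pdivrMr//.
by near: n; exact: nbhs_infty_ger.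
Unshelve. all: by end_near.
Qed.

Lemma bump_vanish_below (k : R -> R) x : rintegrable k ->
  (forall t, bump_function t -> rint (fun x => k x * t x) = 0) ->
  rint (fun s => k s * below s x) = 0.
Proof.
move=> ik kt.
have mb n : measurable_fun [set: R] (half_line_bump x n).
  by apply: smooth_measurable; case: (half_line_bumpP x n).
have mk := rintegrable_measurable ik.
have b1 n y : `|half_line_bump x n y| <= 1.
  by have [_ /(_ y)/andP[b0 b1] _] := half_line_bumpP x n; rewrite ger0_norm.
have E (l : R -> R) : cint (fun y => (k y)%:C * (l y)%:C) = (rint (fun y => k y * l y))%:C.
  by rewrite -cint_real; congr cint; apply/funext => y; rewrite rmorphM.
have mkC : cmfun (fun y => (k y)%:C) by exact: cmfun_real.
have [|||||_ ] := @cint_dominated R (fun n y => (k y)%:C * (half_line_bump x n y)%:C)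
  (fun y => (k y)%:C * (below y x)%:C) (fun y => `|k y|) _ _ _ _ _.
- by move=> n; apply: cmfunM => //; exact: cmfun_real.
- by apply: cmfunM => //; apply: cmfun_real; exact: measurable_lt1.
- exact: integrable_norm.
- by move=> n y; rewrite normcM !normc_real ler_piMr.
- by move=> y; apply: cvg_normc_scale; exact: cvg_half_line_bump.
rewrite E (_ : (fun n => _) = fun=> normc (0 - (rint (fun y => k y * below y x))%:C)).
  move=> c0; have [<- //] : 0 = (rint (fun y => k y * below y x))%:C.
  apply: (@clim_unique (fun=> 0)) c0.
  by rewrite (_ : (fun n => _) = fun=> 0); [exact: cvg_cst|rewrite subrr normc0].
by apply/funext => n; rewrite E kt//; exact: half_line_bumpP.
Qed.

(** Bumps approximate half-lines, so the primitive of [k] from minus infinity vanishes identically;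
    Lebesgue differentiation then gives [k = 0] almost everywhere. *)
Lemma bump_ae_eq0 (k : R -> R) : rintegrable k ->
  (forall t, bump_function t -> rint (fun x => k x * t x) = 0) ->
  {ae mu, forall x, k x = 0}.
Proof.
move=> ik kt.
have F0 : (fun x => Rintegral mu `]-oo, x] k) = fun=> 0.
  by apply/funext => x; rewrite Rintegral_Ny// bump_vanish_below.
have lk : locally_integrable [set: R] k by exact: open_integrable_locally openT ik.
have iy y : mu.-integrable `]-oo, y] (EFin \o k) by exact: (integrableS measurableT).
have := @FTC1Ny R k iy lk.
rewrite /= F0; apply: ae_imply => x [_].
by move=> <-; exact: derive1_cst.
Qed.

Lemma cbump_ae_eq0 w : cintegrable w ->
  (forall t, bump_function t -> cint (fun x => w x * (t x)%:C) = 0) ->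
  {ae mu, forall x, w x = 0}.
Proof.
move=> jw wt.
have re : {ae mu, forall x, Re (w x) = 0}.
  apply: bump_ae_eq0; first exact: cintegrable_Re.
  move=> t /wt; rewrite cintE => -[+ _]; move=> <-; congr rint.
  by apply/funext => x; rewrite ReM /= mulr0 subr0.
have im : {ae mu, forall x, Im (w x) = 0}.
  apply: bump_ae_eq0; first exact: cintegrable_Im.
  move=> t /wt; rewrite cintE => -[_ +]; move=> <-; congr rint.
  by apply/funext => x; rewrite ImM /= mulr0 add0r.
apply: ae_imply2 re im => x wr wi; apply/eqP.
by rewrite eq_complex wr wi !eqxx.
Qed.

(** Both functions are integrable over the whole line here, whereas [is_weak_derivative] speaks of
    locally integrable ones. Global integrability is what allows bounded test functions and
    primitives from infinity. *)
Definition weak1 f h := [/\ cintegrable f, cintegrable h &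
  forall t, test_function t -> cint (fun x => f x * (derive1 t x)%:C) =
    - cint (fun x => h x * (t x)%:C)].

(** Converges to [1] pointwise, while its derivative [cutoff'] is bounded uniformly in [n] and tends
    to [0]; dominated convergence then removes the cutoff. *)
Definition cutoff (n : nat) x : R := flat 0 (1 * x + n%:R) * flat 0 (-1 * x + n%:R).
Definition cutoff' (n : nat) x : R :=
  flat 2 (1 * x + n%:R) * flat 0 (-1 * x + n%:R) -
  flat 0 (1 * x + n%:R) * flat 2 (-1 * x + n%:R).

Lemma der_cutoff n x : is_derive x 1 (cutoff n) (cutoff' n x).
Proof.
have d c : is_derive x 1 (fun y => flat 0 (c * y + n%:R)) (flat 2 (c * x + n%:R) * c).
  have := @der_comp _ (flat 0) (fun y => c * y + n%:R) x _ _ (der_flat 0 _) (der_affine c n%:R x).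
  by rewrite mul0r subr0.
by apply: is_derive_eq (der_mul (d 1) (d (-1))) _; rewrite /cutoff'; ring.
Qed.

Lemma smooth_cutoff n : smooth (cutoff n).
Proof. by apply: smooth_mul; apply: smooth_affine; exact: smooth_flat. Qed.

Lemma cutoff_support n x : cutoff n x != 0 -> - n%:R <= x <= n%:R.
Proof.
apply: contraR; rewrite /cutoff negb_and -!ltNge.
case/orP => [xn|nx].
  by rewrite flat_le0 ?mul0r// mul1r -lerBrDr sub0r ltW.
by rewrite [X in _ * X]flat_le0 ?mulr0// mulN1r addrC subr_le0 ltW.
Qed.

Lemma cutoff_le1 n x : `|cutoff n x| <= 1.
Proof.
by rewrite ger0_norm ?mulr_ge0 ?flat_ge0// mulr_ile1 ?flat_ge0 ?flat0_le1.
Qed.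

Lemma cutoff'_le n x : `|cutoff' n x| <= 12%:R.
Proof.
have h2 (y z : R) : 0 <= flat 2 y * flat 0 z <= 6%:R.
  rewrite mulr_ge0 ?flat_ge0//= -[leRHS]mulr1 ler_pM ?flat_ge0 ?flat0_le1//.
  exact: (flat_le 2).
rewrite /cutoff' [flat 0 _ * flat 2 _]mulrC.
have := h2 (1 * x + n%:R) (-1 * x + n%:R).
have := h2 (-1 * x + n%:R) (1 * x + n%:R).
by rewrite ler_norml => /andP[? ?] /andP[? ?]; apply/andP; split; lra.
Qed.

Lemma cvg_cutoff x : cutoff n x @[n --> \oo] --> (1 : R).
Proof.
rewrite -[X in _ --> X](mulr1 1); apply: cvgM; apply: cvg_flat0;
  exact: cvg_shift_natr.
Qed.

Lemma cvg_cutoff' x : cutoff' n x @[n --> \oo] --> (0 : R).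
Proof.
have -> : (0 : R) = 0 * 1 - 1 * 0 by rewrite mul0r mulr0 subr0.
by apply: cvgB; apply: cvgM; (apply: cvg_flat0 || apply: cvg_flat2);
  exact: cvg_shift_natr.
Qed.

(* Multiplying by the cutoff functions extends the test functions to smooth
   functions that are bounded together with their derivative. *)
Lemma weak1_bounded f h t t' (M M' : R) : weak1 f h -> smooth t ->
  (forall x, is_derive x 1 t (t' x)) ->
  (forall x, `|t x| <= M) -> (forall x, `|t' x| <= M') ->
  cint (fun x => f x * (t' x)%:C) = - cint (fun x => h x * (t x)%:C).
Proof.
move=> [jf jh fh] st dt tM t'M.
have t'E : derive1 t = t' by apply/funext => x; exact: (der_derive1 (dt x)).2.
have mt : measurable_fun [set: R] t by exact: smooth_measurable.
have mt' : measurable_fun [set: R] t'.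
  by rewrite -t'E; apply: smooth_measurable; exact: smooth_derive1.
have mc n : measurable_fun [set: R] (cutoff n) by apply: smooth_measurable; exact: smooth_cutoff.
have mc' n : measurable_fun [set: R] (cutoff' n).
  have -> : cutoff' n = derive1 (cutoff n).
    by apply/funext => x; rewrite (der_derive1 (der_cutoff n x)).2.
  by apply: smooth_measurable; apply: smooth_derive1; exact: smooth_cutoff.
have M0 : 0 <= M by rewrite (le_trans _ (tM 0)).
have M'0 : 0 <= M' by rewrite (le_trans _ (t'M 0)).
have [|||||_ hc] := @cint_dominated R (fun n y => h y * (t y * cutoff n y)%:C)
  (fun y => h y * (t y)%:C) (fun y => M * normc (h y)) _ _ _ _ _.
- by move=> n; apply: cmfunM jh.1 _; apply: cmfun_real; exact: measurable_funM.
- by apply: cmfunM jh.1 _; exact: cmfun_real.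
- by apply: rintegrableZl; exact: jh.2.
- move=> n y; rewrite normcM normc_real mulrC ler_wpM2r ?normc_ge0//.
  by rewrite normrM -[leRHS]mulr1 ler_pM// cutoff_le1.
- move=> y; apply: cvg_normc_scale.
  by rewrite -[X in _ --> X]mulr1; apply: cvgMr; exact: cvg_cutoff.
have [|||||_ fc] := @cint_dominated R
  (fun n y => f y * (t' y * cutoff n y + t y * cutoff' n y)%:C)
  (fun y => f y * (t' y)%:C) (fun y => (M' + M * 12%:R) * normc (f y)) _ _ _ _ _.
- move=> n; apply: cmfunM jf.1 _; apply: cmfun_real.
  by apply: measurable_funD; exact: measurable_funM.
- by apply: cmfunM jf.1 _; exact: cmfun_real.
- by apply: rintegrableZl; exact: jf.2.
- move=> n y; rewrite normcM normc_real mulrC ler_wpM2r ?normc_ge0//.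
  rewrite (le_trans (ler_normD _ _))// normrM [`|t y * _|]normrM lerD//.
    by rewrite -[leRHS]mulr1 ler_pM// cutoff_le1.
  by rewrite ler_pM// cutoff'_le.
- move=> y; apply: cvg_normc_scale.
  rewrite -[X in _ --> X]addr0; apply: cvgD.
    by rewrite -[X in _ --> X]mulr1; apply: cvgMr; exact: cvg_cutoff.
  by rewrite -(mulr0 (t y)); apply: cvgMr; exact: cvg_cutoff'.
apply: (clim_unique fc).
rewrite (_ : (fun n => _) = (fun n => normc (cint (fun y => h y * (t y * cutoff n y)%:C) -
  cint (fun y => h y * (t y)%:C))))//; apply/funext => n.
have sn : smooth (fun x => t x * cutoff n x) by apply: smooth_mul => //; exact: smooth_cutoff.
have tn : test_function (fun x => t x * cutoff n x).
  apply: (@test_functionP _ _ (- n%:R) n%:R) => // x.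
  by rewrite mulf_eq0 negb_or => /andP[_]; exact: cutoff_support.
have := fh _ tn.
have -> : derive1 (fun x => t x * cutoff n x) = (fun y => t' y * cutoff n y + t y * cutoff' n y).
  by apply/funext => x; rewrite (der_derive1 (der_mul (dt x) (der_cutoff n x))).2.
by move=> ->; rewrite -normcN; congr normc; ring.
Qed.

(** Encodes [f s = - \int_s^oo h]. Integrating from infinity fixes the constant of integration, and
    no pointwise differentiability has to be mentioned. *)
Definition absc f h := [/\ cintegrable f, cintegrable h &
  {ae mu, forall s, f s = - cint (fun x => h x * (below s x)%:C)}].

Lemma cmfun_below : cmfun (fun z : R * R => (below z.1 z.2)%:C).
Proof. by apply: cmfun_real; exact: measurable_lt_pair. Qed.

Lemma normc_below (z : R * R) : normc ((below z.1 z.2)%:C) <= 1.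
Proof. by rewrite normc_real below_le1. Qed.

Lemma bump_cutoff n t : bump_function t -> bump_function (fun x => cutoff n x * t x).
Proof.
move=> [st t01 [[a b] tab]]; split.
- by apply: smooth_mul => //; exact: smooth_cutoff.
- move=> x; have /andP[t0 t1] := t01 x.
  have c1 := cutoff_le1 n x.
  have c0 : 0 <= cutoff n x by rewrite mulr_ge0 ?flat_ge0.
  by rewrite mulr_ge0//= mulr_ile1//; rewrite ger0_norm in c1.
- exists (- n%:R, n%:R) => x; rewrite mulf_eq0 negb_or => /andP[+ _].
  exact: cutoff_support.
Qed.

Lemma cutoff_bump n : bump_function (cutoff n).
Proof.
split; first exact: smooth_cutoff.
  by move=> x; have := cutoff_le1 n x; rewrite ger0_norm mulr_ge0 ?flat_ge0.
by exists (- n%:R, n%:R) => x; exact: cutoff_support.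
Qed.

Lemma cutoff_gt0 n x : `|x| < n%:R -> 0 < cutoff n x.
Proof.
rewrite ltr_norml => /andP[nx xn].
have f0 y : 0 < y -> 0 < flat 0 y.
  by move=> y0; rewrite /flat y0 expr0 mul1r expR_gt0.
by rewrite mulr_gt0// f0//; lra.
Qed.

(** The difference [W] of the two sides is tested against bumps. The primitive [T] of a bump [u] is
    an admissible test function by [weak1_bounded], and Fubini turns the pairing of [h] with [T]
    into the pairing of [u] with the integrals of [h] over half-lines. *)
Lemma weak1_absc f h : weak1 f h -> absc f h.
Proof.
move=> wfh; have [jf jh _] := wfh; split=> //.
pose W (s : R) : R[i] := f s + cint (fun x => h x * (below s x)%:C).
(* [W] is an integrable function plus a bounded one. The factor [cutoff n] makes it integrable, as
   [cbump_ae_eq0] demands, and is positive for [|s| < n], so it can be divided out at the end. *)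
have H n : {ae mu, forall s, (cutoff n s)%:C * W s = 0}.
  have jc : cintegrable (fun s => (cutoff n s)%:C).
    by apply: cintegrable_real; apply: bump_rintegrable; exact: cutoff_bump.
  have ck := cintegrable_kernel jc jh cmfun_below normc_below.
  have mc : cmfun (fun s => (cutoff n s)%:C) by exact: jc.1.
  have nc s : normc ((cutoff n s)%:C) <= 1 by rewrite normc_real cutoff_le1.
  have fc := cintegrableMb jf mc nc.
  have WE : (fun s => (cutoff n s)%:C * W s) = fun s => f s * (cutoff n s)%:C +
      (cutoff n s)%:C * cint (fun x => h x * (below s x)%:C).
    by apply/funext => s; rewrite /W mulrDr mulrC.
  apply: cbump_ae_eq0; first by rewrite WE; exact: cintegrableD.
  move=> t bt; pose u s := cutoff n s * t s.
  have bu : bump_function u by exact: bump_cutoff.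
  have [su u01 _] := bu; have iu := bump_rintegrable bu.
  (* To the right of the support of [u], [T] is constant, and this constant is in general not [0]:
     [T] is bounded with bounded derivative but not compactly supported. *)
  pose T x := rint (fun s => u s * below s x).
  have cu : continuous u by exact: smooth_continuous.
  have dT x : is_derive x 1 T (u x) by exact: der_primitive.
  have sT : smooth T by exact: smooth_primitive dT su.
  have u1 x : `|u x| <= 1 by have /andP[u0 ?] := u01 x; rewrite ger0_norm.
  have TM x : `|T x| <= rint u.
    rewrite ger0_norm; last first.
      by apply: rint_ge0 => s; have /andP[u0 _] := u01 s; rewrite mulr_ge0// ler0n.
    apply: le_rint => //; first exact: rintegrable_lt.
    move=> s; have /andP[u0 _] := u01 s; rewrite ler_piMr//.
    by rewrite (le_trans (ler_norm _))// below_le1.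
  have fu := weak1_bounded wfh sT dT TM u1.
  have ju : cintegrable (fun s => (u s)%:C) by exact: cintegrable_real.
  have nu s : normc ((u s)%:C) <= 1 by rewrite normc_real.
  transitivity (cint (fun s => f s * (u s)%:C +
      (u s)%:C * cint (fun x => h x * (below s x)%:C))).
congr cint; apply/funext => s; rewrite /u /W.
    by move: (cutoff n s) (t s) (cint _) (f s) => a b d e; rewrite rmorphM; ring.
  rewrite cintD; [|exact: (cintegrableMb jf ju.1 nu)
    |exact: (cintegrable_kernel ju jh cmfun_below normc_below)].
  rewrite (cfubini_kernel ju jh cmfun_below normc_below) fu addrC -[X in X - _]opprK.
  apply/eqP; rewrite subr_eq0 opprK; apply/eqP; congr cint; apply/funext => x.
  congr (_ * _); rewrite /T -cint_real; congr cint; apply/funext => s.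
  by rewrite -rmorphM.
have := ae_foralln H; apply: ae_imply => s Hs.
have [n sn] : exists n, `|s| < n%:R.
  by exists (Num.truncn `|s|).+1; exact: truncnS_gt.
apply/eqP; rewrite -addr_eq0; apply/eqP.
have := Hs n => /eqP; rewrite mulf_eq0 => /orP[|/eqP //].
by rewrite eq_complex /= gt_eqF ?cutoff_gt0.
Qed.

Lemma test_support t : test_function t ->
  exists2 M, 0 <= M & forall x, M < `|x| -> t x = 0 /\ derive1 t x = 0.
Proof.
move=> [_ ct]; have [N [_ HN]] := compact_bounded ct.
have N1 : N < `|N| + 1 by rewrite (le_lt_trans (ler_norm N))// ltrDl.
have t0 x : `|N| + 1 < `|x| -> t x = 0.
  move=> Nx; apply/eqP; apply: contraPT Nx => tx; apply/negP; rewrite -leNgt.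
  by apply: (HN _ N1); exact: subset_closure.
exists (`|N| + 1); first by rewrite addr_ge0.
move=> x Nx; split; first exact: t0.
have d0 := der_cst 0 x; apply: (der_derive1 (near_eq_is_derive _ d0)).2.
have e0 : 0 < `|x| - (`|N| + 1) by rewrite subr_gt0.
near=> y; apply/esym/t0.
have : `|x - y| < `|x| - (`|N| + 1) by near: y; exact: cvgr_dist_lt.
by have := ler_distD y x 0; rewrite !subr0; lra.
Unshelve. all: by end_near. Qed.

Lemma test_derive1_rintegrable t : test_function t -> rintegrable (derive1 t).
Proof.
move=> tt; have [st ct] := tt; have [M M0 HM] := test_support tt.
have sd : smooth (derive1 t) by exact: smooth_derive1.
have iM : mu.-integrable `[- M, M] (EFin \o derive1 t).
  apply: continuous_compact_integrable; first exact: segment_compact.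
  by apply: continuous_subspaceT; exact: smooth_continuous.
have : mu.-integrable setT ((EFin \o derive1 t) \_ `[- M, M]).
  by apply/integrable_restrict => //; rewrite setTI.
apply: eq_integrable => // x _; rewrite patchE /=; case: ifPn => //.
rewrite notin_setE/= in_itv/= => /negP; rewrite -ler_norml -ltNge => /HM[_ ->].
by [].
Qed.

(** Both sides have the same derivative and vanish far to the left. *)
Lemma test_primitive t x : test_function t ->
  rint (fun s => derive1 t s * below s x) = t x.
Proof.
move=> tt; have [st ct] := tt; have [M M0 HM] := test_support tt.
have id := test_derive1_rintegrable tt.
have cd : continuous (derive1 t) by apply: smooth_continuous; exact: smooth_derive1.
pose T y := rint (fun s => derive1 t s * below s y).
have D y : is_derive y 1 (fun y => T y - t y) 0.
  apply: is_derive_eq (is_deriveB (der_primitive y id cd) (smooth_der y st)) _.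
  by rewrite subrr.
have TT y z : T y - t y = T z - t z by exact: (is_derive_0_is_cst y z D).
apply/eqP; rewrite -subr_eq0; apply/eqP; rewrite (TT x (- (M + 1))).
have nM (y : R) : y <= - (M + 1) -> M < `|y|.
  by move=> yM; rewrite ler0_norm; lra.
rewrite (HM _ (nM _ (lexx _))).1 subr0 /T.
rewrite (_ : (fun s => _) = fun=> 0); first by rewrite /rint Rintegral_cst// mul0r.
apply/funext => s; rewrite /below; case: ltP => [sM|_]; last by rewrite mulr0.
by rewrite (HM _ (nM _ (ltW sM))).2 mul0r.
Qed.

(** Fubini moves [below] from [h] onto [derive1 t], whose integral up to [x] is [t x]. *)
Lemma absc_weak1 f h : absc f h -> weak1 f h.
Proof.
move=> [jf jh fE]; split=> // t tt; have [st _] := tt.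
have id := test_derive1_rintegrable tt.
have jd : cintegrable (fun s => (derive1 t s)%:C) by exact: cintegrable_real.
have jk := cintegrable_kernel jd jh cmfun_below normc_below.
rewrite (@ae_eq_cint _ _ (fun s => - ((derive1 t s)%:C *
    cint (fun x => h x * (below s x)%:C)))).
- rewrite cintN// (cfubini_kernel jd jh cmfun_below normc_below).
  congr (- cint _); apply/funext => x; congr (_ * _).
  rewrite -(test_primitive x tt) -cint_real; congr cint; apply/funext => s.
  by rewrite rmorphM.
- by apply: cmfunM jf.1 _; exact: jd.1.
- by apply: cmfunN; exact: jk.1.
- by apply: ae_imply fE => s ->; rewrite mulNr mulrC.
Qed.

Lemma le_ae_rintegrable (h k : R -> R) : measurable_fun [set: R] h ->
  {ae mu, forall x, `|h x| <= k x} -> rintegrable k -> rintegrable h.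
Proof.
move=> mh hk ik; apply: rintegrableP => //.
have /integrableP[mk] := ik; apply: le_lt_trans.
apply: ae_ge0_le_integral => //.
- by apply/measurable_EFinP; exact: measurableT_comp.
- exact: measurableT_comp.
- by apply: ae_imply hk => x hkx _ /=; rewrite lee_fin (le_trans hkx)// ler_norm.
Qed.

Lemma cintegrable_ae_bounded f g (M : R) : cmfun f -> {ae mu, forall x, normc (f x) <= M} ->
  cintegrable g -> cintegrable (fun x => f x * g x).
Proof.
move=> mf fM [mg ng]; have mfg := cmfunM mf mg; split=> //.
apply: (@le_ae_rintegrable _ (fun x => M * normc (g x))).
- exact: measurable_normc.
- apply: ae_imply fM => x fMx.
  by rewrite ger0_norm ?normc_ge0// normcM ler_wpM2r ?normc_ge0.
- exact: rintegrableZl.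
Qed.

Lemma ae_neq x : {ae mu, forall y, y != x}.
Proof.
exists [set x]; split; [exact: measurable_set1|exact: lebesgue_measure_set1|].
by move=> y /= /negP; rewrite negbK => /eqP.
Qed.

(** The one-dimensional Sobolev embedding; it makes products of such functions integrable. *)
Lemma absc_bounded f h : absc f h ->
  {ae mu, forall s, normc (f s) <= rint (fun x => normc (h x))}.
Proof.
move=> [_ jh fE]; apply: ae_imply fE => s ->; rewrite normcN.
apply: normc_cint_le jh.2 _.
  by apply: cmfunM jh.1 _; apply: cmfun_real; exact: measurable_lt2.
by move=> x; rewrite normcM normc_real ler_piMr ?normc_ge0// below_le1.
Qed.

Lemma cintegrable_below h s : cintegrable h -> cintegrable (fun x => h x * (below s x)%:C).
Proof.
move=> jh; apply: (cintegrableMb jh (M := 1)).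
  by apply: cmfun_real; exact: measurable_lt2.
by move=> x; rewrite normc_real below_le1.
Qed.

Lemma cmfun_below_swap : cmfun (fun z : R * R => (below z.2 z.1)%:C).
Proof. by apply: cmfun_real; exact: (swap_measurable measurable_lt_pair). Qed.

(* With [f = - \int_s^oo h] and [g = - \int_s^oo k], the product [f g] is an
   integral over a quadrant, which the diagonal splits into two halves. *)
Lemma absc_mul f g h k : absc f h -> absc g k ->
  absc (fun x => f x * g x) (fun x => h x * g x + f x * k x).
Proof.
move=> af ag; have [jf jh fE] := af; have [jg jk gE] := ag.
have bf := absc_bounded af; have bg := absc_bounded ag.
have jfg : cintegrable (fun x => f x * g x) by exact: cintegrable_ae_bounded jf.1 bf jg.
have jhg : cintegrable (fun x => h x * g x).
  have := cintegrable_ae_bounded jg.1 bg jh.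
  by congr cintegrable; apply/funext => x; rewrite mulrC.
have jfk : cintegrable (fun x => f x * k x) by exact: cintegrable_ae_bounded jf.1 bf jk.
split=> //; first exact: cintegrableD.
apply: ae_imply2 fE gE => s fs gs.
have fE : {ae mu, forall s, f s = - cint (fun x => h x * (below s x)%:C)} by case: af.
have gE : {ae mu, forall s, g s = - cint (fun x => k x * (below s x)%:C)} by case: ag.
pose hs x := h x * (below s x)%:C; pose ks x := k x * (below s x)%:C.
have jhs : cintegrable hs by exact: cintegrable_below.
have jks : cintegrable ks by exact: cintegrable_below.
have K1 := cintegrable_kernel jhs jks cmfun_below normc_below.
have K2 := cintegrable_kernel jhs jks cmfun_below_swap (fun z => normc_below (z.2, z.1)).
have K3 := cintegrable_kernel jks jhs cmfun_below normc_below.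
(* From [s < x] and [x < y] follows [s < y], so the inner integral may also be restricted to the
   right of [s]. *)
have bb (l : R -> R[i]) x y : below s x != 0 ->
    l y * (below s y)%:C * (below x y)%:C = l y * (below x y)%:C.
  rewrite /below; case: (ltP s x) => [sx _|_ /eqP//]; case: (ltP x y) => [xy|_].
    by rewrite (lt_trans sx xy) !mulr1.
  by rewrite !mulr0.
have bB (l m : R -> R[i]) x : l x * (below s x)%:C * cint (fun y => m y * (below x y)%:C) =
    l x * (below s x)%:C * cint (fun y => m y * (below s y)%:C * (below x y)%:C).
  have [->|sx] := eqVneq (below s x) 0; first by rewrite !mulr0 !mul0r.
  by congr (_ * cint _); apply/funext => y; rewrite bb.
have E1 : cint (fun x => h x * g x * (below s x)%:C) =
    - cint (fun x => hs x * cint (fun y => ks y * (below x y)%:C)).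
  rewrite -cintN//; apply: ae_eq_cint.
  - by apply: cmfunM jhg.1 _; apply: cmfun_real; exact: measurable_lt2.
  - by apply: cmfunN; exact: K1.1.
  - by apply: ae_imply gE => x ->; rewrite /hs /ks -bB; ring.
have E2 : cint (fun x => f x * k x * (below s x)%:C) =
    - cint (fun x => hs x * cint (fun y => ks y * (below y x)%:C)).
  have -> : cint (fun x => hs x * cint (fun y => ks y * (below y x)%:C)) =
      cint (fun y => ks y * cint (fun x => hs x * (below y x)%:C)).
    exact: (cfubini_kernel jhs jks cmfun_below_swap (fun z => normc_below (z.2, z.1))).
  rewrite -cintN//; apply: ae_eq_cint.
  - by apply: cmfunM jfk.1 _; apply: cmfun_real; exact: measurable_lt2.
  - by apply: cmfunN; exact: K3.1.
  - by apply: ae_imply fE => x ->; rewrite /hs /ks -bB; ring.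
have jb (l : R -> R[i]) : cintegrable l -> cintegrable (fun x => l x * (below s x)%:C).
  exact: cintegrable_below.
transitivity (- (cint (fun x => h x * g x * (below s x)%:C) +
    cint (fun x => f x * k x * (below s x)%:C))); last first.
  by rewrite -cintD; [congr (- cint _); apply/funext => x; ring|exact: jb|exact: jb].
rewrite E1 E2 -opprD opprK -cintD// fs gs mulrNN -/hs -/ks.
rewrite -cintZr//; congr cint; apply/funext => x; rewrite -mulrDr; congr (_ * _).
have jl (m : R -> R) : (forall y, `|m y| <= 1) -> measurable_fun [set: R] m ->
    cintegrable (fun y => ks y * (m y)%:C).
  move=> m1 mm; apply: (cintegrableMb jks (M := 1)); first exact: cmfun_real.
  by move=> y; rewrite normc_real.
have mb1 : measurable_fun [set: R] (below x) by exact: measurable_lt2.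
have mb2 : measurable_fun [set: R] (below^~ x) by exact: measurable_lt1.
have j1 := jl _ (fun y => below_le1 x y) mb1.
have j2 := jl _ (fun y => below_le1 y x) mb2.
(* The two half-planes [x < y] and [y < x] miss only the diagonal, a single point [y = x] for each
   [x]. *)
rewrite -cintD//; apply: ae_eq_cint; first exact: jks.1.
  exact: (cintegrableD j1 j2).1.
apply: ae_imply (ae_neq x) => y yx; rewrite -mulrDr -rmorphD /below.
by case: ltgtP yx => // _ _; rewrite ?add0r ?addr0 mulr1.
Qed.

Lemma ae_shift (P : R -> Prop) a : {ae mu, forall x, P x} -> {ae mu, forall x, P (x + a)}.
Proof.
move=> [N [mN N0 PN]]; exists ((fun x => x + a) @^-1` N); split.
- by rewrite -[X in measurable X]setTI; exact: (measurable_shift a).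
- by rewrite -N0 -[RHS](lebesgue_measure_shift a mN).
- by move=> x /= Px; exact: PN.
Qed.

Lemma absc_shift f h a : absc f h -> absc (fun x => f (x + a)) (fun x => h (x + a)).
Proof.
move=> [jf jh fE]; split; [exact: cintegrable_shift|exact: cintegrable_shift|].
apply: ae_imply (ae_shift a fE) => s ->; congr (- _).
rewrite -(cint_shift a (cintegrable_below (s + a) jh)); congr cint.
by apply/funext => x; rewrite /below ltrD2r.
Qed.

Lemma conjcN (z : R[i]) : conjc (- z) = - conjc z. Proof. by case: z. Qed.

Lemma conjcM (z w : R[i]) : conjc (z * w) = conjc z * conjc w.
Proof. exact: rmorphM. Qed.

Lemma absc_conj f h : absc f h -> absc (fun x => conjc (f x)) (fun x => conjc (h x)).
Proof.
move=> [jf jh fE]; split; [exact: cintegrable_conj|exact: cintegrable_conj|].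
apply: ae_imply fE => s ->; rewrite conjcN -(cint_conj (cintegrable_below s jh)).
by congr (- cint _); apply/funext => x; rewrite conjcM conjc_real.
Qed.

Lemma absc_add f g h k : absc f h -> absc g k ->
  absc (fun x => f x + g x) (fun x => h x + k x).
Proof.
move=> [jf jh fE] [jg jk gE]; split; [exact: cintegrableD|exact: cintegrableD|].
apply: ae_imply2 fE gE => s -> ->; rewrite -opprD -cintD; try exact: cintegrable_below.
by congr (- cint _); apply/funext => x; rewrite mulrDl.
Qed.

Lemma expi_decomp (c x : R) :
  expi (c * x) = (cos (c * x))%:C + 'i%C * (sin (c * x))%:C :> R[i].
Proof. by apply/eqP; rewrite eq_complex ReD ImD ReM ImM/=; apply/andP; split; apply/eqP; ring. Qed.

Lemma cmfun_expi_lin (c : R) : cmfun (fun x : R => expi (c * x)).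
Proof.
by apply: cmfun_expi; apply: measurable_funM => //; exact: measurable_cst.
Qed.

Lemma cintegrable_expi f (c : R) : cintegrable f -> cintegrable (fun x => f x * expi (c * x)).
Proof.
move=> jf; apply: (cintegrableMb jf (M := 1)); first exact: cmfun_expi_lin.
by move=> x; rewrite normc_expi.
Qed.

(** Cosine and sine are smooth and bounded together with their derivatives, so [weak1_bounded]
    applies to each; a character is split because test functions are real. *)
Lemma weak1_fourier f h (c : R) : weak1 f h ->
  cint (fun x => h x * expi (c * x)) = - ('i%C * c%:C) * cint (fun x => f x * expi (c * x)).
Proof.
move=> wfh; have [jf jh _] := wfh; have [sc ss] := smooth_cos_sin c.
have c1 x : `|cos (c * x)| <= 1 by rewrite ler_norml cos_geN1 cos_le1.
have s1 x : `|sin (c * x)| <= 1 by rewrite ler_norml sin_geN1 sin_le1.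
have mc : measurable_fun [set: R] (fun x => cos (c * x)) by exact: smooth_measurable.
have ms : measurable_fun [set: R] (fun x => sin (c * x)) by exact: smooth_measurable.
have C := weak1_bounded wfh sc (der_cos_affine c) c1 (M' := `|c|)
  ltac:(by move=> x; rewrite normrM normrN ler_piMr).
have S := weak1_bounded wfh ss (der_sin_affine c) s1 (M' := `|c|)
  ltac:(by move=> x; rewrite normrM ler_piMr).
have jC g : cintegrable g -> cintegrable (fun x => g x * (cos (c * x))%:C).
  by move=> jg; apply: (cintegrableMb jg (M := 1)); [exact: cmfun_real|move=> x; rewrite normc_real].
have jS g : cintegrable g -> cintegrable (fun x => g x * (sin (c * x))%:C).
  by move=> jg; apply: (cintegrableMb jg (M := 1)); [exact: cmfun_real|move=> x; rewrite normc_real].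
have D g : cintegrable g -> cint (fun x => g x * expi (c * x)) =
    cint (fun x => g x * (cos (c * x))%:C) + 'i%C * cint (fun x => g x * (sin (c * x))%:C).
  move=> jg; have := cintD (jC g jg) (cintegrableZ 'i%C (jS g jg)).
  rewrite (cintZ _ (jS g jg)) => <-.
  by congr cint; apply/funext => x; rewrite expi_decomp; ring.
rewrite !D// -[X in X + _]opprK -C -[X in _ * X]opprK -S.
have -> : cint (fun x => f x * (- c * sin (c * x))%:C) =
    - c%:C * cint (fun x => f x * (sin (c * x))%:C).
  rewrite -(cintZ _ (jS f jf)); congr cint; apply/funext => x.
  by rewrite rmorphM rmorphN; ring.
have -> : cint (fun x => f x * (c * cos (c * x))%:C) =
    c%:C * cint (fun x => f x * (cos (c * x))%:C).
  rewrite -(cintZ _ (jC f jf)); congr cint; apply/funext => x.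
  by rewrite rmorphM; ring.
have i2 : 'i%C * 'i%C = - 1 :> R[i] by rewrite -expr2 sqr_i.
set a := cint _; set b := cint _.
rewrite mulrDr !mulNr -!mulrA [c%:C * (_ * _)]mulrCA mulrA [_ * ('i%C * _)]mulrA i2; ring.
Qed.

End weak_derivatives.

(** * Fourier transforms *)

Section lebesgue_spaces.
Context {R : realType}.
Local Notation mu := (@lebesgue_measure R).
Implicit Types (f g h k : R -> R[i]) (t u : R -> R) (s x y a b : R).

Lemma cLnorm1E f : cLnorm 1 f = (\int[mu]_x (normc (f x))%:E)%E.
Proof.
rewrite /cLnorm Lnorm1; apply: eq_integral => x _ /=.
by rewrite ger0_norm ?normc_ge0.
Qed.

Lemma cLnorm1_rint f : cintegrable f -> cLnorm 1 f = (rint (fun x => normc (f x)))%:E.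
Proof. by move=> [_ nf]; rewrite cLnorm1E rint_EFin. Qed.

Lemma cLnorm1_lty f : cmfun f -> (cLnorm 1 f < +oo)%E -> cintegrable f.
Proof.
rewrite cLnorm1E => mf foo; split=> //; apply: rintegrableP; first exact: measurable_normc.
apply: le_lt_trans foo; rewrite le_eqVlt; apply: predU1l.
by apply: eq_integral => x _; rewrite ger0_norm ?normc_ge0.
Qed.

Lemma in_L1_cintegrable f : in_Lp 1 f -> cintegrable f.
Proof. by move=> [mf foo]; exact: cLnorm1_lty. Qed.

Lemma clocally_integrable_measurable f : clocally_integrable f -> cmfun f.
Proof. by move=> [[mr _ _] [mi _ _]]; split. Qed.

Lemma cintegrable_locally f : cintegrable f -> clocally_integrable f.
Proof.
move=> jf; split.
  exact: open_integrable_locally openT (cintegrable_Re jf).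
exact: open_integrable_locally openT (cintegrable_Im jf).
Qed.

Lemma test_derive1 t : test_function t -> test_function (derive1 t).
Proof.
move=> tt; have [st _] := tt; have [M M0 HM] := test_support tt.
apply: (@test_functionP _ _ (- M) M); first exact: smooth_derive1.
move=> x; apply: contraNT => xM; rewrite (HM x _).2//.
by rewrite ltNge ler_norml.
Qed.

Lemma weak_derivative0 f : cintegrable f -> is_weak_derivative 0 f f.
Proof.
move=> jf; split; [exact: cintegrable_locally|exact: cintegrable_locally|].
by move=> t _; rewrite expr0 mul1r.
Qed.

Lemma weak_derivativeS m f h k : is_weak_derivative m f h -> weak1 h k ->
  is_weak_derivative m.+1 f k.
Proof.
move=> [lf lh fh] [_ jk hk]; split => //; first exact: cintegrable_locally.
move=> t tt; rewrite derive1Sn fh; last exact: test_derive1.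
by rewrite -/(cint _) hk// exprS mulN1r mulrN mulNr.
Qed.

(** The Sobolev condition provides a derivative of [f] for each order separately. Comparing two
    consecutive orders on the test function [t'] shows that each is the derivative of the one
    before. *)
Lemma weak_derivative_weak1 m f h k : is_weak_derivative m f h ->
  is_weak_derivative m.+1 f k -> cintegrable h -> cintegrable k -> weak1 h k.
Proof.
move=> [_ _ fh] [_ _ fk] jh jk; split=> // t tt.
have := fh _ (test_derive1 tt); rewrite -derive1Sn fk// => E.
have s2 : (-1) ^+ m * (-1) ^+ m = 1 :> R[i] by rewrite -expr2 sqrr_sign.
rewrite /cint -[LHS]mul1r -s2 -mulrA -E mulrA exprS mulrCA s2 mulr1 mulN1r.
by [].
Qed.

Lemma weak_derivative_unique m f h k : is_weak_derivative m f h ->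
  is_weak_derivative m f k -> cintegrable h -> cintegrable k ->
  {ae mu, forall x, h x = k x}.
Proof.
move=> [_ _ fh] [_ _ fk] jh jk.
have H : {ae mu, forall x, h x - k x = 0}.
  apply: cbump_ae_eq0; first exact: cintegrableB.
  move=> t bt; have tt := bump_test bt; have [st t01 _] := bt.
  have mt : cmfun (fun x => (t x)%:C) by apply: cmfun_real; exact: smooth_measurable.
  have t1 x : normc ((t x)%:C) <= 1.
    by have /andP[t0 tle] := t01 x; rewrite normc_real ger0_norm.
  under [X in cint X]eq_fun do rewrite mulrBl.
  rewrite cintB; [|exact: (cintegrableMb jh mt t1)|exact: (cintegrableMb jk mt t1)].
  have s0 : (-1) ^+ m != 0 :> R[i] by rewrite signr_eq0.
  by have := fh t tt; rewrite fk// => /(mulfI s0); rewrite /cint => ->; rewrite subrr.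
by apply: ae_imply H => x /subr0_eq.
Qed.

Lemma sobolev_absc f : sobolev 3 1 f -> exists hs : (R -> R[i]) * (R -> R[i]) * (R -> R[i]),
  [/\ absc f hs.1.1, absc hs.1.1 hs.1.2 & absc hs.1.2 hs.2].
Proof.
move=> [L1f Wf].
have [h1 W1 /in_L1_cintegrable j1] := Wf 1%N isT.
have [h2 W2 /in_L1_cintegrable j2] := Wf 2%N isT.
have [h3 W3 /in_L1_cintegrable j3] := Wf 3%N isT.
have jf := in_L1_cintegrable L1f.
exists (h1, h2, h3); split; apply: weak1_absc => /=.
- exact: weak_derivative_weak1 (weak_derivative0 jf) W1 jf j1.
- exact: weak_derivative_weak1 W1 W2 j1 j2.
- exact: weak_derivative_weak1 W2 W3 j2 j3.
Qed.

(** Keeps the two ends of a chain of [m] successive derivatives, so that integration by parts is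
    iterated by induction on the chain. *)
Inductive absc_chain : nat -> (R -> R[i]) -> (R -> R[i]) -> Prop :=
| absc_chain0 f : cintegrable f -> absc_chain 0 f f
| absc_chainS m f h k : absc_chain m f h -> absc h k -> absc_chain m.+1 f k.

Lemma absc_chain_integrable m f h : absc_chain m f h -> cintegrable f /\ cintegrable h.
Proof.
by elim=> {m f h} [f jf|m f h k _ [jf jh] [_ jk _]].
Qed.

Lemma absc_chain_weak m f h : absc_chain m f h -> is_weak_derivative m f h.
Proof.
elim=> {m f h} [f jf|m f h k _ fh hk]; first exact: weak_derivative0.
by apply: weak_derivativeS fh _; exact: absc_weak1.
Qed.

Lemma absc_chain_fourier m f h (c : R) : absc_chain m f h ->
  cint (fun x => h x * expi (c * x)) =
  (- ('i%C * c%:C)) ^+ m * cint (fun x => f x * expi (c * x)).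
Proof.
elim=> {m f h} [f jf|m f h k _ fh /absc_weak1 hk]; first by rewrite expr0 mul1r.
by rewrite (weak1_fourier c hk) fh exprS mulrA.
Qed.

Lemma absc_chain_decay m f h (c : R) : absc_chain m f h ->
  `|c| ^+ m * normc (cint (fun x => f x * expi (c * x))) <= rint (fun x => normc (h x)).
Proof.
move=> fh; have [jf jh] := absc_chain_integrable fh.
have ni : normc (- ('i%C * c%:C)) = `|c|.
  by rewrite normcN normcM normc_real normcE /= expr0n expr1n add0r sqrtr1 mul1r.
have -> : `|c| ^+ m = normc ((- ('i%C * c%:C)) ^+ m).
  elim: m {fh} => [|m ih]; first by rewrite !expr0 normcE /= expr0n expr1n addr0 sqrtr1.
  by rewrite !exprS normcM -ih ni.
rewrite -normcM -(absc_chain_fourier c fh).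
apply: (normc_cint_le _ jh.2); first exact: (cintegrable_expi c jh).1.
by move=> x; rewrite normcM normc_expi mulr1.
Qed.

(** The chosen representative [weak_derivative m f] is a priori only locally integrable. If its norm
    is infinite the bound is trivial; otherwise it is integrable and agrees almost everywhere with
    the end of the chain. *)
Lemma weak_derivative_decay m f h (c : R) : absc_chain m f h ->
  ((`|c| ^+ m * normc (cint (fun x => f x * expi (c * x))))%:E <=
   cLnorm 1 (weak_derivative m f))%E.
Proof.
move=> fh; have fhW := absc_chain_weak fh; have [jf jh] := absc_chain_integrable fh.
have W : is_weak_derivative m f (weak_derivative m f).
  by apply: xgetPex; exists h.
have [lf lw _] := W; have mw := clocally_integrable_measurable lw.
have [oo|foo] := eqVneq (cLnorm 1 (weak_derivative m f)) +oo%E; first by rewrite oo leey.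
have jw : cintegrable (weak_derivative m f).
  by apply: cLnorm1_lty => //; rewrite lt_neqAle foo leey.
rewrite (cLnorm1_rint jw) lee_fin (le_trans (absc_chain_decay c fh))//.
rewrite le_eqVlt; apply: predU1l; apply: ae_eq_rint.
- exact: measurable_normc jh.1.
- exact: measurable_normc mw.
- by apply: ae_imply (weak_derivative_unique fhW W jh jw) => x ->.
Qed.

Definition square_integrable f := cmfun f /\ rintegrable (fun x => normc (f x) ^+ 2).

Lemma cLnorm2_sqr f : (cLnorm 2 f `^ 2 = \int[mu]_x (normc (f x) ^+ 2)%:E)%E.
Proof.
rewrite /cLnorm powR_Lnorm ?pnatr_eq0//; apply: eq_integral => x _ /=.
by rewrite ger0_norm ?normc_ge0// -powR_mulrn ?normc_ge0.
Qed.

Lemma in_L2_square_integrable f : in_Lp 2 f -> square_integrable f.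
Proof.
move=> [mf foo]; split=> //; apply: rintegrableP.
  by apply: measurable_funX; exact: measurable_normc.
have : (cLnorm 2 f `^ 2 < +oo)%E by exact: poweR_lty.
rewrite cLnorm2_sqr; congr (_ < _)%E; apply: eq_integral => x _.
by rewrite ger0_norm ?sqr_ge0.
Qed.

Lemma square_integrableM f g : square_integrable f -> square_integrable g ->
  cintegrable (fun x => f x * g x).
Proof.
move=> [mf f2] [mg g2].
apply: (@le_cintegrable _ _ (fun x => normc (f x) ^+ 2 + normc (g x) ^+ 2)).
- exact: cmfunM.
- move=> x; rewrite normcM; have := sqr_ge0 (normc (f x) - normc (g x)).
  have := mulr_ge0 (normc_ge0 (f x)) (normc_ge0 (g x)).
  by move: (normc _) (normc _) => p q; nra.
- exact: rintegrableD.
Qed.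

Definition window (n : nat) x : R := \1_`[- n%:R, n%:R] x.

Lemma window_le1 n x : `|window n x| <= 1.
Proof. by rewrite /window indicE; case: (_ \in _); rewrite ?normr1 ?normr0. Qed.

Lemma measurable_window n : measurable_fun [set: R] (window n).
Proof. by apply: measurable_indic; exact: measurable_itv. Qed.

Lemma cintegral_window n f : cintegral `[- n%:R, n%:R] f = cint (fun x => f x * (window n x)%:C).
Proof.
have E (u : R -> R) : Rintegral mu `[- n%:R, n%:R] u = rint (fun x => u x * window n x).
  rewrite Rintegral_mkcond; congr rint; apply/funext => x.
  by rewrite patchE /window indicE; case: (x \in _); rewrite ?mulr1 ?mulr0.
rewrite /cintegral !E cintE; congr (_ +i* _); congr rint; apply/funext => x.
  by rewrite ReM /= mulr0 subr0.
by rewrite ImM /= mulr0 add0r.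
Qed.

Lemma cvg_window x : window n x @[n --> \oo] --> (1 : R).
Proof.
apply: cvg_near_cst; near=> n; rewrite /window indicE mem_set//= in_itv/= -ler_norml.
by near: n; exact: nbhs_infty_ger.
Unshelve. all: by end_near. Qed.

Lemma square_integrable_window n f : square_integrable f ->
  cintegrable (fun x => f x * (window n x)%:C).
Proof.
move=> [mf f2].
apply: (@le_cintegrable _ _ (fun x => window n x + normc (f x) ^+ 2)).
- by apply: cmfunM => //; apply: cmfun_real; exact: measurable_window.
- move=> x; rewrite normcM normc_real /window indicE.
  have := sqr_ge0 (normc (f x) - 1); have := normc_ge0 (f x).
  by case: (x \in _); rewrite ?mulr1n ?mulr0n ?normr1 ?normr0; move: (normc _) => p; nra.
- by apply: rintegrableD => //; exact: integrable_indic_itv.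
Qed.

Lemma cmfun_fourier_kernel :
  cmfun (fun z : R * R => expi (- (2 * pi * z.1 * z.2)) : R[i]).
Proof.
apply: cmfun_expi; apply: measurableT_comp => //.
apply: measurable_funM; last exact: measurable_snd.
by apply: measurable_funM; [exact: measurable_cst|exact: measurable_fst].
Qed.

Lemma cmfun_swap (k : R * R -> R[i]) : cmfun k -> cmfun (fun z => k (z.2, z.1)).
Proof. by move=> [kr ki]; split; [exact: (swap_measurable kr)|exact: (swap_measurable ki)]. Qed.

(** The transform of an integrable function need not be integrable, but its product with a window
    is, by Fubini; the transform is the pointwise limit of these measurable products. *)
Lemma cmfun_kernel g (k : R * R -> R[i]) (M : R) : cintegrable g -> cmfun k ->
  (forall z, normc (k z) <= M) -> cmfun (fun x => cint (fun y => g y * k (x, y))).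
Proof.
move=> jg mk kM; pose I x := cint (fun y => g y * k (x, y)).
have jw n : cintegrable (fun x => (window n x)%:C).
  by apply: cintegrable_real; exact: integrable_indic_itv.
have [mw _] : (forall n, cmfun (fun x => (window n x)%:C * I x)) /\ True.
  by split=> // n; exact: (cintegrable_kernel (jw n) jg mk kM).1.
have cw (v : R) x : window n x * v @[n --> \oo] --> v.
  by rewrite -[X in _ --> X]mul1r; apply: cvgMl; exact: cvg_window.
split.
  apply: (measurable_fun_cvg (h := fun n x => window n x * Re (I x))) => [n|x _].
    have [+ _] := mw n; congr measurable_fun; apply/funext => x.
    by rewrite ReM /= mul0r subr0.
  exact: cw.
apply: (measurable_fun_cvg (h := fun n x => window n x * Im (I x))) => [n|x _].
  have [_ +] := mw n; congr measurable_fun; apply/funext => x.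
  by rewrite ImM /= mul0r addr0.
exact: cw.
Qed.

Lemma cLnorm2_fin_num q : square_integrable q -> cLnorm 2 q \is a fin_num.
Proof.
move=> [mq q2]; rewrite ge0_fin_numE ?Lnorm_ge0// ltNge leye_eq; apply/negP => /eqP oo.
by have := cLnorm2_sqr q; rewrite oo poweRyr ?pnatr_eq0// rint_EFin.
Qed.

Lemma cauchy_schwarz q d : square_integrable q -> cmfun d -> cintegrable (fun x => q x * d x) ->
  ((normc (cint (fun x => (q x * d x)%R)))%:E <= cLnorm 2 q * cLnorm 2 d)%E.
Proof.
move=> [mq q2] md jqd.
apply: (@le_trans _ _ (rint (fun x => normc (q x * d x)))%:E); first by rewrite lee_fin normc_cint.
rewrite -rint_EFin; last exact: jqd.2.
have p2 : (0 : R) < 2 by [].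
have pq : (2^-1 + 2^-1 : R) = 1 by rewrite -div1r -splitr.
apply: (le_trans _ (hoelder mu (measurable_normc mq) (measurable_normc md) p2 p2 pq)).
rewrite Lnorm1 le_eqVlt; apply/orP; left; apply/eqP; apply: eq_integral => x _ /=.
by rewrite -normcM ger0_norm ?normc_ge0.
Qed.

Lemma truncated_fourierE n f (xi : R) : truncated_fourier n f xi =
  cint (fun x => f x * (window n x)%:C * expi (- (2 * pi * xi * x))).
Proof.
by rewrite /truncated_fourier cintegral_window; congr cint; apply/funext => x; ring.
Qed.

(* The truncated transforms pair with [q] by Fubini, and converge in L^2. *)
Lemma fourier_pairing f g q : is_fourier f g -> cintegrable q -> square_integrable q ->
  cintegrable (fun x => f x * cint (fun xi => q xi * expi (- (2 * pi * xi * x)))) ->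
  cint (fun xi => q xi * g xi) =
  cint (fun x => f x * cint (fun xi => q xi * expi (- (2 * pi * xi * x)))).
Proof.
move=> [L2f L2g fg] jq q2 jfq.
have f2 := in_L2_square_integrable L2f; have g2 := in_L2_square_integrable L2g.
have k1 (z : R * R) : normc (expi (- (2 * pi * z.1 * z.2))) <= 1 by rewrite normc_expi.
pose F n x := f x * (window n x)%:C.
have jF n : cintegrable (F n) by exact: square_integrable_window.
pose Q x := cint (fun xi => q xi * expi (- (2 * pi * xi * x))).
have E n : cint (fun xi => q xi * truncated_fourier n f xi) = cint (fun x => F n x * Q x).
  rewrite -(cfubini_kernel jq (jF n) cmfun_fourier_kernel k1); congr cint.
  by apply/funext => xi; rewrite truncated_fourierE.
have mQ : cmfun Q by exact: (cmfun_kernel jq (cmfun_swap cmfun_fourier_kernel) (fun z => k1 (z.2, z.1))).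
have [|||||_ c1] := @cint_dominated R (fun n x => F n x * Q x) (fun x => f x * Q x)
  (fun x => normc (f x * Q x)) _ _ _ _ _.
- by move=> n; apply: cmfunM => //; exact: (jF n).1.
- exact: jfq.1.
- exact: jfq.2.
- move=> n x; rewrite !normcM normc_real ler_wpM2r ?normc_ge0// ler_piMr ?normc_ge0//.
  exact: window_le1.
- move=> x; rewrite (_ : (fun n => _) = (fun n => normc (f x * Q x * (window n x)%:C -
    f x * Q x * 1%:C))); last by apply/funext => n; congr normc; rewrite /F; ring.
  by apply: cvg_normc_scale; exact: cvg_window.
apply: clim_unique c1.
have jqt n : cintegrable (fun xi => q xi * truncated_fourier n f xi).
  have := cintegrable_kernel jq (jF n) cmfun_fourier_kernel k1.
  by congr cintegrable; apply/funext => xi; rewrite truncated_fourierE.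
have jqg : cintegrable (fun xi => q xi * g xi) by exact: square_integrableM.
rewrite (_ : (fun n => _) = (fun n => normc (cint (fun xi =>
    q xi * (truncated_fourier n f xi - g xi))))); last first.
  apply/funext => n; rewrite -E -cintB//; congr (normc (cint _)).
  by apply/funext => xi; rewrite mulrBr.
have q2n := cLnorm2_fin_num q2.
have mT n : cmfun (truncated_fourier n f).
  have := cmfun_kernel (jF n) cmfun_fourier_kernel k1.
  by congr cmfun; apply/funext => xi; rewrite truncated_fourierE.
have jd n : cintegrable (fun xi => q xi * (truncated_fourier n f xi - g xi)).
  have := cintegrableB (jqt n) jqg.
  by congr cintegrable; apply/funext => xi; rewrite mulrBr.
have CS n := cauchy_schwarz q2 (cmfunB (mT n) g2.1) (jd n).
have U : (cLnorm 2 q * cLnorm 2 (fun xi => (truncated_fourier n f xi - g xi)%R))%E @[n --> \oo] --> 0%E.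
  by rewrite -[X in _ --> X](mule0 (cLnorm 2 q)); apply: cvgeZl.
have N : (normc (cint (fun xi => q xi * (truncated_fourier n f xi - g xi))))%:E @[n --> \oo] --> 0%E.
  apply: (squeeze_cvge _ (cvg_cst 0%E) U).
  by apply: nearW => n; rewrite CS lee_fin normc_ge0.
exact: (fine_cvg N).
Qed.

End lebesgue_spaces.

Section fourier_inversion.
Context {R : realType}.
Local Notation mu := (@lebesgue_measure R).
Implicit Types (f g : R -> R[i]) (h F : R -> R) (x y c w : R).

Let T := measurableTypeR R.

Let measurable_oppT : measurable_fun [set: T] (-%R : T -> T).
Proof. by have : measurable_fun [set: R] (-%R : R -> R) by []. Qed.

Lemma rintegrable_opp h : rintegrable h -> rintegrable (fun x => h (- x)).
Proof.
move=> ih; have mh := rintegrable_measurable ih.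
apply: rintegrableP; first by apply: (measurableT_comp mh).
have mah : measurable_fun [set: T] (fun x => (`|h x|)%:E).
  by apply/measurable_EFinP; exact: measurableT_comp.
pose m : {measure set T -> \bar R} := mu.
have H := ge0_integral_pushforward measurable_oppT m measurableT mah
  ltac:(by move=> y _; rewrite lee_fin).
move/integrableP : ih => [_]; apply: le_lt_trans.
rewrite le_eqVlt; apply: predU1l; apply: etrans (esym H) _.
by apply: eq_measure_integral => A mA _ /=; exact: lebesgue_measureN.
Qed.

Lemma rint_opp h : rintegrable h -> rint (fun x => h (- x)) = rint h.
Proof.
move=> ih; rewrite /rint /Rintegral; congr fine.
have mh := rintegrable_measurable ih.
have mEh : measurable_fun [set: T] (EFin \o h) by exact/measurable_EFinP.
pose m : {measure set T -> \bar R} := mu.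
have /= <- := @integral_pushforward _ _ _ _ _ _ measurable_oppT m setT _ mEh
  (rintegrable_opp ih) measurableT.
by apply: eq_measure_integral => //= A mA _; exact: lebesgue_measureN.
Qed.

Lemma rintegrable_below1 h s : rintegrable h -> rintegrable (fun x => h x * below s x).
Proof.
move=> ih; apply: (@le_rintegrable _ _ (fun x => `|h x|)); last exact: integrable_norm.
  apply: measurable_funM; [exact: rintegrable_measurable|exact: measurable_lt2].
by move=> x; rewrite normrM ler_piMr// below_le1.
Qed.

Lemma rint_half_split h : rintegrable h ->
  rint h = rint (fun x => h x * below 0 x) + rint (fun x => h (- x) * below 0 x).
Proof.
move=> ih; have i1 := rintegrable_below1 0 ih; have i2 := rintegrable_lt 0 ih.
have -> : rint (fun x => h (- x) * below 0 x) = rint (fun x => h x * below x 0).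
  rewrite -(rint_opp i2); congr rint; apply/funext => x.
  by rewrite /below oppr_lt0.
rewrite -rintD//; apply: ae_eq_rint; first exact: rintegrable_measurable.
  by apply: rintegrable_measurable; exact: rintegrableD.
apply: ae_imply (ae_neq 0) => x x0; rewrite -mulrDr /below.
by case: ltgtP x0 => // _ _; rewrite ?add0r ?addr0 mulr1.
Qed.

Lemma rint_cvg (fn : nat -> R -> R) h k : (forall n, measurable_fun [set: R] (fn n)) ->
  measurable_fun [set: R] h -> rintegrable k -> (forall n x, `|fn n x| <= k x) ->
  (forall x, fn n x @[n --> \oo] --> h x) -> rint (fn n) @[n --> \oo] --> rint h.
Proof.
move=> mfn mh ik fnk fnh.
have [|||||_] := @cint_dominated R (fun n x => 1 * (fn n x)%:C) (fun x => 1 * (h x)%:C)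
  k _ _ _ _ _.
- by move=> n; apply: cmfunM; [exact: cmfun_cst|exact: cmfun_real].
- by apply: cmfunM; [exact: cmfun_cst|exact: cmfun_real].
- exact: ik.
- by move=> n x; rewrite mul1r normc_real.
- by move=> x; apply: cvg_normc_scale.
have E (l : R -> R) : cint (fun x => 1 * (l x)%:C) = (rint l)%:C.
  by rewrite -cint_real; congr cint; apply/funext => x; rewrite mul1r.
rewrite (_ : (fun n => _) = (fun n => `|rint (fn n) - rint h|)); last first.
  by apply/funext => n; rewrite !E -rmorphB normc_real.
by move/norm_cvg0P => H; apply/subr_cvg0.
Qed.

Lemma rint_half_line F F' (L : R) : (forall x, is_derive x 1 F (F' x)) ->
  continuous F' -> rintegrable (fun x => F' x * below 0 x) ->
  F n%:R @[n --> \oo] --> L -> rint (fun x => F' x * below 0 x) = L - F 0.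
Proof.
move=> dF cF' iF' FL.
have mF' : measurable_fun [set: R] F' by exact: continuous_measurable_fun.
(* The index [n.+1] keeps the interval of integration nondegenerate. *)
have E n : rint (fun x => F' x * below 0 x * window n.+1 x) = F n.+1%:R - F 0.
  have n0 : (0 : R) < n.+1%:R by rewrite ltr0n.
  have cFn : {within `[0, n.+1%:R], continuous F'} by exact: continuous_subspaceT.
  have iFn : mu.-integrable `[0, n.+1%:R] (EFin \o F').
    by apply: continuous_compact_integrable => //; exact: segment_compact.
  have cF : continuous F by exact: der_continuous dF.
  have -> : rint (fun x => F' x * below 0 x * window n.+1 x) =
      Rintegral mu `]0, n.+1%:R] F'.
    rewrite Rintegral_mkcond; congr rint; apply/funext => x.
    rewrite patchE /below /window indicE.
    case: (ltP 0 x) => [x0|x0]; last first.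
      rewrite mulr0 mul0r ifN// notin_setE/= in_itv/= => /andP[].
      by rewrite ltNge x0.
    rewrite mulr1; have [xn|nx] := leP x n.+1%:R.
      by rewrite !mem_set ?mulr1//= in_itv/= ?x0 ?xn// andbT (le_trans _ (ltW x0))// oppr_le0.
    rewrite !memNset ?mulr0//= in_itv/= ?x0 => /andP[_]; by rewrite leNgt nx.
  rewrite Rintegral_itv_obnd_cbnd; last first.
    by apply: integrableS iFn => //; exact: subset_itv_oc_cc.
  rewrite /Rintegral (@continuous_FTC2 _ F' F)//.
  - split=> [x _||]; first exact: (der_derive1 (dF x)).1.
      by apply: cvg_at_right_filter; exact: cF.
    by apply: cvg_at_left_filter; exact: cF.
  - by move=> x _; exact: (der_derive1 (dF x)).2.
have C : rint (fun x => F' x * below 0 x * window n.+1 x) @[n --> \oo] -->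
    rint (fun x => F' x * below 0 x).
  apply: (rint_cvg _ _ (integrable_norm iF')).
  - move=> n; apply: measurable_funM; last exact: measurable_window.
    by apply: measurable_funM => //; exact: measurable_lt2.
  - by apply: measurable_funM => //; exact: measurable_lt2.
  - by move=> n x; rewrite normrM ler_piMr// window_le1.
  - move=> x; rewrite -[X in _ --> X]mulr1; apply: cvgMr.
    by have := cvg_window x; rewrite -cvg_shiftS.
have D : F n.+1%:R - F 0 @[n --> \oo] --> L - F 0.
  apply: cvgB; last exact: cvg_cst.
  by move: FL; rewrite -cvg_shiftS.
apply: (cvg_unique _ C); rewrite // (_ : (fun n => _) = (fun n => F n.+1%:R - F 0))//.
exact/funext.
Qed.

Lemma oneDsqr_gt0 x : 0 < 1 + x ^+ 2.
Proof. by rewrite ltr_pwDl// sqr_ge0. Qed.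

Lemma rintegrable_oneDsqrV : rintegrable (fun x => (1 + x ^+ 2)^-1).
Proof.
have c := @continuous_oneDsqrV R; have p x : 0 <= (1 + x ^+ 2)^-1.
  by rewrite invr_ge0 ltW// oneDsqr_gt0.
apply: rintegrableP; first exact: continuous_measurable_fun c.
under eq_integral do rewrite ger0_norm//.
rewrite (@ge0_symfun_integralT _ (fun x => (1 + x ^+ 2)^-1))//; last first.
  by move=> x; rewrite /= sqrrN.
by rewrite -set_itvcy integral0y_oneDsqr -EFinM ltry.
Qed.

(** The kernel of the half-plane at height [c], normalized to mass [1]; it is the Fourier transform
    of [exp (- 2 pi c |xi|)]. *)
Definition poisson (c y : R) : R := c / (pi * (c ^+ 2 + y ^+ 2)).

Lemma poisson_denom_gt0 c y : 0 < c -> 0 < c ^+ 2 + y ^+ 2.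
Proof. by move=> c0; rewrite ltr_pwDl ?sqr_ge0// exprn_gt0. Qed.

Lemma poisson_ge0 c y : 0 < c -> 0 <= poisson c y.
Proof.
move=> c0; rewrite divr_ge0 ?(ltW c0)// mulr_ge0 ?pi_ge0//.
by rewrite ltW// poisson_denom_gt0.
Qed.

Lemma continuous_poisson c : 0 < c -> continuous (poisson c).
Proof.
move=> c0 y; apply: cvgMr; apply: cvgV.
  by rewrite mulf_neq0 ?gt_eqF ?pi_gt0// poisson_denom_gt0.
by apply: cvgMr; apply: cvgD; [exact: cvg_cst|exact: exprn_continuous].
Qed.

Lemma pi_ge1 : 1 <= pi :> R.
Proof. by have := pi_ge2 R; lra. Qed.

Lemma poisson_le c y : 0 < c -> poisson c y <= (c + c^-1) * (1 + y ^+ 2)^-1.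
Proof.
move=> c0; have D0 := poisson_denom_gt0 y c0; have p1 := pi_ge1.
rewrite ler_pdivrMr ?mulr_gt0 ?pi_gt0// mulrAC ler_pdivlMr ?oneDsqr_gt0//.
have -> : (c + c^-1) * (pi * (c ^+ 2 + y ^+ 2)) = pi * (c * (c ^+ 2 + y ^+ 2) + c + c^-1 * y ^+ 2).
  by field; rewrite gt_eqF.
have c1 : 0 < c^-1 by rewrite invr_gt0.
have y2 := sqr_ge0 y.
have A : 0 <= c^-1 * y ^+ 2 by rewrite mulr_ge0// ltW.
have B : 0 <= c * c ^+ 2 by rewrite mulr_ge0 ?sqr_ge0// ltW.
have C : 0 <= c * y ^+ 2 by rewrite mulr_ge0// ltW.
by nra.
Qed.

Lemma rintegrable_poisson c : 0 < c -> rintegrable (poisson c).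
Proof.
move=> c0; apply: (@le_rintegrable _ _ (fun y => (c + c^-1) * (1 + y ^+ 2)^-1)).
- by apply: continuous_measurable_fun; exact: continuous_poisson.
- by move=> y; rewrite ger0_norm ?poisson_ge0// poisson_le.
- exact: rintegrableZl rintegrable_oneDsqrV.
Qed.

Lemma rint_poisson c : 0 < c -> rint (poisson c) = 1.
Proof.
move=> c0; have ip := rintegrable_poisson c0.
rewrite (rint_half_split ip).
have -> : (fun x => poisson c (- x) * below 0 x) = (fun x => poisson c x * below 0 x).
  by apply/funext => x; rewrite /poisson sqrrN.
have D x : is_derive x 1 (fun y => pi^-1 * atan (c^-1 * y + 0)) (poisson c x).
  have := der_mul (der_cst pi^-1 x) (@der_comp _ atan (fun y => c^-1 * y + 0) x _ _
    (is_derive1_atan _) (der_affine c^-1 0 x)).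
  move/is_derive_eq; apply; rewrite mul0r add0r addr0 /poisson.
  have D0 := poisson_denom_gt0 x c0; have Dn : c ^+ 2 + x ^+ 2 != 0 by rewrite gt_eqF.
  have cn : c != 0 by rewrite gt_eqF.
  have -> : 1 + (c^-1 * x) ^+ 2 = (c ^+ 2 + x ^+ 2) / c ^+ 2 by field.
  have : (pi : R) != 0 by rewrite gt_eqF ?pi_gt0.
  by move: (pi : R) => p pn; field; rewrite pn cn Dn.
rewrite (rint_half_line D (continuous_poisson c0) (rintegrable_below1 0 ip) (L := 2^-1)).
  by rewrite mulr0 addr0 atan0 mulr0 subr0 -div1r -splitr.
have -> : 2^-1 = pi^-1 * (pi / 2) :> R by rewrite mulrA mulVf ?mul1r// gt_eqF// pi_gt0.
apply: cvgMr; apply: (cvg_comp (fun n : nat => c^-1 * n%:R + 0) _ _ (@cvgy_atan R)).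
apply/cvgryPge => M; near=> n; rewrite addr0 mulrC -ler_pdivrMr ?invr_gt0//.
by near: n; exact: nbhs_infty_ger.
Unshelve. all: by end_near. Qed.

Lemma expNabs_le c x : 0 < c -> expR (- (c * `|x|)) <= (1 + 2 / c ^+ 2) * (1 + x ^+ 2)^-1.
Proof.
move=> c0; set t := c * `|x|; have t0 : 0 <= t by rewrite mulr_ge0// ltW.
rewrite ler_pdivlMr ?oneDsqr_gt0//.
have e2 : 1 + t ^+ 2 / 2 <= expR t by have := expR_ge1Dxn 1 t0.
have x2 : 1 + x ^+ 2 <= (1 + 2 / c ^+ 2) * (1 + t ^+ 2 / 2).
  have -> : t ^+ 2 = c ^+ 2 * x ^+ 2 by rewrite exprMn real_normK// num_real.
  have c2 : c ^+ 2 != 0 by rewrite expf_neq0// gt_eqF.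
  have -> : (1 + 2 / c ^+ 2) * (1 + c ^+ 2 * x ^+ 2 / 2) =
    1 + x ^+ 2 + (c ^+ 2 * x ^+ 2 / 2 + 2 / c ^+ 2) by field; rewrite gt_eqF.
  have := mulr_ge0 (sqr_ge0 c) (sqr_ge0 x) => A; have B := sqr_ge0 c.
  by rewrite lerDl; apply: addr_ge0; apply: divr_ge0.
have K0 : 0 <= 1 + 2 / c ^+ 2 by rewrite addr_ge0// divr_ge0// sqr_ge0.
apply: (@le_trans _ _ (expR (- t) * ((1 + 2 / c ^+ 2) * expR t))).
  rewrite ler_wpM2l ?expR_ge0// (le_trans x2)// ler_wpM2l//.
by rewrite mulrCA [expR (- t) * _]mulrC expRxMexpNx_1 mulr1.
Qed.

Lemma measurable_expNabs c : measurable_fun [set: R] (fun x => expR (- (c * `|x|))).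
Proof.
apply: (measurableT_comp (@measurable_expR R)); apply: measurableT_comp => //.
apply: measurable_funM; first exact: measurable_cst.
by apply: continuous_measurable_fun; exact: norm_continuous.
Qed.

Lemma rintegrable_expNabs c : 0 < c -> rintegrable (fun x => expR (- (c * `|x|))).
Proof.
move=> c0; apply: (le_rintegrable (measurable_expNabs c) _
  (rintegrableZl (1 + 2 / c ^+ 2) rintegrable_oneDsqrV)).
by move=> x; rewrite ger0_norm ?expR_ge0// expNabs_le.
Qed.

Lemma cvg_expRN_natr c : 0 < c -> expR (- (c * n%:R)) @[n --> \oo] --> (0 : R).
Proof.
move=> c0; apply: (cvg_comp (fun n : nat => c * n%:R) _ _ (@cvgr_expR R)).
apply/cvgryPge => M; near=> n; rewrite mulrC -ler_pdivrMr//.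
by near: n; exact: nbhs_infty_ger.
Unshelve. all: by end_near. Qed.

Lemma eq_rint_below h k : (forall x, 0 < x -> h x = k x) ->
  rint (fun x => h x * below 0 x) = rint (fun x => k x * below 0 x).
Proof.
move=> hk; congr rint; apply/funext => x; rewrite /below.
by have [/hk ->|_] := ltP 0 x; rewrite ?mulr0.
Qed.

Lemma laplace_cos c w : 0 < c ->
  rint (fun x => expR (- (c * x)) * cos (w * x) * below 0 x) = c / (c ^+ 2 + w ^+ 2).
Proof.
move=> c0; have D0 := poisson_denom_gt0 w c0.
have Dn : c ^+ 2 + w ^+ 2 != 0 by rewrite gt_eqF.
(* The primitive of [exp (- c x) cos (w x)] that two integrations by parts produce. *)
pose F x := (c ^+ 2 + w ^+ 2)^-1 *
  (expR (- c * x + 0) * (w * sin (w * x) + (- c) * cos (w * x))).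
have dE x : is_derive x 1 (fun y => expR (- c * y + 0)) (expR (- c * x + 0) * - c).
  exact: (@der_comp _ expR (fun y => - c * y + 0) x _ _ (is_derive_expR _) (der_affine (- c) 0 x)).
have dF x : is_derive x 1 F (expR (- (c * x)) * cos (w * x)).
  have := der_mul (der_cst (c ^+ 2 + w ^+ 2)^-1 x) (der_mul (dE x)
    (der_add (der_mul (der_cst w x) (der_sin_affine w x))
             (der_mul (der_cst (- c) x) (der_cos_affine w x)))).
  by move/is_derive_eq; apply; rewrite !addr0 mulNr; field.
have cF' : continuous (fun x => expR (- (c * x)) * cos (w * x)).
  move=> x; apply: cvgM; last exact: (der_continuous (der_cos_affine w)).
  apply: (@continuous_comp _ _ _ (fun y => - (c * y)) expR); last exact: continuous_expR.
  by apply: cvgN; exact: mulrl_continuous.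
have mF' : measurable_fun [set: R] (fun x => expR (- (c * x)) * cos (w * x)).
  exact: continuous_measurable_fun.
have iF' : rintegrable (fun x => expR (- (c * x)) * cos (w * x) * below 0 x).
  apply: (@le_rintegrable _ _ (fun x => expR (- (c * `|x|)))).
  - by apply: measurable_funM => //; exact: measurable_lt2.
  - move=> x; rewrite /below; case: ltP => [x0|_]; last by rewrite mulr0 normr0 expR_ge0.
    rewrite mulr1 normrM [`|expR _|]ger0_norm ?expR_ge0// [`|x|]gtr0_norm// ler_piMr ?expR_ge0//.
    by rewrite ler_norml cos_geN1 cos_le1.
  - exact: rintegrable_expNabs.
rewrite (rint_half_line dF cF' iF' (L := 0)).
  by rewrite /F !mulr0 addr0 expR0 sin0 cos0; field.
have K0 : 0 <= (c ^+ 2 + w ^+ 2)^-1 by rewrite invr_ge0 ltW.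
pose K := (c ^+ 2 + w ^+ 2)^-1 * (`|w| + c).
have U : K * expR (- (c * n%:R)) @[n --> \oo] --> 0.
  by rewrite -[X in _ --> X](mulr0 K); apply: cvgMr; exact: cvg_expRN_natr.
apply/norm_cvg0P; apply: (squeeze_cvgr _ (cvg_cst 0) U); apply: nearW => n.
rewrite normr_ge0 /= /F normrM ger0_norm// /K -mulrA ler_wpM2l// normrM.
rewrite addr0 mulNr ger0_norm ?expR_ge0// mulrC ler_wpM2r ?expR_ge0//.
rewrite (le_trans (ler_normD _ _))// !normrM lerD ?ler_piMr//.
  by rewrite ler_norml sin_geN1 sin_le1.
by rewrite [`|- c|]normrN [`|c|]gtr0_norm// ler_piMr ?(ltW c0)// ler_norml cos_geN1 cos_le1.
Qed.

Lemma cint_expNabs c w : 0 < c ->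
  cint (fun x => (expR (- (c * `|x|)))%:C * expi (w * x)) =
  (2 * c / (c ^+ 2 + w ^+ 2))%:C.
Proof.
move=> c0; have me := measurable_expNabs c; have ie := rintegrable_expNabs c0.
have [sc ss] := smooth_cos_sin w.
have bnd (u : R -> R) : measurable_fun [set: R] u -> (forall x, `|u x| <= 1) ->
    rintegrable (fun x => expR (- (c * `|x|)) * u x).
  move=> mu1 u1; apply: (le_rintegrable _ _ ie); first exact: measurable_funM.
  by move=> x; rewrite normrM ger0_norm ?expR_ge0// ler_piMr ?expR_ge0.
have ic : rintegrable (fun x => expR (- (c * `|x|)) * cos (w * x)).
  by apply: bnd; [exact: smooth_measurable|move=> x; rewrite ler_norml cos_geN1 cos_le1].
have is_ : rintegrable (fun x => expR (- (c * `|x|)) * sin (w * x)).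
  by apply: bnd; [exact: smooth_measurable|move=> x; rewrite ler_norml sin_geN1 sin_le1].
rewrite cintE; congr (_ +i* _).
  transitivity (rint (fun x => expR (- (c * `|x|)) * cos (w * x))).
    by congr rint; apply/funext => x; rewrite ReM /= mul0r subr0.
  pose k x := expR (- (c * x)) * cos (w * x).
  have H1 x : 0 < x -> expR (- (c * `|x|)) * cos (w * x) = k x.
    by move=> x0; rewrite [`|x|]gtr0_norm.
  have H2 x : 0 < x -> expR (- (c * `|- x|)) * cos (w * - x) = k x.
    by move=> x0; rewrite [`|- x|]normrN mulrN cosN; exact: H1.
  have E1 := eq_rint_below H1; have E2 := eq_rint_below H2.
  rewrite (rint_half_split ic) E1 E2 (laplace_cos w c0).
  by rewrite -mulr2n -mulr_natl; ring.
transitivity (rint (fun x => expR (- (c * `|x|)) * sin (w * x))).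
  by congr rint; apply/funext => x; rewrite ImM /= mul0r addr0.
have : rint (fun x => expR (- (c * `|x|)) * sin (w * x)) =
    - rint (fun x => expR (- (c * `|x|)) * sin (w * x)).
  rewrite -[LHS](rint_opp is_) -rintN//; congr rint; apply/funext => x.
  by rewrite normrN mulrN sinN mulrN.
by move=> H; lra.
Qed.

Lemma rintegrable_poisson_shift c x : 0 < c -> rintegrable (fun y => poisson c (x - y)).
Proof.
move=> c0; have := rintegrable_opp (rintegrable_shift x (rintegrable_poisson c0)).
by congr rintegrable; apply/funext => y; rewrite addrC.
Qed.

Lemma square_integrable_poisson c x : 0 < c ->
  square_integrable (fun y => (poisson c (x - y))%:C).
Proof.
move=> c0; have jp := cintegrable_real (rintegrable_poisson_shift x c0).
have pb y : normc ((poisson c (x - y))%:C) <= c + c^-1.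
  rewrite normc_real ger0_norm ?poisson_ge0// (le_trans (poisson_le _ c0))//.
  rewrite ler_piMr ?addr_ge0 ?invr_ge0 ?(ltW c0)// invf_le1 ?oneDsqr_gt0//.
  by rewrite lerDl sqr_ge0.
split; first exact: jp.1.
have := cintegrableMb jp jp.1 pb; case=> _; congr rintegrable.
by apply/funext => y; rewrite normcM expr2.
Qed.

Lemma ccontinuous_ball f x (e : R) : ccontinuous f -> 0 < e ->
  exists2 d : R, 0 < d & forall y, `|x - y| < d -> normc (f y - f x) <= e.
Proof.
move=> [cr ci] e0.
have e2 : 0 < e / 2 by rewrite divr_gt0.
have /cvgrPdist_lt/(_ _ e2)/nbhs_ballP[d1 d10 H1] := cr x.
have /cvgrPdist_lt/(_ _ e2)/nbhs_ballP[d2 d20 H2] := ci x.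
exists (Num.min d1 d2); first by rewrite lt_min d10 d20.
move=> y; rewrite lt_min => /andP[y1 y2].
rewrite (le_trans (normc_le_ReIm _))// ReD ReN ImD ImN [leRHS]splitr.
by rewrite lerD// distrC ltW//; [exact: H1|exact: H2].
Qed.

(* The mean of [f] against the Poisson kernel is compared with [f x] by
   splitting the increment [f y - f x] into a small near part and a far part on
   which the kernel is at most [c / (x - y)^2]. *)
Lemma poisson_approx f x (e : R) : square_integrable f -> ccontinuous f -> 0 < e ->
  exists M, forall c, 0 < c ->
    normc (cint (fun y => f y * (poisson c (x - y))%:C) - f x) <= e + c * M.
Proof.
move=> [mf f2] [cr ci] e0.
have [d d0 Hd] := ccontinuous_ball x (conj cr ci) e0.
(* On the far part the increment of [f] is at most [|f y|^2 + (1 + |f x|)]. The square is paired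
   with [(x - y)^-2 <= d^-2], the constant with [(x - y)^-2 <= (1 + d^-2) / (1 + (x - y)^2)]; both
   products are integrable in [y]. *)
pose K := (1 + normc (f x)) * (1 + d ^- 2).
pose M y := d ^- 2 * normc (f y) ^+ 2 + K * (1 + (y + - x) ^+ 2)^-1.
have d2 : 0 < d ^- 2 by rewrite invr_gt0 exprn_gt0.
have iM : rintegrable M.
  apply: rintegrableD; first exact: rintegrableZl.
  by apply: rintegrableZl; exact: (rintegrable_shift (- x) rintegrable_oneDsqrV).
exists (rint M) => c c0.
have ip := rintegrable_poisson_shift x c0.
have p1 : rint (fun y => poisson c (x - y)) = 1.
  rewrite -(rint_poisson c0) -(rint_shift x (rintegrable_poisson c0)).
  rewrite -(rint_opp (rintegrable_shift x (rintegrable_poisson c0))).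
  by congr rint; apply/funext => y; rewrite addrC.
have jp : cintegrable (fun y => (poisson c (x - y))%:C) by exact: cintegrable_real.
have pw y : normc ((f y - f x) * (poisson c (x - y))%:C) <=
    e * poisson c (x - y) + c * M y.
  have P0 := poisson_ge0 (x - y) c0.
  rewrite normcM normc_real ger0_norm//.
  have M0 : 0 <= M y.
    have I0 : 0 <= (1 + (y + - x) ^+ 2)^-1 by rewrite invr_ge0 ltW// oneDsqr_gt0.
    by rewrite addr_ge0 ?mulr_ge0 ?addr_ge0 ?sqr_ge0 ?normc_ge0 ?(ltW d2).
  have [near|far] := ltP `|x - y| d.
    apply: (@le_trans _ _ (e * poisson c (x - y))); first by rewrite ler_wpM2r// Hd.
    by rewrite lerDl mulr_ge0// ltW.
  apply: (@le_trans _ _ (c * M y)); last by rewrite lerDr mulr_ge0// ltW.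
  have xy2 : d ^+ 2 <= (x - y) ^+ 2.
    by rewrite -(real_normK (num_real (x - y))) ler_pXn2r ?nnegrE ?(ltW d0).
  have dd : 0 < d ^+ 2 by rewrite exprn_gt0.
  have xy0 : 0 < (x - y) ^+ 2 by rewrite (lt_le_trans dd).
  have P1 : poisson c (x - y) <= c * (x - y) ^- 2.
    rewrite /poisson ler_wpM2l ?(ltW c0)//.
    have D0 := poisson_denom_gt0 (x - y) c0; have p1' := pi_ge1; have p0 := pi_gt0 R.
    have := sqr_ge0 c; move: xy0 D0; move: ((x - y) ^+ 2) (c ^+ 2) => u v u0 uv v0.
    rewrite lef_pV2 ?posrE; [|exact: mulr_gt0|by []].
    rewrite -[leLHS]mul1r ler_pM// ?(ltW u0)//.
    by rewrite lerDr.
  have V1 : (x - y) ^- 2 <= d ^- 2.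
    by move: xy0 dd xy2; move: ((x - y) ^+ 2) (d ^+ 2) => u v u0 v0 uv; rewrite lef_pV2.
  have V2 : (x - y) ^- 2 <= (1 + d ^- 2) * (1 + (y + - x) ^+ 2)^-1.
    rewrite -[y + - x]opprB sqrrN ler_pdivlMr ?oneDsqr_gt0// mulrDr mulr1 mulVf ?gt_eqF//.
    by rewrite addrC lerD2l.
  have N1 : normc (f y - f x) <= normc (f y) ^+ 2 + (1 + normc (f x)).
    apply: (le_trans (normcB _ _)); have := sqr_ge0 (normc (f y) - 1).
    by have := normc_ge0 (f y); have := normc_ge0 (f x); nra.
  apply: (@le_trans _ _ ((normc (f y) ^+ 2 + (1 + normc (f x))) * (c * (x - y) ^- 2))).
    by rewrite ler_pM ?normc_ge0.
  rewrite mulrCA ler_wpM2l ?(ltW c0)// mulrDl /M lerD//.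
    by rewrite mulrC ler_wpM2r ?sqr_ge0.
  by rewrite /K -mulrA ler_wpM2l// addr_ge0 ?normc_ge0.
have fE : cint (fun y => f x * (poisson c (x - y))%:C) = f x.
  by rewrite cintZ// cint_real p1 mulr1.
have p2 := square_integrable_poisson x c0.
have jfp := square_integrableM (conj mf f2) p2.
have jxp : cintegrable (fun y => f x * (poisson c (x - y))%:C) by exact: cintegrableZ.
rewrite -[X in _ - X]fE -cintB//.
have iB := rintegrableD (rintegrableZl e ip) (rintegrableZl c iM).
apply: (@le_trans _ _ (rint (fun y => e * poisson c (x - y) + c * M y))).
  apply: normc_cint_le iB _; first exact: (cintegrableB jfp jxp).1.
  by move=> y; rewrite -mulrBl; exact: pw.
by rewrite (rintD (rintegrableZl e ip) (rintegrableZl c iM)) (rintZl e ip) (rintZl c iM) p1 mulr1.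
Qed.

(** The factor [exp (- 2 pi c |xi|)] is inserted. On the frequency side it disappears by dominated
    convergence as [c] tends to [0]; on the other side [fourier_pairing] turns the integral into the
    Poisson mean of [f], which tends to [f x] by continuity, hence at every point. *)
Theorem fourier_inversion f g x : is_fourier f g -> ccontinuous f -> cintegrable g ->
  f x = cint (fun xi => g xi * expi (2 * pi * x * xi)).
Proof.
move=> fg cf jg; have [L2f _ _] := fg; have f2 := in_L2_square_integrable L2f.
pose c (n : nat) : R := n.+1%:R^-1.
have c0 n : 0 < c n by rewrite invr_gt0 ltr0n.
have cc : c n @[n --> \oo] --> (0 : R) by exact: cvg_harmonic.
have p0 : 0 < 2 * pi :> R by rewrite mulr_gt0// pi_gt0.
pose e n (xi : R) := expR (- (2 * pi * c n * `|xi|)).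
have e0 n : 0 < 2 * pi * c n by rewrite mulr_gt0.
have e1 n xi : `|e n xi| <= 1.
  rewrite ger0_norm ?expR_ge0// -expR0 ler_expR oppr_le0 mulr_ge0//; exact: ltW.
pose q n xi : R[i] := (e n xi)%:C * expi (2 * pi * x * xi).
have je n : cintegrable (fun xi => (e n xi)%:C).
  by apply: cintegrable_real; exact: rintegrable_expNabs.
have jq n : cintegrable (q n) by exact: cintegrable_expi.
have q2 n : square_integrable (q n).
  split; first exact: (jq n).1.
  have [_] := cintegrableMb (je n) (je n).1 (fun xi => eq_ind_r (fun z => z <= 1) (e1 n xi) (normc_real _)).
  by congr rintegrable; apply/funext => xi; rewrite /q !normcM normc_expi mulr1 expr2.
have Q n y : cint (fun xi => q n xi * expi (- (2 * pi * xi * y))) = (poisson (c n) (x - y))%:C.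
  transitivity (cint (fun xi => (e n xi)%:C * expi (2 * pi * (x - y) * xi))).
    congr cint; apply/funext => xi; rewrite /q -mulrA -expiD; congr (_ * expi _).
    by ring.
  rewrite cint_expNabs//; congr (_%:C); rewrite /poisson.
  have := poisson_denom_gt0 (x - y) (c0 n); move: (c n) (x - y) => a b ab.
  have abn : a ^+ 2 + b ^+ 2 != 0 by rewrite gt_eqF.
  have : (pi : R) != 0 by rewrite gt_eqF ?pi_gt0.
  move: (pi : R) => p pn.
  have -> : (2 * p * a) ^+ 2 + (2 * p * b) ^+ 2 = 4 * p ^+ 2 * (a ^+ 2 + b ^+ 2) by ring.
  by field; rewrite pn abn.
have P n : cint (fun xi => q n xi * g xi) = cint (fun y => f y * (poisson (c n) (x - y))%:C).
  have E : (fun y => f y * cint (fun xi => q n xi * expi (- (2 * pi * xi * y)))) =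
      (fun y => f y * (poisson (c n) (x - y))%:C).
    by apply/funext => y; rewrite Q.
  rewrite (fourier_pairing fg (jq n) (q2 n)) E//.
  exact: square_integrableM f2 (square_integrable_poisson x (c0 n)).
have [|||||_ c1] := @cint_dominated R (fun n xi => g xi * expi (2 * pi * x * xi) * (e n xi)%:C)
  (fun xi => g xi * expi (2 * pi * x * xi)) (fun xi => normc (g xi)) _ _ _ _ _.
- by move=> n; apply: cmfunM (je n).1; exact: (cintegrable_expi _ jg).1.
- exact: (cintegrable_expi _ jg).1.
- exact: jg.2.
- by move=> n xi; rewrite !normcM normc_expi mulr1 normc_real ler_piMr ?normc_ge0.
- move=> xi; rewrite (_ : (fun n => _) = (fun n => normc (g xi * expi (2 * pi * x * xi) *
    (e n xi)%:C - g xi * expi (2 * pi * x * xi) * 1%:C))); last first.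
    by apply/funext => n; rewrite mulr1.
  apply: cvg_normc_scale; rewrite -expR0; apply: continuous_cvg; first exact: continuous_expR.
  rewrite -[X in _ --> X]oppr0; apply: cvgN.
  have -> : (0 : R) = 2 * pi * 0 * `|xi| by rewrite mulr0 mul0r.
  by apply: cvgMl; apply: cvgMr.
apply: clim_unique c1.
apply/cvgr0Pnorm_le => d d0; have d2 : 0 < d / 2 by rewrite divr_gt0.
have [M HM] := poisson_approx x f2 cf d2.
have cM : c n * M @[n --> \oo] --> 0 * M by exact: cvgMl.
rewrite mul0r in cM.
have /cvgr0Pnorm_le/(_ _ d2) := cM; apply: filterS => n cMn.
rewrite ger0_norm ?normc_ge0// (_ : cint _ = cint (fun xi => q n xi * g xi)); last first.
  by congr cint; apply/funext => xi; rewrite /q; ring.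
rewrite P (le_trans (HM _ (c0 n)))// [leRHS]splitr lerD2l.
by rewrite (le_trans (ler_norm _)).
Qed.

End fourier_inversion.

(** * Poisson summation *)

Section half_open_box.
Context {R : realType}.
Local Notation mu := (@lebesgue_measure R).
Implicit Types (f g : R -> R[i]) (h F : R -> R) (a b c s x : R).

(** Half-open, so that adjacent boxes add up exactly and tilings are pointwise identities. *)
Definition box a b s : R := \1_`[a, b[ s.

Lemma boxE a b s : box a b s = ((a <= s) && (s < b))%R%:R.
Proof. by rewrite /box indicE mem_setE in_itv. Qed.

Lemma box_ge0 a b s : 0 <= box a b s.
Proof. by rewrite boxE ler0n. Qed.

Lemma box_le1 a b s : `|box a b s| <= 1.
Proof. by rewrite boxE; case: (_ && _); rewrite ?normr1 ?normr0. Qed.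

Lemma measurable_box a b : measurable_fun [set: R] (box a b).
Proof. exact: measurable_indic. Qed.

Lemma rintegrable_box a b : rintegrable (box a b).
Proof. exact: integrable_indic_itv. Qed.

Lemma box_shift a b c s : box a b (s + c) = box (a - c) (b - c) s.
Proof. by rewrite !boxE lerBlDr ltrBrDr. Qed.

Lemma box_cat a b c s : a <= b -> b <= c -> box a b s + box b c s = box a c s.
Proof.
move=> ab bc; rewrite !boxE; have [bs|sb] := leP b s.
  by rewrite andbF (le_trans ab bs) add0r.
by rewrite (lt_le_trans sb bc) /= !andbT addr0.
Qed.

Lemma rint_box F F' a b : a < b -> (forall x, is_derive x 1 F (F' x)) ->
  continuous F' -> rint (fun s => box a b s * F' s) = F b - F a.
Proof.
move=> ab dF cF'.
have -> : rint (fun s => box a b s * F' s) = Rintegral mu `[a, b[ F'.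
  rewrite Rintegral_mkcond; congr rint; apply/funext => x.
  by rewrite patchE /box indicE; case: (x \in _); rewrite ?mul1r ?mul0r.
have cF'ab : {within `[a, b], continuous F'} by exact: continuous_subspaceT.
have iF' : mu.-integrable `[a, b] (EFin \o F').
  by apply: continuous_compact_integrable => //; exact: segment_compact.
have cF : continuous F by exact: der_continuous dF.
rewrite Rintegral_itv_bndo_bndc; last first.
  by apply: integrableS iF' => //; exact: subset_itv_co_cc.
rewrite /Rintegral (@continuous_FTC2 _ F' F)//.
- split=> [x _||]; first exact: (der_derive1 (dF x)).1.
    by apply: cvg_at_right_filter; exact: cF.
  by apply: cvg_at_left_filter; exact: cF.
- by move=> x _; exact: (der_derive1 (dF x)).2.
Qed.

End half_open_box.

Section fejer_kernel.
Context {R : realType} {B : R} (B0 : 0 < B).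
Implicit Types (f g F : R -> R[i]) (s e d x : R) (N n m : nat) (j k l : int).

Let om := 2 * pi / B.

Lemma sin_pi_int k : sin (pi * k%:~R) = 0 :> R.
Proof.
have H n : sin (pi * n%:R) = 0 :> R.
  elim: n => [|n IHn]; first by rewrite mulr0 sin0.
  by rewrite -natr1 mulrDr mulr1 sinDpi IHn oppr0.
by case: k => n; rewrite ?NegzE ?mulrNz ?mulrN ?sinN -pmulrn H ?oppr0.
Qed.

Lemma expi_int k : expi (2 * pi * k%:~R) = 1 :> R[i].
Proof.
have -> : 2 * pi * k%:~R = pi * k%:~R + pi * k%:~R :> R by ring.
rewrite /expi sinD cosD sin_pi_int mul0r mulr0 addr0 subr0 -expr2 cos2sin2.
by rewrite sin_pi_int expr0n mul0r /= subr0.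
Qed.

Lemma expi_period k l s : expi (om * k%:~R * (s + l%:~R * B)) = expi (om * k%:~R * s).
Proof.
have -> : om * k%:~R * (s + l%:~R * B) = om * k%:~R * s + 2 * pi * (k * l)%:~R.
  by rewrite /om intrM; move: (pi : R) => p; field; rewrite gt_eqF.
by rewrite expiD expi_int mulr1.
Qed.

Definition cell s : R := box (- (B / 2)) (B / 2) s.

Let halfB : - (B / 2) < B / 2.
Proof. by rewrite (@lt_trans _ _ 0) ?oppr_lt0 ?divr_gt0. Qed.

Lemma rint_cell : rint cell = B.
Proof.
have -> : cell = (fun s => cell s * 1) by apply/funext => s; rewrite mulr1.
rewrite (@rint_box _ id (fun=> 1))//; last by move=> x; exact: cvg_cst.
by rewrite opprK -splitr.
Qed.

Lemma cint_cell k : cint (fun s => (cell s)%:C * expi (om * k%:~R * s)) =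
  (if k == 0 then B else 0)%:C.
Proof.
have om0 : om != 0 by rewrite gt_eqF// divr_gt0// mulr_gt0// pi_gt0.
case: eqVneq => [->|k0].
  rewrite -rint_cell -cint_real; congr cint; apply/funext => s.
  by rewrite mulr0 mul0r expi0 mulr1.
pose w := om * k%:~R.
have w0 : w != 0 by rewrite mulf_neq0// intr_eq0.
rewrite cintE -[0%:C]/(0 +i* 0); congr (_ +i* _).
  transitivity (rint (fun s => cell s * cos (w * s))).
    by congr rint; apply/funext => s; rewrite ReM /= mul0r subr0.
  have dF x : is_derive x 1 (fun y => w^-1 * sin (w * y)) (cos (w * x)).
    have -> : cos (w * x) = 0 * sin (w * x) + w^-1 * (w * cos (w * x)).
      by rewrite mul0r add0r mulrA mulVf// mul1r.
    exact: der_mul (der_cst w^-1 x) (der_sin_affine w x).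
  rewrite (rint_box halfB dF); last first.
    exact: smooth_continuous (smooth_cos_sin w).1.
  have : w * (B / 2) = pi * k%:~R.
    by rewrite /w /om; move: (pi : R) => p; field; rewrite gt_eqF.
  by move=> W; rewrite [w * - _]mulrN W sinN sin_pi_int oppr0 !mulr0 subrr.
transitivity (rint (fun s => cell s * sin (w * s))).
  by congr rint; apply/funext => s; rewrite ImM /= mul0r addr0.
have dF x : is_derive x 1 (fun y => - w^-1 * cos (w * y)) (sin (w * x)).
  have -> : sin (w * x) = 0 * cos (w * x) + - w^-1 * (- w * sin (w * x)).
    by rewrite mul0r add0r mulrA mulrNN mulVf// mul1r.
  exact: der_mul (der_cst (- w^-1) x) (der_cos_affine w x).
rewrite (rint_box halfB dF); last first.
  exact: smooth_continuous (smooth_cos_sin w).2.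
by rewrite mulrN cosN subrr.
Qed.

(** The frequencies are one-sided: a shift of them changes the sum by a phase, and [fejer] depends
    on the modulus alone. Defining [fejer] as a square makes its positivity immediate. *)
Definition dirichlet N s : R[i] := \sum_(m < N) expi (om * (Posz m)%:~R * s).
Definition fejer N s : R := N%:R^-1 * normc (dirichlet N s) ^+ 2.

Lemma fejer_ge0 N s : 0 <= fejer N s.
Proof. by rewrite mulr_ge0 ?invr_ge0 ?sqr_ge0. Qed.

Lemma fejerE N s : (fejer N s)%:C =
  (N%:R^-1)%:C * \sum_(m < N) \sum_(n < N) expi (om * (Posz n - Posz m)%:~R * s).
Proof.
rewrite /fejer rmorphM/= -mul_conjc; congr (_ * _).
have -> : conjc (dirichlet N s) = \sum_(m < N) expi (- (om * (Posz m)%:~R * s)).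
  by rewrite /dirichlet rmorph_sum; apply: eq_bigr => m _; exact: conj_expi.
rewrite /dirichlet big_distrlr/=; apply: eq_bigr => m _; apply: eq_bigr => n _.
rewrite -expiD; congr expi.
by rewrite intrB; ring.
Qed.

Lemma cmfun_fejer N : cmfun (fun s => (fejer N s)%:C).
Proof.
under [X in cmfun X]funext do rewrite fejerE.
apply: cmfunM; first exact: cmfun_cst.
apply: cmfun_sum => m; apply: cmfun_sum => n; exact: cmfun_expi_lin.
Qed.

Lemma fejer_period N k s : fejer N (s + k%:~R * B) = fejer N s.
Proof.
rewrite /fejer /dirichlet; congr (_ * normc _ ^+ 2).
by apply: eq_bigr => m _; exact: expi_period.
Qed.

Lemma fejer_le N s : fejer N s <= N%:R.
Proof.
have D : normc (dirichlet N s) <= N%:R.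
  rewrite (le_trans (normc_sum _ _ _))// (eq_bigr (fun=> 1)) => [|m _]; last exact: normc_expi.
  by rewrite sumr_const card_ord.
rewrite /fejer; case: N D => [|N] D; first by rewrite invr0 mul0r.
rewrite ler_pdivrMl ?ltr0n// expr2 ler_pM ?normc_ge0//.
Qed.

(** With [z = expi (om * s)], the geometric sum gives [(z - 1) D = z ^ N - 1], of modulus at most
    [2]. Moreover [|z - 1|^2 = 2 - 2 cos (om s)], and the cosine decreases on [[0, pi]], which is
    the range of [om |s|] over a cell. *)
Lemma fejer_far N d s : 0 < d -> d <= `|s| -> `|s| <= B / 2 ->
  fejer N s <= 4 / (2 - 2 * cos (om * d)) / N%:R.
Proof.
move=> d0 ds sB.
have om0 : 0 < om by rewrite divr_gt0// mulr_gt0// pi_gt0.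
have omB : om * (B / 2) = pi by rewrite /om; move: (pi : R) => p; field; rewrite gt_eqF.
have cs : cos (om * s) <= cos (om * d).
  have -> : cos (om * s) = cos (om * `|s|).
    by case: (ger0P s) => // _; rewrite mulrN cosN.
  have i t : 0 <= t -> t <= B / 2 -> om * t \in `[0, pi].
    by move=> t0 tB; rewrite in_itv/= mulr_ge0 ?(ltW om0)//= -omB ler_wpM2l ?(ltW om0).
  have [->//|ne] := eqVneq `|s| d.
  have ds' : d < `|s| by rewrite lt_neqAle eq_sym ne.
  rewrite ltW// ltr_cos ?i// ?ltr_pM2l//; first exact: ltW.
  exact: le_trans sB.
have cd : cos (om * d) < 1.
  have i0 : 0 \in `[0, pi : R] by rewrite in_itv/= lexx pi_ge0.
  have id : om * d \in `[0, pi].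
    rewrite in_itv/= mulr_ge0 ?(ltW om0) ?(ltW d0)//= -omB ler_wpM2l ?(ltW om0)//.
    exact: le_trans sB.
  by rewrite -[X in _ < X]cos0 (ltr_cos i0 id) mulr_gt0.
have c0 : 0 < 2 - 2 * cos (om * d) by lra.
rewrite /fejer mulrC ler_wpM2r ?invr_ge0// ler_pdivlMr//.
pose z := expi (om * s).
have D : z ^+ N - 1 = (z - 1) * dirichlet N s.
  rewrite subrX1; congr (_ * _); apply: eq_bigr => m _.
  elim: (nat_of_ord m) => [|n IHn]; first by rewrite mulr0 mul0r expi0.
  rewrite exprS IHn -expiD; congr expi; rewrite -addn1 PoszD intrD.
  by ring.
have zN : normc (z ^+ N) = 1.
  elim: N {D} => [|n IHn]; first by rewrite expr0 -expi0 normc_expi.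
  by rewrite exprS normcM IHn normc_expi mulr1.
have N1 : normc (1 : R[i]) = 1 by rewrite -expi0 normc_expi.
have : normc (z - 1) * normc (dirichlet N s) <= 2.
  by rewrite -normcM -D (le_trans (normcB _ _))// zN N1.
have : normc (z - 1) ^+ 2 = 2 - 2 * cos (om * s).
  rewrite sqr_normc ReD ImD ReN ImN /=.
  have := cos2Dsin2 (om * s); move: (cos _) (sin _) => u v uv.
  by rewrite subr0; nra.
have := normc_ge0 (z - 1); have := normc_ge0 (dirichlet N s).
move: (normc (z - 1)) (normc _) => u v v0 u0 u2 uv.
have : (u * v) ^+ 2 <= 4.
  have : 0 <= u * v by exact: mulr_ge0.
  by move: (u * v) uv => w w2 w0; nra.
rewrite exprMn u2; apply: le_trans; rewrite mulrC ler_wpM2r ?sqr_ge0//.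
by rewrite lerD2l lerN2 ler_pM2l.
Qed.

Lemma rintegrable_cell_fejer N : rintegrable (fun s => cell s * fejer N s).
Proof.
apply: (@le_rintegrable _ _ (fun s => N%:R * cell s)).
- apply: measurable_funM; first exact: measurable_box.
  exact: (cmfun_fejer N).1.
- move=> s; rewrite normrM ger0_norm ?box_ge0// ger0_norm ?fejer_ge0// mulrC.
  by rewrite ler_wpM2r ?box_ge0// fejer_le.
- by apply: rintegrableZl; exact: rintegrable_box.
Qed.

(** Orthogonality of the characters over a cell leaves only the [N] diagonal pairs. *)
Lemma rint_cell_fejer N : (0 < N)%N -> rint (fun s => cell s * fejer N s) = B.
Proof.
move=> N0; have NR : N%:R != 0 :> R by rewrite pnatr_eq0 -lt0n.
have je k : cintegrable (fun s => (cell s)%:C * expi (om * k%:~R * s)).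
  by apply: cintegrable_expi; apply: cintegrable_real; exact: rintegrable_box.
have : (rint (fun s => cell s * fejer N s))%:C = B%:C.
  rewrite -cint_real.
  have -> : (fun s => (cell s * fejer N s)%:C) = (fun s => (N%:R^-1)%:C *
      \sum_(m < N) \sum_(n < N) (cell s)%:C * expi (om * (Posz n - Posz m)%:~R * s)).
    apply/funext => s; rewrite rmorphM/= fejerE mulrCA; congr (_ * _).
    by rewrite mulr_sumr; apply: eq_bigr => m _; rewrite mulr_sumr.
  rewrite cintZ; last by do 2 (apply: cintegrable_sum => ?); exact: je.
  rewrite cint_sum => [|m]; last by apply: cintegrable_sum => n; exact: je.
  rewrite (eq_bigr (fun=> B%:C)) => [|m _].
    rewrite sumr_const card_ord -[B%:C *+ N]mulr_natl mulrA.
    by rewrite -(rmorph_nat (real_complex R)) -rmorphM/= mulVf// mul1r.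
  rewrite cint_sum => [|n]; last exact: je.
  rewrite (bigD1 m)//= cint_cell subrr eqxx big1 ?addr0// => n nm.
  by rewrite cint_cell subr_eq0 eqz_nat (negbTE (nm : (n : nat) != m)).
by case.
Qed.

(** The mass [B] of the kernel multiplies the small increment of [g] near [0]; away from [0] the
    kernel is of order [1 / N] and the increment is at most [2 * G]. *)
Lemma fejer_approx g (G e : R) : cmfun g -> ccontinuous g ->
  (forall s, normc (g s) <= G) -> 0 < e ->
  exists M, forall N, (0 < N)%N ->
    normc (cint (fun s => g s * (cell s * fejer N s)%:C) - B%:C * g 0) <= e * B + M / N%:R.
Proof.
move=> mg cg gG e0.
have [d d0 Hd] := ccontinuous_ball 0 cg e0.
pose K := 4 / (2 - 2 * cos (om * d)).
exists (2 * G * `|K| * B) => N N0.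
have jc : cintegrable (fun s => (cell s * fejer N s)%:C).
  by apply: cintegrable_real; exact: rintegrable_cell_fejer.
have jg : cintegrable (fun s => g s * (cell s * fejer N s)%:C).
  have := cintegrableMb jc mg gG.
  by congr cintegrable; apply/funext => s; rewrite mulrC.
have gE : cint (fun s => g 0 * (cell s * fejer N s)%:C) = B%:C * g 0.
  by rewrite cintZ// cint_real rint_cell_fejer// mulrC.
have j0 := cintegrableZ (g 0) jc.
rewrite -gE -cintB//.
have i1 := rintegrableZl e (rintegrable_cell_fejer N).
have i2 := rintegrableZl (2 * G * `|K| / N%:R) (rintegrable_box (- (B / 2)) (B / 2)).
have -> : e * B + 2 * G * `|K| * B / N%:R =
    rint (fun s => e * (cell s * fejer N s) + 2 * G * `|K| / N%:R * cell s).
  rewrite rintD// rintZl ?rint_cell_fejer//; last exact: rintegrable_cell_fejer.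
  by rewrite rintZl ?rint_cell; [ring|exact: rintegrable_box].
have G0 : 0 <= G by exact: le_trans (normc_ge0 _) (gG 0).
apply: normc_cint_le (rintegrableD i1 i2) _; first exact: (cintegrableB jg j0).1.
move=> s; have c0 := box_ge0 (- (B / 2)) (B / 2) s; have f0 := fejer_ge0 N s.
have cf0 : 0 <= cell s * fejer N s by exact: mulr_ge0.
rewrite -mulrBl normcM normc_real ger0_norm//.
have [near|far] := ltP `|s| d.
  apply: (@le_trans _ _ (e * (cell s * fejer N s))).
    apply: ler_wpM2r; first exact: mulr_ge0.
    by apply: Hd; rewrite sub0r normrN.
  by rewrite lerDl !mulr_ge0 ?invr_ge0.
apply: (@le_trans _ _ (2 * G * `|K| / N%:R * cell s)); last first.
  by rewrite lerDr; apply: mulr_ge0; [exact: ltW|exact: mulr_ge0].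
have [->|/eqP] := eqVneq (cell s) 0; first by rewrite mul0r !mulr0.
rewrite {1}/cell boxE; case: andP => // -[s1 s2] _.
rewrite [cell s * _]mulrC mulrA ler_wpM2r// -[leRHS]mulrA ler_pM ?normc_ge0//.
  by rewrite (le_trans (normcB _ _))// mulr2n mulrDl mul1r lerD.
apply: (le_trans (fejer_far N d0 far _)); first by rewrite ler_norml s1 ltW.
by rewrite ler_wpM2r ?invr_ge0// ler_norm.
Qed.

(** For fixed [m] the frequencies [n - m] are pairwise distinct, so each inner sum is at most [S],
    and the average over the [N] values of [m] is again at most [S]. Grouping by [m] keeps the
    triangular weights out of sight. *)
Lemma fejer_fourier F N (S : R) : cintegrable F -> (0 < N)%N ->
  (forall r : seq int, uniq r ->
    \sum_(l <- r) normc (cint (fun s => F s * expi (om * l%:~R * s))) <= S) ->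
  normc (cint (fun s => F s * (fejer N s)%:C)) <= S.
Proof.
move=> jF N0 HS; have NR : 0 < N%:R :> R by rewrite ltr0n.
have je k : cintegrable (fun s => F s * expi (om * k%:~R * s)) by exact: cintegrable_expi.
have -> : (fun s => F s * (fejer N s)%:C) = (fun s => (N%:R^-1)%:C *
    \sum_(m < N) \sum_(n < N) F s * expi (om * (Posz n - Posz m)%:~R * s)).
  apply/funext => s; rewrite fejerE mulrCA; congr (_ * _).
  by rewrite mulr_sumr; apply: eq_bigr => m _; rewrite mulr_sumr.
rewrite cintZ; last by do 2 (apply: cintegrable_sum => ?); exact: je.
rewrite normcM normc_real ger0_norm ?invr_ge0// ler_pdivrMl//.
rewrite cint_sum => [|m]; last by apply: cintegrable_sum => n; exact: je.
rewrite (le_trans (normc_sum _ _ _))//.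
rewrite mulr_natl -[X in _ *+ X](card_ord N) -sumr_const ler_sum// => m _.
rewrite cint_sum => [|n]; last exact: je.
rewrite (le_trans (normc_sum _ _ _))//.
have U : uniq [seq Posz (nat_of_ord n) - Posz m | n : 'I_N].
  rewrite map_inj_uniq ?enum_uniq// => a b /addIr [] /val_inj.
  exact.
by have := HS _ U; rewrite big_map enumT.
Qed.

End fejer_kernel.

Section poisson_summation.
Context {R : realType} {B : R} (B0 : 0 < B).
Implicit Types (f g F : R -> R[i]) (s e d x a C S : R) (N n m i : nat).
Local Notation cell := (cell (B := B)).
Local Notation fejer := (fejer (B := B)).
Local Notation K C := (16 * C / B ^+ 2).

Lemma ccontinuousD f g : ccontinuous f -> ccontinuous g -> ccontinuous (fun x => f x + g x).
Proof.
move=> [fr fi] [gr gi]; split=> x.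
  rewrite (_ : _ \o _ = (fun x => Re (f x) + Re (g x))); last by apply/funext => y; exact: ReD.
  by apply: cvgD; [exact: fr|exact: gr].
rewrite (_ : _ \o _ = (fun x => Im (f x) + Im (g x))); last by apply/funext => y; exact: ImD.
by apply: cvgD; [exact: fi|exact: gi].
Qed.

Lemma ccontinuous_shift f a : ccontinuous f -> ccontinuous (fun x => f (x + a)).
Proof.
have c x : (fun y : R => y + a) @ x --> x + a.
  by apply: cvgD; [exact: cvg_id|exact: cvg_cst].
move=> [fr fi]; split=> x.
  change (continuous_at x ((@complex.Re R \o f) \o (fun y => y + a))).
  by apply: continuous_comp; [exact: c|exact: fr].
change (continuous_at x ((@complex.Im R \o f) \o (fun y => y + a))).
by apply: continuous_comp; [exact: c|exact: fi].
Qed.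

Lemma cmfun_shift f a : cmfun f -> cmfun (fun x => f (x + a)).
Proof. by move=> mf; apply: (cmfun_comp mf); exact: measurable_shift. Qed.

Lemma ex_natr_le x e : 0 < e -> exists2 n, (0 < n)%N & x / n%:R <= e.
Proof.
move=> e0; exists (Num.bound (`|x| / e)).+1 => //.
rewrite ler_pdivrMr ?ltr0n// mulrC -ler_pdivrMr//.
have H : 0 <= `|x| / e by rewrite mulr_ge0// invr_ge0 ltW.
apply: (@le_trans _ _ (`|x| / e)); first by rewrite ler_wpM2r ?ler_norm// invr_ge0 ltW.
by rewrite (le_trans (ltW (archi_boundP H)))// ler_nat.
Qed.

Let normc_via (z a b c : R[i]) :
  normc z <= normc (c - z) + normc (b - c) + normc (b - a) + normc a.
Proof.
rewrite -(normcN (c - z)) -(normcN (b - c)).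
have h1 := normcD (- (c - z) - (b - c) + (b - a)) a.
have h2 := normcD (- (c - z) - (b - c)) (b - a).
have h3 := normcD (- (c - z)) (- (b - c)).
have E : - (c - z) - (b - c) + (b - a) + a = z by ring.
by rewrite E in h1; lra.
Qed.

Let in_growing_box (u v t : R) : v + B <= u -> - t <= v -> t <= v ->
  (B / 2 - u <= t) && (t < B / 2 + u).
Proof. by move: B0 => b0 h1 h2 h3; apply/andP; split; lra. Qed.

(** Shifts by [- i] and [i + 1] periods: over [i >= 0] these exhaust the integers once each, and up
    to sign they are the constructors [Posz i] and [Negz i] of [int]. *)
Definition pair_translate F i s : R[i] := F (s + - (i%:R * B)) + F (s + i.+1%:R * B).

Section decaying.
Variables (F : R -> R[i]) (C : R).
Hypotheses (mF : cmfun F) (cF : ccontinuous F) (FC : forall s, normc (F s) <= C / (1 + s ^+ 2)).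

Let C0 : 0 <= C.
Proof. by have := FC 0; rewrite expr0n addr0 divr1; apply: le_trans; exact: normc_ge0. Qed.

Let FleC s : normc (F s) <= C.
Proof.
rewrite (le_trans (FC s))// ler_pdivrMr ?oneDsqr_gt0//.
by rewrite ler_peMr// lerDl sqr_ge0.
Qed.

Lemma decay_cintegrable : cintegrable F.
Proof.
apply: (le_cintegrable mF FC); apply: rintegrableZl; exact: rintegrable_oneDsqrV.
Qed.

(** On a cell both translates are evaluated at distance at least [i B / 2] from [0], which gives
    [8 C / (B i)^2]. The inequality [1 / i^2 <= 2 (1 / i - 1 / (i + 1))] then makes the bound
    telescope and produces the [16]. *)
Lemma pair_translate_le i s : (0 < i)%N -> `|s| <= B / 2 ->
  normc (pair_translate F i s) <= K C * (i%:R^-1 - i.+1%:R^-1).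
Proof.
move=> i0; rewrite ler_norml => /andP[s1 s2].
have i1 : (1 : R) <= i%:R by rewrite ler1n.
have far x : i%:R * B / 2 <= `|x| -> normc (F x) <= 4 * C / B ^+ 2 / i%:R ^+ 2.
  move=> ix; have iB : 0 < i%:R * B / 2 by rewrite !mulr_gt0 ?invr_gt0// ltr0n.
  have -> : 4 * C / B ^+ 2 / i%:R ^+ 2 = C / (i%:R * B / 2) ^+ 2.
    by field; rewrite !gt_eqF// ltr0n.
  rewrite (le_trans (FC x))// ler_wpM2l// lef_pV2 ?posrE ?oneDsqr_gt0 ?exprn_gt0//.
  rewrite (@le_trans _ _ (x ^+ 2)) ?lerDr//.
  by rewrite -(real_normK (num_real x)) ler_pXn2r ?nnegrE// ltW.
apply: (@le_trans _ _ (8 * C / B ^+ 2 / i%:R ^+ 2)).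
  rewrite (le_trans (normcD _ _))//.
  have -> : 8 * C / B ^+ 2 / i%:R ^+ 2 = 4 * C / B ^+ 2 / i%:R ^+ 2 + 4 * C / B ^+ 2 / i%:R ^+ 2.
    by ring.
  rewrite lerD//; apply: far.
    by rewrite -normrN; apply: le_trans (ler_norm _); nra.
  by apply: le_trans (ler_norm _); rewrite -[i.+1%:R]natr1; nra.
have -> : K C * (i%:R^-1 - i.+1%:R^-1) = 8 * C / B ^+ 2 * (2 * (i%:R^-1 - i.+1%:R^-1)) by ring.
apply: ler_wpM2l; first by rewrite !mulr_ge0// invr_ge0 sqr_ge0.
rewrite -[i.+1%:R]natr1; move: i1; move: (i%:R : R) => u u1.
have -> : 2 * (u^-1 - (u + 1)^-1) = 2 / (u * (u + 1)).
  by field; rewrite gt_eqF ?gt_eqF//; lra.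
rewrite ler_pdivlMr ?mulr_gt0//; try lra.
by rewrite ler_pdivrMl ?exprn_gt0; nra.
Qed.

Definition translates n s : R[i] := \sum_(i < n) pair_translate F i s.

Lemma translates_tail m n s : (0 < m)%N -> (m <= n)%N -> `|s| <= B / 2 ->
  normc (translates n s - translates m s) <= K C / m%:R.
Proof.
move=> m0 mn sB.
suff H : normc (translates n s - translates m s) <= K C * (m%:R^-1 - n%:R^-1).
  apply: (le_trans H); apply: ler_wpM2l; last by rewrite gerBl.
  by rewrite !mulr_ge0// invr_ge0 sqr_ge0.
move: mn => /subnK <-; elim: (n - m)%N => [|k IHk].
  by rewrite add0n !subrr normc0 mulr0.
have E : translates (k + m).+1 s = translates (k + m) s + pair_translate F (k + m) s.
  by rewrite /translates big_ord_recr.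
rewrite addSn E addrAC.
rewrite (le_trans (normcD _ _))//.
rewrite (le_trans (lerD IHk (pair_translate_le (ltn_addl k m0) sB)))//.
by rewrite -mulrDr addrA subrK.
Qed.

Lemma cmfun_translates n : cmfun (translates n).
Proof.
apply: cmfun_sum => i; apply: cmfunD; exact: cmfun_shift.
Qed.

Lemma ccontinuous_translates n : ccontinuous (translates n).
Proof.
rewrite /translates; elim: n => [|n IHn].
  under [X in ccontinuous X]funext do rewrite big_ord0.
  by split=> x; exact: cvg_cst.
under [X in ccontinuous X]funext do rewrite big_ord_recr/=.
by apply: ccontinuousD => //; apply: ccontinuousD; exact: ccontinuous_shift.
Qed.

Lemma translates_le n s : normc (translates n s) <= n%:R * (2 * C).
Proof.
rewrite (le_trans (normc_sum _ _ _))// mulr_natl -[X in _ *+ X](card_ord n) -sumr_const.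
apply: ler_sum => i _; rewrite (le_trans (normcD _ _))// mulr2n mulrDl mul1r lerD//.
Qed.

Let cintegrable_cell f N (M : R) : cmfun f -> (forall s, normc (f s) <= M) ->
  cintegrable (fun s => f s * (cell s * fejer N s)%:C).
Proof.
move=> mf fM; have jc := cintegrable_real (rintegrable_cell_fejer (B := B) N).
have := cintegrableMb jc mf fM.
by congr cintegrable; apply/funext => s; rewrite mulrC.
Qed.

Lemma cintegrable_fejer N : cintegrable (fun s => F s * (fejer N s)%:C).
Proof.
apply: (cintegrableMb (M := N%:R) decay_cintegrable); first exact: cmfun_fejer.
by move=> s; rewrite normc_real ger0_norm ?fejer_ge0// fejer_le.
Qed.

(** The kernel is periodic, so shifting the variable moves the cell instead of [F], and the [2 n]
    shifted cells tile one box. It is centred at [B / 2] because the shifts run from [1 - n] to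
    [n]. *)
Lemma cint_translates N n :
  cint (fun s => translates n s * (cell s * fejer N s)%:C) =
  cint (fun s => F s * (fejer N s)%:C * (box (B / 2 - n%:R * B) (B / 2 + n%:R * B) s)%:C).
Proof.
have jb a b : cintegrable (fun s => F s * (fejer N s)%:C * (box a b s)%:C).
  apply: (cintegrableMb (M := 1) (cintegrable_fejer N)).
    by apply: cmfun_real; exact: measurable_box.
  by move=> s; rewrite normc_real box_le1.
have tr k : cint (fun s => F (s + k%:~R * B) * (cell s * fejer N s)%:C) =
    cint (fun s => F s * (fejer N s)%:C * (box (- (B / 2) + k%:~R * B) (B / 2 + k%:~R * B) s)%:C).
  rewrite -[RHS](cint_shift (k%:~R * B))//; congr cint; apply/funext => s.
  by rewrite box_shift !addrK fejer_period// -mulrA -rmorphM [X in _ * X%:C]mulrC.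
have js k : cintegrable (fun s => F (s + k%:~R * B) * (cell s * fejer N s)%:C).
  exact: (cintegrable_cell N (cmfun_shift _ mF) (fun s => FleC _)).
elim: n => [|n IHn].
  congr cint; apply/funext => s; rewrite mul0r subr0 addr0 /translates big_ord0 mul0r.
  by rewrite boxE; case: (leP (B / 2) s); rewrite mulr0.
have E1 : - (n%:R * B) = (- (Posz n))%:~R * B by rewrite intrN mulNr.
have E2 : n.+1%:R * B = (Posz n.+1)%:~R * B by [].
transitivity (cint (fun s => translates n s * (cell s * fejer N s)%:C) +
   (cint (fun s => F (s + - (n%:R * B)) * (cell s * fejer N s)%:C) +
    cint (fun s => F (s + n.+1%:R * B) * (cell s * fejer N s)%:C))).
  rewrite -[X in _ + X]cintD; [|by rewrite E1|exact: (js n.+1)].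
  rewrite -cintD.
  - by congr cint; apply/funext => s; rewrite -!mulrDl /translates big_ord_recr.
  - by apply: cintegrable_cell (cmfun_translates n) (translates_le n).
  - by rewrite E1; apply: cintegrableD => //; exact: (js n.+1).
rewrite IHn E1 E2 !tr -[X in _ + X]cintD// -cintD//; last exact: cintegrableD.
congr cint; apply/funext => s; rewrite -!mulrDr -!(rmorphD (real_complex R))/=; congr (_ * _%:C).
have nB : 0 <= n%:R * B by rewrite mulr_ge0// ltW.
have b0 := B0.
rewrite -E1 -E2 -[n.+1%:R]natr1 mulrDl mul1r.
rewrite -(@box_cat _ (B / 2 - (n%:R * B + B)) (B / 2 - n%:R * B) (B / 2 + (n%:R * B + B))); try lra.
rewrite -(@box_cat _ (B / 2 - n%:R * B) (B / 2 + n%:R * B) (B / 2 + (n%:R * B + B))); try lra.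
rewrite addrCA; congr (box _ _ _ + (_ + box _ _ _)); lra.
Qed.

(* The translates of [F] are summed against the Fejér kernel: over one cell the
   mass concentrates at [0], over the whole line the kernel is a convex
   combination of characters. *)
Lemma poisson_summation_bound S e : 0 < e ->
  (forall r : seq int, uniq r ->
    \sum_(l <- r) normc (cint (fun s => F s * expi (2 * pi / B * l%:~R * s))) <= S) ->
  exists n0, forall n, (n0 <= n)%N -> B * normc (translates n 0) <= S + e.
Proof.
(* Four errors of [e / 4]: the tail of the translates, the near and the far part of the Fejér
   approximation, and the truncation of the line to a box. *)
move=> e0 HS; have e4 : 0 < e / 4 by rewrite divr_gt0.
have [m0 m00 Hm0] := ex_natr_le (K C * B) e4.
exists m0 => m m0m; have m0' : (0 < m)%N by exact: leq_trans m0m.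
have Hm : K C / m%:R * B <= e / 4.
  rewrite (le_trans _ Hm0)// mulrAC ler_wpM2l//.
    by rewrite !mulr_ge0// ?invr_ge0 ?sqr_ge0 ?ltW.
  by rewrite lef_pV2 ?posrE ?ltr0n ?ler_nat.
have eB : 0 < e / 4 / B by rewrite divr_gt0.
(* The order of the choices matters: [m] controls the tail for every [N], because the mass of the
   kernel over a cell is [B]; then [N] is chosen for this [m], and last [n >= m] for this [N]. *)
have [M HM] := fejer_approx B0 (cmfun_translates m) (ccontinuous_translates m) (translates_le m) eB.
have [N N0 HN] := ex_natr_le M e4.
have {HM} := HM _ N0; rewrite divfK ?gt_eqF// => HM.
have jt n := cintegrable_cell N (cmfun_translates n) (translates_le n).
have tail n : (m <= n)%N -> normc (cint (fun s => translates n s * (cell s * fejer N s)%:C) -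
    cint (fun s => translates m s * (cell s * fejer N s)%:C)) <= e / 4.
  move=> mn; rewrite -cintB//; apply: le_trans Hm.
  have ic := rintegrable_cell_fejer (B := B) N.
  have -> : K C / m%:R * B = rint (fun s => K C / m%:R * (cell s * fejer N s)).
    by rewrite rintZl// rint_cell_fejer.
  apply: normc_cint_le (rintegrableZl _ ic) _; first exact: (cintegrableB (jt n) (jt m)).1.
  move=> s; have cf0 : 0 <= cell s * fejer N s.
    by apply: mulr_ge0; [exact: box_ge0|exact: fejer_ge0].
  rewrite -mulrBl normcM normc_real ger0_norm//.
  have [->|/eqP] := eqVneq (cell s) 0; first by rewrite mul0r !mulr0.
  rewrite {1}/cell boxE; case: andP => // -[s1 s2] _.
  by apply: ler_wpM2r => //; apply: translates_tail => //; rewrite ler_norml s1 ltW.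
have jf := cintegrable_fejer N.
have [|||||_ c1] := @cint_dominated R (fun n s => F s * (fejer N s)%:C *
    (box (B / 2 - n%:R * B) (B / 2 + n%:R * B) s)%:C) (fun s => F s * (fejer N s)%:C)
    (fun s => normc (F s * (fejer N s)%:C)) _ _ _ _ _.
- by move=> n; apply: cmfunM jf.1 _; apply: cmfun_real; exact: measurable_box.
- exact: jf.1.
- exact: jf.2.
- by move=> n s; rewrite normcM normc_real ler_piMr ?normc_ge0 ?box_le1.
- move=> s; rewrite (_ : (fun n => _) = (fun n => normc (F s * (fejer N s)%:C *
    (box (B / 2 - n%:R * B) (B / 2 + n%:R * B) s)%:C - F s * (fejer N s)%:C * 1%:C))); last first.
    by apply/funext => n; rewrite mulr1.
  apply: cvg_normc_scale; apply: cvg_near_cst; near=> n.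
  have : (`|s| + B) / B <= n%:R by near: n; exact: nbhs_infty_ger.
  rewrite ler_pdivrMr// => sn; rewrite boxE.
  have sl := ler_norm (- s); rewrite normrN in sl.
  by rewrite (in_growing_box sn sl (ler_norm s)).
have /cvgr0Pnorm_le/(_ _ e4) := c1.
move=> [n1 _ Hn1]; pose n := maxn n1 m.
have {Hn1} := Hn1 n (leq_maxl _ _); rewrite ger0_norm ?normc_ge0// -cint_translates => Hn.
have {tail} := tail n (leq_maxr _ _).
have := fejer_fourier decay_cintegrable N0 HS.
move: HM Hn; move: (cint _) (cint _) (cint _) => a b c; rewrite -[B in B * normc _]gtr0_norm//.
rewrite -normc_real -normcM; move: (B%:C * _) => z cz ba aS bc.
apply: (le_trans (normc_via z a b c)); rewrite (le_trans (lerD (lerD (lerD cz bc) ba) aS))//.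
rewrite addrC lerD2l [leRHS](_ : _ = e / 4 + e / 4 + e / 4 + e / 4); last by field.
by rewrite !lerD2r lerD2l.
Unshelve. all: by end_near. Qed.

End decaying.

End poisson_summation.

(** * Unordered sums *)

Section unordered_sums.
Context {R : realType} {I : choiceType}.
Implicit Types (w v : I -> R) (u : I -> R[i]) (r s : seq I) (e M : R).

Lemma ge_esum_seq (w : I -> \bar R) r : uniq r ->
  (\sum_(i <- r) w i <= \esum_(i in [set: I]) w i)%E.
Proof.
move=> ur; apply: esum_ge; exists [set` r]; first by split=> //; exact: finite_seq.
by rewrite -fsbig_seq.
Qed.

Lemma esum_seq_le (w : I -> \bar R) (x : \bar R) :
  (forall r, uniq r -> (\sum_(i <- r) w i <= x)%E) -> (\esum_(i in [set: I]) w i <= x)%E.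
Proof.
move=> H; apply: ge_ereal_sup => /= _ [A [fA _] <-].
by rewrite fsbig_finite//; apply: H; exact: finmap.fset_uniq.
Qed.

Lemma ler_sum_subset w r s : (forall i, 0 <= w i) -> uniq s -> uniq r ->
  {subset s <= r} -> \sum_(i <- s) w i <= \sum_(i <- r) w i.
Proof.
move=> w0 us ur sr; rewrite [leRHS](bigID (mem s))/= -[\sum_(i <- r | i \in s) _]big_filter.
have P : perm_eq [seq i <- r | i \in s] s.
  apply: uniq_perm; rewrite ?filter_uniq// => i; rewrite mem_filter.
  by case: (boolP (i \in s)) => // /sr ->.
by rewrite (perm_big _ P) lerDl sumr_ge0.
Qed.

Lemma esum_approx w e : (forall i, 0 <= w i) ->
  (\esum_(i in [set: I]) (w i)%:E)%E \is a fin_num -> 0 < e ->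
  exists s, forall r, uniq r -> {subset s <= r} ->
    `|\sum_(i <- r) w i - fine (\esum_(i in [set: I]) (w i)%:E)%E| <= e.
Proof.
move=> w0 fw e0; have [_ [A [fA _] <-]] := ub_ereal_sup_adherent e0 fw.
rewrite fsbig_finite//= => HA; exists (finmap.enum_fset (fset_set A)) => r ur rA.
have H := ler_sum_subset w0 (finmap.fset_uniq _) ur rA.
have := ge_esum_seq (EFin \o w) ur; rewrite sumEFin -[X in (_ <= X)%E -> _](fineK fw) lee_fin => Hr.
move: HA; rewrite -/(esum _ _) -(fineK fw) -EFinB sumEFin lte_fin => HA.
rewrite ler0_norm ?subr_le0// opprB lerBlDr -lerBlDl ltW//.
exact: lt_le_trans HA H.
Qed.

Let subset_catl r s1 s2 : {subset s1 ++ s2 <= r} -> {subset s1 <= r}.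
Proof. by move=> sr i is1; apply: sr; rewrite mem_cat is1. Qed.

Let subset_catr r s1 s2 : {subset s1 ++ s2 <= r} -> {subset s2 <= r}.
Proof. by move=> sr i is2; apply: sr; rewrite mem_cat is2 orbT. Qed.

Lemma rsum_approx v e : (\esum_(i in [set: I]) (`|v i|)%:E < +oo)%E -> 0 < e ->
  exists s, forall r, uniq r -> {subset s <= r} -> `|\sum_(i <- r) v i - rsum v| <= e.
Proof.
move=> sv e0; have e2 : 0 < e / 2 by rewrite divr_gt0.
pose p i : R := Num.max (v i) 0; pose n i : R := Num.max (- v i) 0.
have p0 i : 0 <= p i by rewrite le_max lexx orbT.
have n0 i : 0 <= n i by rewrite le_max lexx orbT.
have fin w : (forall i, 0 <= w i) -> (forall i, w i <= `|v i|) ->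
    (\esum_(i in [set: I]) (w i)%:E)%E \is a fin_num.
  move=> w0 wv; rewrite ge0_fin_numE; last by apply: esum_ge0 => i _; rewrite lee_fin.
  by apply: le_lt_trans sv; apply: le_esum => i _; rewrite lee_fin.
have fp : (\esum_(i in [set: I]) (p i)%:E)%E \is a fin_num.
  by apply: fin => // i; rewrite ge_max ler_norm normr_ge0.
have fn : (\esum_(i in [set: I]) (n i)%:E)%E \is a fin_num.
  by apply: fin => // i; rewrite ge_max -normrN ler_norm normr_ge0.
have [s1 H1] := esum_approx p0 fp e2; have [s2 H2] := esum_approx n0 fn e2.
exists (s1 ++ s2) => r ur sr.
have {}H1 := H1 r ur (subset_catl sr).
have {}H2 := H2 r ur (subset_catr sr).
have -> : rsum v = fine (\esum_(i in [set: I]) (p i)%:E)%E - fine (\esum_(i in [set: I]) (n i)%:E)%E.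
  rewrite -fineB// /rsum; congr (fine (_ - _)%E); apply: eq_esum => i _.
    by rewrite funeposE/= -EFin_max.
  by rewrite funenegE/= -EFin_max.
have -> : \sum_(i <- r) v i = \sum_(i <- r) p i - \sum_(i <- r) n i.
  rewrite -sumrB; apply: eq_bigr => i _; rewrite /p /n.
  rewrite !maxEle; case: (leP (v i) 0); case: (leP (- v i) 0); lra.
move: (\sum_(i <- r) _) (\sum_(i <- r) _) (fine _) (fine _) H1 H2 => a b c d.
rewrite !ler_norml; lra.
Qed.

(** Convergence along the net of finite subsets; the later facts on [csum] all rest on it. *)
Lemma csum_approx u e : csummable u -> 0 < e ->
  exists s, forall r, uniq r -> {subset s <= r} -> normc (\sum_(i <- r) u i - csum u) <= e.
Proof.
move=> su e0; have e2 : 0 < e / 2 by rewrite divr_gt0.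
have fin w : (forall i, `|w i| <= normc (u i)) -> (\esum_(i in [set: I]) (`|w i|)%:E < +oo)%E.
  move=> wu; apply: le_lt_trans su; apply: le_esum => i _.
  by rewrite abse_EFin lee_fin (le_trans (wu i))// ler_norm.
have [s1 H1] := rsum_approx (fin _ (fun i => normRe_le (u i))) e2.
have [s2 H2] := rsum_approx (fin _ (fun i => normIm_le (u i))) e2.
exists (s1 ++ s2) => r ur sr.
have {}H1 := H1 r ur (subset_catl sr).
have {}H2 := H2 r ur (subset_catr sr).
apply: (le_trans (normc_le_ReIm _)); rewrite ReD ImD ReN ImN [leRHS]splitr lerD//.
  by rewrite (big_morph _ (@ReD R) (erefl _)).
by rewrite (big_morph _ (@ImD R) (erefl _)).
Qed.

Lemma csummableP u M : (forall r, uniq r -> \sum_(i <- r) normc (u i) <= M) -> csummable u.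
Proof.
move=> H; apply: (@le_lt_trans _ _ M%:E); last exact: ltry.
apply: esum_seq_le => r ur; under eq_bigr do rewrite abse_EFin ger0_norm ?normc_ge0//.
by rewrite sumEFin lee_fin; exact: H.
Qed.

(** Absolute convergence makes one cofinal family of finite sets enough; this is what allows
    summation over rectangles of unequal sides. *)
Lemma normc_csum_le u M : csummable u ->
  (forall s e, 0 < e ->
    exists2 r, uniq r /\ {subset s <= r} & normc (\sum_(i <- r) u i) <= M + e) ->
  normc (csum u) <= M.
Proof.
move=> su H; apply/ler_addgt0Pr => e e0; have e2 : 0 < e / 2 by rewrite divr_gt0.
have [s Hs] := csum_approx su e2.
have [r [ur sr] Hr] := H s _ e2.
have := Hs r ur sr; rewrite normcBC => h.
have := normcD (csum u - \sum_(i <- r) u i) (\sum_(i <- r) u i).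
by rewrite subrK => /le_trans; apply; rewrite (le_trans (lerD h Hr))// addrCA -splitr.
Qed.

Lemma csummableB u u' : csummable u -> csummable u' -> csummable (fun i => u i - u' i).
Proof.
move=> su su'.
have E (w : I -> R[i]) : csummable w -> (\esum_(i in [set: I]) (normc (w i))%:E)%E \is a fin_num.
  move=> sw; rewrite ge0_fin_numE; last by apply: esum_ge0 => i _; rewrite lee_fin normc_ge0.
  apply: le_lt_trans sw; apply: le_esum => i _.
  by rewrite abse_EFin lee_fin ler_norm.
pose S (w : I -> R[i]) := fine (\esum_(i in [set: I]) (normc (w i))%:E)%E.
apply: (@csummableP _ (S u + S u')) => r ur.
have H (w : I -> R[i]) : csummable w -> \sum_(i <- r) normc (w i) <= S w.
  by move=> sw; rewrite -lee_fin fineK ?E// -sumEFin; exact: ge_esum_seq.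
apply: (@le_trans _ _ (\sum_(i <- r) (normc (u i) + normc (u' i)))).
  by apply: ler_sum => i _; exact: normcB.
by rewrite big_split lerD ?H.
Qed.

Lemma csum_unique u (z : R[i]) : csummable u ->
  (forall s e, 0 < e ->
    exists2 r, uniq r /\ {subset s <= r} & normc (\sum_(i <- r) u i - z) <= e) ->
  csum u = z.
Proof.
move=> su H; apply/eqP; rewrite -subr_eq0; apply/eqP; apply: normc_eq0.
apply/eqP; rewrite eq_le normc_ge0 andbT; apply/ler_addgt0Pr => e e0; rewrite add0r.
have e2 : 0 < e / 2 by rewrite divr_gt0.
have [s Hs] := csum_approx su e2; have [r [ur sr] Hr] := H s _ e2.
have {Hs}:= Hs r ur sr; rewrite normcBC => h.
have := normcD (csum u - \sum_(i <- r) u i) (\sum_(i <- r) u i - z).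
by rewrite addrA subrK => /le_trans; apply; rewrite (le_trans (lerD h Hr))// -splitr.
Qed.

Lemma csumB u u' : csummable u -> csummable u' ->
  csum (fun i => u i - u' i) = csum u - csum u'.
Proof.
move=> su su'; apply: csum_unique => [|s e e0]; first exact: csummableB.
have e2 : 0 < e / 2 by rewrite divr_gt0.
have [s1 H1] := csum_approx su e2; have [s2 H2] := csum_approx su' e2.
exists (undup (s ++ s1 ++ s2)); first by split=> [|i]; rewrite ?undup_uniq// mem_undup mem_cat => ->.
have {}H1 := H1 (undup (s ++ s1 ++ s2)) (undup_uniq _) _.
have {}H2 := H2 (undup (s ++ s1 ++ s2)) (undup_uniq _) _.
rewrite sumrB (_ : _ - _ - _ = \sum_(i <- undup (s ++ s1 ++ s2)) u i - csum u -
  (\sum_(i <- undup (s ++ s1 ++ s2)) u' i - csum u')); last by ring.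
rewrite (le_trans (normcB _ _))// [leRHS]splitr lerD ?H1 ?H2// => i;
  by rewrite mem_undup !mem_cat => ->; rewrite ?orbT.
Qed.

Lemma csum_conj u : csummable u -> csum (fun i => conjc (u i)) = conjc (csum u).
Proof.
move=> su; apply: csum_unique => [|s e e0].
  by move: su; rewrite /csummable; under [in X in _ -> X]eq_fun do rewrite normc_conj.
have [s1 H1] := csum_approx su e0.
exists (undup (s ++ s1)); first by split=> [|i]; rewrite ?undup_uniq// mem_undup mem_cat => ->.
rewrite -rmorph_sum -rmorphB normc_conj; apply: H1; first exact: undup_uniq.
by move=> i; rewrite mem_undup mem_cat => ->; rewrite orbT.
Qed.

End unordered_sums.

Section two_sided_geometric_sums.
Context {R : realType}.
Implicit Types (a b c e s t x X M T : R) (f : int -> R) (n p J : nat) (j k : int).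

Lemma geometric_below b c X n : 1 < b -> 0 < c -> 0 <= X ->
  \sum_(i < n) (if c * b ^+ i <= X then c * b ^+ i else 0) <= X * (b / (b - 1)).
Proof.
move=> b1 c0 X0; have d0 : 0 < b - 1 by rewrite subr_gt0.
have b0 : 0 < b by exact: lt_trans b1.
(* Both bounds are carried through the induction: a new term at most [X] is added to the first to
   preserve the second, and once the terms exceed [X] the sum no longer grows. *)
have H : (b - 1) * \sum_(i < n) (if c * b ^+ i <= X then c * b ^+ i else 0) <= c * b ^+ n /\
    (b - 1) * \sum_(i < n) (if c * b ^+ i <= X then c * b ^+ i else 0) <= X * b.
  elim: n => [|n [IH1 IH2]].
    by rewrite big_ord0 mulr0 expr0 mulr1; split; [exact: ltW|rewrite mulr_ge0// ltW].
  have q0 : 0 < c * b ^+ n by rewrite mulr_gt0// exprn_gt0.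
  rewrite big_ord_recr/= mulrDr exprS [c * (b * _)]mulrCA.
  move: q0 IH1 IH2; move: (c * b ^+ n) (\sum_(i < n) _) => q u q0 u1 u2.
  by case: (leP q X) => qX; rewrite ?mulr0 ?addr0; split; nra.
by rewrite mulrA ler_pdivlMr// mulrC; exact: H.2.
Qed.

Definition jbox J : seq int := [seq Posz i - Posz J | i <- iota 0 J.*2].

Lemma jbox_uniq J : uniq (jbox J).
Proof. by rewrite map_inj_uniq ?iota_uniq// => i k /addIr []. Qed.

Lemma mem_jbox J j : (j \in jbox J) = (- Posz J <= j < Posz J).
Proof.
apply/mapP/andP.
  by case=> i; rewrite mem_iota => /andP[_ i2] ->; split; lia.
case=> j1 j2; exists (absz (j + Posz J)); last by lia.
by rewrite mem_iota; lia.
Qed.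

Lemma sum_jbox f J : \sum_(j <- jbox J) f j = \sum_(i < J.*2) f (Posz i - Posz J).
Proof. by rewrite big_map -[in LHS](subn0 J.*2) -/(index_iota _ _) big_mkord. Qed.

(** The increasing bound is used for [a ^ j <= T], the decreasing one above [T]; the threshold stays
    free until the exponent [p] is fixed. *)
Lemma two_sided_sum a p s t T f J : 1 < a -> (0 < p)%N -> 0 <= s -> 0 <= t -> 0 < T ->
  (forall j, f j <= s * (a ^ j) ^+ p) -> (forall j, f j <= t / a ^ j) ->
  \sum_(j <- jbox J) f j <= s * (T ^+ p * (a ^+ p / (a ^+ p - 1))) + t * (T^-1 * (a / (a - 1))).
Proof.
move=> a1 p0 s0 t0 T0 fs ft; have a0 : 0 < a by exact: lt_trans a1.
have an0 : a != 0 by rewrite gt_eqF.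
have ap1 : 1 < a ^+ p by rewrite exprn_egt1// -lt0n.
pose lo j := if (a ^ j) ^+ p <= T ^+ p then (a ^ j) ^+ p else 0.
pose hi j := if (a ^ j)^-1 <= T^-1 then (a ^ j)^-1 else 0.
have lo0 j : 0 <= lo j by rewrite /lo; case: ifP => // _; rewrite exprn_ge0// exprz_ge0// ltW.
have hi0 j : 0 <= hi j by rewrite /hi; case: ifP => // _; rewrite invr_ge0 exprz_ge0// ltW.
apply: (@le_trans _ _ (\sum_(j <- jbox J) (s * lo j + t * hi j))).
  apply: ler_sum => j _; have aj : 0 < a ^ j by exact: exprz_gt0.
  have [jT|Tj] := leP (a ^ j) T.
    apply: (le_trans (fs j)); rewrite ler_wpDr ?mulr_ge0// /lo.
    by rewrite ler_pXn2r ?nnegrE ?(ltW aj) ?(ltW T0)// jT.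
  apply: (le_trans (ft j)); rewrite ler_wpDl ?mulr_ge0// /hi.
  by rewrite lef_pV2 ?posrE// (ltW Tj).
rewrite big_split/= -!mulr_sumr lerD// ler_wpM2l// sum_jbox.
  have c0 : 0 < (a ^ (- Posz J)) ^+ p by rewrite exprn_gt0// exprz_gt0.
  have := geometric_below J.*2 ap1 c0 (exprn_ge0 p (ltW T0)).
  congr (_ <= _); apply: eq_bigr => i _.
  by rewrite /lo addrC expfzDr// exprMn -exprnP exprAC.
have c0 : 0 < a ^ (1 - Posz J) by exact: exprz_gt0.
have T0' : 0 <= T^-1 by rewrite invr_ge0 ltW.
have := geometric_below J.*2 a1 c0 T0'.
(* Reversing the index turns the decreasing terms into a geometric progression of ratio [a], as
   [geometric_below] expects. *)
congr (_ <= _); rewrite [RHS](reindex_inj rev_ord_inj)/=; apply: eq_bigr => i _.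
have <- : (a ^ (Posz (J.*2 - i.+1)%N - Posz J))^-1 = a ^ (1 - Posz J) * a ^+ i.
  rewrite invr_expz; have -> : - (Posz (J.*2 - i.+1)%N - Posz J) = 1 - Posz J + Posz i.
    by have := ltn_ord i; lia.
  by rewrite expfzDr.
by [].
Qed.

Lemma two_sided_sum1 a s t f J : 1 < a -> 0 <= s -> 0 <= t ->
  (forall j, f j <= s * a ^ j) -> (forall j, f j <= t / a ^ j) ->
  \sum_(j <- jbox J) f j <= 2 * a / (a - 1) * Num.sqrt (s * t).
Proof.
move=> a1 s0 t0 fs ft; have a0 : 0 < a by exact: lt_trans a1.
have K0 : 0 <= 2 * a / (a - 1) by rewrite divr_ge0 ?subr_ge0 ?mulr_ge0 ?ltW.
(* If [s] or [t] is [0] there is no crossing point, but then one of the two bounds already gives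
   [f j <= 0]. *)
have trivial : (forall j, f j <= 0) -> \sum_(j <- jbox J) f j <= 2 * a / (a - 1) * Num.sqrt (s * t).
  move=> f0; apply: (@le_trans _ _ 0); first by apply: sumr_le0 => j _; exact: f0.
  by rewrite mulr_ge0// sqrtr_ge0.
have [sE|sn] := eqVneq s 0; first by apply: trivial => j; rewrite (le_trans (fs j))// sE mul0r.
have [tE|tn] := eqVneq t 0; first by apply: trivial => j; rewrite (le_trans (ft j))// tE mul0r.
have {}s0 : 0 < s by rewrite lt_neqAle eq_sym sn.
have {}t0 : 0 < t by rewrite lt_neqAle eq_sym tn.
(* The two bounds cross at [T]. *)
pose T := Num.sqrt (t / s); have T0 : 0 < T by rewrite sqrtr_gt0 divr_gt0.
have := two_sided_sum J a1 (isT : (0 < 1)%N) (ltW s0) (ltW t0) T0 fs ft.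
rewrite !expr1 => /le_trans; apply; rewrite le_eqVlt; apply: predU1l.
have T2 : T ^+ 2 = t / s by rewrite sqr_sqrtr// divr_ge0 ?ltW.
have E : Num.sqrt (s * t) = s * T.
  have -> : s * t = (s * T) ^+ 2 by rewrite exprMn T2; field; rewrite gt_eqF.
  by rewrite sqrtr_sqr ger0_norm// mulr_ge0 ?ltW.
have tE : t = s * T ^+ 2 by rewrite T2 mulrC divfK.
rewrite E [X in _ + X * _]tE.
by field; rewrite !gt_eqF// subr_gt0.
Qed.

Lemma two_sided_sum2 a s t f J : 1 < a -> 0 <= s -> 0 <= t ->
  (forall j, f j <= s * (a ^ j) ^+ 2) -> (forall j, f j <= t / a ^ j) ->
  \sum_(j <- jbox J) f j <= a * (2 * a + 1) / (a ^+ 2 - 1) * (s * t ^+ 2) `^ 3^-1.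
Proof.
move=> a1 s0 t0 fs ft; have a0 : 0 < a by exact: lt_trans a1.
have a21 : 0 < a ^+ 2 - 1 by rewrite subr_gt0 exprn_egt1.
have K0 : 0 <= a * (2 * a + 1) / (a ^+ 2 - 1).
  by rewrite divr_ge0 ?(ltW a21)// mulr_ge0 ?addr_ge0 ?mulr_ge0 ?ltW.
have trivial : (forall j, f j <= 0) ->
    \sum_(j <- jbox J) f j <= a * (2 * a + 1) / (a ^+ 2 - 1) * (s * t ^+ 2) `^ 3^-1.
  move=> f0; apply: (@le_trans _ _ 0); first by apply: sumr_le0 => j _; exact: f0.
  by rewrite mulr_ge0// powR_ge0.
have [sE|sn] := eqVneq s 0; first by apply: trivial => j; rewrite (le_trans (fs j))// sE mul0r.
have [tE|tn] := eqVneq t 0; first by apply: trivial => j; rewrite (le_trans (ft j))// tE mul0r.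
have {}s0 : 0 < s by rewrite lt_neqAle eq_sym sn.
have {}t0 : 0 < t by rewrite lt_neqAle eq_sym tn.
(* The crossing point of [s x^2] and [t / x]; there both equal [s T^2], which is the cube root of
   [s t^2]. *)
pose T := (t / s) `^ 3^-1; have T0 : 0 < T by rewrite powR_gt0// divr_gt0.
have := two_sided_sum J a1 (isT : (0 < 2)%N) (ltW s0) (ltW t0) T0 fs ft.
move=> /le_trans; apply; rewrite le_eqVlt; apply: predU1l.
have T3 : T ^+ 3 = t / s.
  by rewrite -powR_mulrn ?powR_ge0// -powRrM mulVf// powRr1// divr_ge0 ?ltW.
have tE : t = s * T ^+ 3 by rewrite T3 mulrC divfK.
have E : (s * t ^+ 2) `^ 3^-1 = s * T ^+ 2.
  have -> : s * t ^+ 2 = (s * T ^+ 2) ^+ 3 by rewrite tE; ring.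
  have sT : 0 <= s * T ^+ 2 by rewrite mulr_ge0 ?exprn_ge0 ?ltW.
  by rewrite -powR_mulrn// -powRrM divff// powRr1.
rewrite E [X in _ + X * _]tE.
by field; rewrite !gt_eqF// subr_gt0.
Qed.

(** Finiteness of the product does not make both factors finite, since [0 * +oo = 0]. In that case
    the vanishing factor already forces [u <= 0], so [s = t = 0] serve. *)
Lemma real_bounds (x y : \bar R) p : (0 < p)%N -> (0 <= x)%E -> (0 <= y)%E ->
  (x * y ^+ p)%E \is a fin_num ->
  exists s t, [/\ 0 <= s, 0 <= t, fine (x * y ^+ p)%E = s * t ^+ p &
    forall u c, 0 < c -> (u%:E <= x)%E -> (u%:E <= y * c%:E)%E -> u <= s /\ u <= t * c].
Proof.
move=> p0; have oo : (+oo ^+ p)%E = +oo%E :> \bar R.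
  by case: p p0 => // p _; elim: p => // p IHp; rewrite expeS IHp mulyy.
case: x => [s| |]//; case: y => [t| |]//; rewrite ?lee_fin => s0 t0 fxy.
- exists s, t; split=> //; first by rewrite -EFin_expe -EFinM.
- have [sE|sn] := eqVneq s 0; last first.
    have {}s0 : 0 < s by rewrite lt_neqAle eq_sym sn.
    by move: fxy; rewrite oo gt0_muley ?lte_fin.
  exists 0, 0; rewrite sE !mul0e mul0r; split=> // u c c0; rewrite lee_fin => u0 _.
  by rewrite mul0r.
- have [tE|tn] := eqVneq t 0; last first.
    have {}t0 : 0 < t by rewrite lt_neqAle eq_sym tn.
    by move: fxy; rewrite -EFin_expe gt0_mulye ?lte_fin ?exprn_gt0.
  exists 0, 0; rewrite tE -EFin_expe expr0n gtn_eqF//= mule0 mul0r; split=> // u c c0 _.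
  by rewrite mul0e lee_fin mul0r.
- by move: fxy; rewrite oo mulyy.
Qed.

End two_sided_geometric_sums.

Section double_series.
Context {R : realType}.
Implicit Types (u : int * int -> R[i]) (b : int -> R) (B M e : R) (n J : nat) (j k : int).

Definition kbox n : seq int := [seq Posz i | i <- iota 0 n] ++ [seq Negz i | i <- iota 0 n].

Lemma kbox_uniq n : uniq (kbox n).
Proof.
rewrite cat_uniq !map_inj_uniq ?iota_uniq//=; try by move=> i j [].
by rewrite andbT; apply/hasPn => _ /mapP[i _ ->]; apply/mapP => -[].
Qed.

Lemma sum_kbox (V : nmodType) (f : int -> V) n :
  \sum_(k <- kbox n) f k = \sum_(i < n) (f (Posz i) + f (Negz i)).
Proof.
rewrite big_cat !big_map big_split/=; congr (_ + _);
  by rewrite -[in LHS](subn0 n) -/(index_iota _ _) big_mkord.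
Qed.

Lemma sub_jkbox (s : seq (int * int)) : exists m, forall J n, (m <= J)%N -> (m <= n)%N ->
  {subset s <= [seq (j, k) | j <- jbox J, k <- kbox n]}.
Proof.
have jb j J : (`|j| < J)%N -> j \in jbox J.
  by move=> jJ; rewrite mem_jbox; apply/andP; split; lia.
have kb k n : (`|k| < n)%N -> k \in kbox n.
  rewrite mem_cat; case: k => i kn; apply/orP; [left|right]; apply/mapP; exists i => //;
    by rewrite mem_iota; lia.
exists (\max_(x <- s) (maxn `|x.1| `|x.2|)).+1 => J n mJ mn [j k] jks.
have := @leq_bigmax_seq _ s xpredT (fun x => maxn `|x.1| `|x.2|) (j, k) jks isT.
rewrite geq_max/= => /andP[jm km].
by apply/allpairsP; exists (j, k); split=> //=; [apply: jb|apply: kb]; lia.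
Qed.

Lemma double_csummable u b M :
  (forall j n, \sum_(k <- kbox n) normc (u (j, k)) <= b j) ->
  (forall J, \sum_(j <- jbox J) b j <= M) -> csummable u.
Proof.
move=> ub bM; apply: (@csummableP _ _ _ M) => r ur.
have [m Hm] := sub_jkbox r.
rewrite (le_trans _ (bM m))//.
have U : uniq [seq (j, k) | j <- jbox m, k <- kbox m].
  by apply: allpairs_uniq; rewrite ?jbox_uniq ?kbox_uniq// => -[? ?] [? ?] _ _ [-> ->].
apply: (le_trans (ler_sum_subset (fun i => normc_ge0 (u i)) ur U (Hm m m (leqnn m) (leqnn m)))).
by rewrite big_allpairs; apply: ler_sum => j _; exact: ub.
Qed.

(** The row bounds are asymptotic in [n] and not uniform in [j]. A rectangle has finitely many rows,
    so a common [n] exists once the range of [j] has been fixed. *)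
Lemma double_csum_le B u b M : 0 < B -> csummable u ->
  (forall j e, 0 < e -> exists m, forall n, (m <= n)%N ->
    B * normc (\sum_(k <- kbox n) u (j, k)) <= b j + e) ->
  (forall J, \sum_(j <- jbox J) b j <= M) -> B * normc (csum u) <= M.
Proof.
move=> B0 su ub bM; rewrite mulrC -ler_pdivlMr//; apply: (normc_csum_le su) => s e e0.
have [m Hm] := sub_jkbox s.
(* The error is shared among the [m.*2] rows; the successor avoids a division by [0]. *)
have e1 : 0 < B * e / m.*2.+1%:R by rewrite divr_gt0// mulr_gt0.
have [N HN] := choice (fun j => ub j _ e1).
pose n := maxn m (\max_(j <- jbox m) N j).
have U : uniq [seq (j, k) | j <- jbox m, k <- kbox n].
  by apply: allpairs_uniq; rewrite ?jbox_uniq ?kbox_uniq// => -[? ?] [? ?] _ _ [-> ->].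
exists [seq (j, k) | j <- jbox m, k <- kbox n].
  by split=> //; apply: Hm => //; exact: leq_maxl.
rewrite big_allpairs -(ler_pM2l B0) mulrDr mulrC.
rewrite (le_trans (ler_wpM2r (ltW B0) (normc_sum _ _ _)))// mulrC mulr_sumr.
rewrite mulrCA divff ?gt_eqF// mulr1.
apply: (@le_trans _ _ (\sum_(j <- jbox m) (b j + B * e / m.*2.+1%:R))).
  rewrite big_seq [leRHS]big_seq; apply: ler_sum => j jm; apply: HN.
  by rewrite (leq_trans _ (leq_maxr _ _))//; exact: leq_bigmax_seq.
rewrite big_split/= lerD// sum_jbox sumr_const card_ord -[_ *+ m.*2]mulr_natl mulrA.
rewrite ler_pdivrMr// mulrC ler_wpM2l ?ler_nat//.
by rewrite mulr_ge0 ?ltW.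
Qed.

End double_series.

(** * Coefficients of the periodized products *)

Section fourier_increments.
Context {R : realType}.
Implicit Types (f g : R -> R[i]) (c t w x M : R).

(** The fundamental theorem on [[0, 1]]; keeping the factor [w] on the left includes the case
    [w = 0]. *)
Lemma box_expi w : 'i%C * w%:C * cint (fun r => (box 0 1 r)%:C * expi (w * r)) = expi w - 1.
Proof.
have j : cintegrable (fun r => (box 0 1 r)%:C * expi (w * r)).
  by apply: cintegrable_expi; apply: cintegrable_real; exact: rintegrable_box.
have [smc sms] := smooth_cos_sin w.
have X : w * rint (fun r => box 0 1 r * cos (w * r)) = sin w.
  rewrite -rintZl; last first.
    by have := cintegrable_Re j; congr rintegrable; apply/funext => r; rewrite ReM /= mul0r subr0.
  transitivity (rint (fun r => box 0 1 r * (w * cos (w * r)))).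
    by congr rint; apply/funext => r; rewrite mulrCA.
  rewrite (rint_box ltr01 (der_sin_affine w)); first by rewrite mulr1 mulr0 sin0 subr0.
  by move=> x; apply: cvgMr; exact: smooth_continuous smc x.
have Y : - w * rint (fun r => box 0 1 r * sin (w * r)) = cos w - 1.
  rewrite -rintZl; last first.
    by have := cintegrable_Im j; congr rintegrable; apply/funext => r; rewrite ImM /= mul0r addr0.
  transitivity (rint (fun r => box 0 1 r * (- w * sin (w * r)))).
    by congr rint; apply/funext => r; rewrite mulrCA.
  rewrite (rint_box ltr01 (der_cos_affine w)); first by rewrite mulr1 mulr0 cos0.
  by move=> x; apply: cvgMr; exact: smooth_continuous sms x.
have E : cint (fun r => (box 0 1 r)%:C * expi (w * r)) =
    rint (fun r => box 0 1 r * cos (w * r)) +i* rint (fun r => box 0 1 r * sin (w * r)).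
  rewrite cintE; congr (_ +i* _); congr rint; apply/funext => r.
    by rewrite ReM /= mul0r subr0.
  by rewrite ImM /= mul0r addr0.
rewrite E; move: X Y; move: (rint _) (rint _) => a b X Y.
have -> : expi w - 1 = (- w * a) +i* (w * b).
  by apply/eqP; rewrite eq_complex /= X Y subr0 !eqxx.
by apply/eqP; rewrite eq_complex /=; apply/andP; split; apply/eqP; ring.
Qed.

(* The increment is the integral over [0, 1] of the derivative along the segment,
   with the order of integration exchanged. *)
Lemma fourier_increment f g s t M : cintegrable f -> cintegrable g ->
  (forall x, g x = x%:C * f x) ->
  (forall r, 0 <= r <= 1 -> normc (cint (fun x => g x * expi (2 * pi * (t + (s - t) * r) * x))) <= M) ->
  normc (cint (fun x => f x * expi (2 * pi * s * x)) - cint (fun x => f x * expi (2 * pi * t * x)))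
    <= 2 * pi * `|s - t| * M.
Proof.
move=> jf jg gE HM.
pose k (z : R * R) := expi (2 * pi * (t + (s - t) * z.2) * z.1) : R[i].
have mk : cmfun k.
  apply: cmfun_expi; apply: measurable_funM; last exact: measurable_fst.
  apply: measurable_funM; first exact: measurable_cst.
  apply: measurable_funD; first exact: measurable_cst.
  by apply: measurable_funM; [exact: measurable_cst|exact: measurable_snd].
have k1 z : normc (k z) <= 1 by rewrite normc_expi.
have jb : cintegrable (fun r : R => (box 0 1 r)%:C).
  by apply: cintegrable_real; exact: rintegrable_box.
pose I x := cint (fun r => (box 0 1 r)%:C * k (x, r)).
have IE x : expi (2 * pi * s * x) - expi (2 * pi * t * x) =
    'i%C * (2 * pi * (s - t))%:C * (x%:C * I x).
  have -> : I x = expi (2 * pi * t * x) *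
      cint (fun r => (box 0 1 r)%:C * expi (2 * pi * (s - t) * x * r)).
    rewrite -cintZ; last exact: cintegrable_expi.
    congr cint; apply/funext => r; rewrite mulrCA -expiD /k/=; congr (_ * expi _).
    by ring.
  rewrite mulrA -['i%C * _ * _]mulrA -rmorphM/= mulrCA box_expi mulrBr mulr1 -expiD.
  by congr (expi _ - _); ring.
rewrite -cintB; [|exact: cintegrable_expi|exact: cintegrable_expi].
have -> : (fun x => f x * expi (2 * pi * s * x) - f x * expi (2 * pi * t * x)) =
    (fun x => 'i%C * (2 * pi * (s - t))%:C * (g x * I x)).
  by apply/funext => x; rewrite -mulrBr IE gE; ring.
have jI : cintegrable (fun x => g x * I x) by exact: cintegrable_kernel jg jb mk k1.
rewrite cintZ// (cfubini_kernel jg jb mk k1) normcM.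
have -> : normc ('i%C * (2 * pi * (s - t))%:C) = 2 * pi * `|s - t|.
  rewrite normcM normc_real !normrM normcE /= expr0n expr1n add0r sqrtr1 mul1r.
  by rewrite (gtr0_norm (pi_gt0 R)) normr_nat.
have M0 : 0 <= M by apply: le_trans (normc_ge0 _) (HM 0 _); rewrite lexx ler01.
rewrite ler_wpM2l ?mulr_ge0 ?pi_ge0//.
have bM : rint (fun r => box 0 1 r * M) = M.
  have d x : is_derive x 1 (fun y => M * y + 0) M by exact: der_affine.
  rewrite (rint_box ltr01 d); first by rewrite mulr1 mulr0 !addr0 subr0.
  by move=> x; exact: cvg_cst.
rewrite -[leRHS]bM; apply: normc_cint_le.
- have := cintegrable_kernel jb jg (cmfun_swap mk) (fun z => k1 (z.2, z.1)).
  by case.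
- have := rintegrableZl M (rintegrable_box (0 : R) 1).
  by congr rintegrable; apply/funext => r; rewrite mulrC.
- move=> r; rewrite normcM normc_real ger0_norm ?box_ge0//.
  rewrite boxE; case: (boolP (_ && _)) => [/andP[r0 r1]|_]; last by rewrite !mul0r.
  by rewrite !mul1r; apply: HM; rewrite r0 ltW.
Qed.

End fourier_increments.

Section leibniz.
Context {R : realType}.
Implicit Types (f g h : R -> R[i]) (a : R).

Definition absc3 f := exists hs : (R -> R[i]) * (R -> R[i]) * (R -> R[i]),
  [/\ absc f hs.1.1, absc hs.1.1 hs.1.2 & absc hs.1.2 hs.2].

Lemma absc3_shift f a : absc3 f -> absc3 (fun x => f (x + a)).
Proof.
move=> [[[f1 f2] f3] /= [F1 F2 F3]].
exists (fun x => f1 (x + a), fun x => f2 (x + a), fun x => f3 (x + a)).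
by split; exact: absc_shift.
Qed.

Lemma absc3_conj f : absc3 f -> absc3 (fun x => conjc (f x)).
Proof.
move=> [[[f1 f2] f3] /= [F1 F2 F3]].
exists (fun x => conjc (f1 x), fun x => conjc (f2 x), fun x => conjc (f3 x)).
by split; exact: absc_conj.
Qed.

Lemma absc3_chain f : absc3 f -> exists h2 h3, absc_chain 2 f h2 /\ absc_chain 3 f h3.
Proof.
move=> [[[f1 f2] f3] /= [F1 F2 F3]]; have [jf _ _] := F1; exists f2, f3.
have c2 := absc_chainS (absc_chainS (absc_chain0 jf) F1) F2.
by split=> //; exact: absc_chainS c2 F3.
Qed.

Lemma absc3_mul f g : absc3 f -> absc3 g -> absc3 (fun x => f x * g x).
Proof.
move=> [[[f1 f2] f3] /= [F1 F2 F3]] [[[g1 g2] g3] /= [G1 G2 G3]].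
have fg := absc_mul F1 G1.
have f1g := absc_mul F2 G1; have fg1 := absc_mul F1 G2.
have f2g := absc_mul F3 G1; have f1g1 := absc_mul F2 G2; have fg2 := absc_mul F1 G3.
eexists (_, _, _); split=> /=; first exact: fg.
  exact: (absc_add f1g fg1).
by apply: absc_add; [exact: (absc_add f2g f1g1)|exact: (absc_add f1g1 fg2)].
Qed.

End leibniz.

Section coefficients.
Context {R : realType} {B : R} (B0 : 0 < B).
Implicit Types (f g fh gh F : R -> R[i]) (s t u v w x y C M : R) (l : int).

(** The rate is what two integrable derivatives of the transform provide, and it makes the sums over
    translations converge absolutely. *)
Definition decaying F := [/\ cmfun F, ccontinuous F &
  exists C, forall s, normc (F s) <= C / (1 + s ^+ 2)].

(** Peetre's inequality [1 + s^2 <= 2 (1 + a^2) (1 + (s + a)^2)]. *)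
Lemma decay_shift a C F : (forall s, normc (F s) <= C / (1 + s ^+ 2)) ->
  forall s, normc (F (s + a)) <= 2 * (1 + a ^+ 2) * C / (1 + s ^+ 2).
Proof.
move=> FC s; have C0 : 0 <= C.
  by have := FC 0; rewrite expr0n addr0 divr1; apply: le_trans; exact: normc_ge0.
have p1 := oneDsqr_gt0 s; have p2 := oneDsqr_gt0 (s + a).
rewrite (le_trans (FC _))// ler_pdivrMr// mulrAC ler_pdivlMr//.
rewrite [2 * _ * C]mulrC -mulrA ler_wpM2l//.
have := sqr_ge0 (s + a + a); have := sqr_ge0 a; have := sqr_ge0 (s + a).
by have := sqr_ge0 (a * (s + a)); nra.
Qed.

Lemma decaying_shift F a : decaying F -> decaying (fun s => F (s + a)).
Proof.
move=> [mF cF [C FC]]; split; [exact: cmfun_shift|exact: ccontinuous_shift|].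
by exists (2 * (1 + a ^+ 2) * C); exact: decay_shift.
Qed.

Lemma decaying_conj F : decaying F -> decaying (fun s => conjc (F s)).
Proof.
move=> [mF [cr ci] [C FC]]; split; first exact: cmfun_conj.
  split=> x.
    rewrite (_ : _ \o _ = (fun x => Re (F x))); first exact: cr.
    by apply/funext => y; exact: Re_conj.
  rewrite (_ : _ \o _ = (fun x => - Im (F x))); first by apply: cvgN; exact: ci.
  by apply/funext => y; exact: Im_conj.
by exists C => s; rewrite normc_conj.
Qed.

Lemma decaying_bounded F : decaying F -> exists C, forall s, normc (F s) <= C.
Proof.
move=> [_ _ [C FC]]; exists C => s; rewrite (le_trans (FC s))// ler_pdivrMr ?oneDsqr_gt0//.
have C0 : 0 <= C.
  by have := FC 0; rewrite expr0n addr0 divr1; apply: le_trans; exact: normc_ge0.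
by rewrite ler_peMr// lerDl sqr_ge0.
Qed.

Lemma decaying_mul f g : decaying f -> decaying g -> decaying (fun s => f s * g s).
Proof.
move=> df dg; have [mf [fr fi] [C fC]] := df; have [mg [gr gi] _] := dg.
have [M gM] := decaying_bounded dg; split; first exact: cmfunM.
  split=> x.
    rewrite (_ : _ \o _ = (fun x => Re (f x) * Re (g x) - Im (f x) * Im (g x))).
      by apply: cvgB; apply: cvgM; [exact: fr|exact: gr|exact: fi|exact: gi].
    by apply/funext => y; exact: ReM.
  rewrite (_ : _ \o _ = (fun x => Re (f x) * Im (g x) + Im (f x) * Re (g x))).
    by apply: cvgD; apply: cvgM; [exact: fr|exact: gi|exact: fi|exact: gr].
  by apply/funext => y; exact: ImM.
by exists (C * M) => s; rewrite normcM mulrAC ler_pM ?normc_ge0.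
Qed.

Lemma decayingB f g : decaying f -> decaying g -> decaying (fun s => f s - g s).
Proof.
move=> [mf [fr fi] [C fC]] [mg [gr gi] [M gM]]; split; first exact: cmfunB.
  split=> x.
    rewrite (_ : _ \o _ = (fun x => Re (f x) - Re (g x))).
      by apply: cvgB; [exact: fr|exact: gr].
    by apply/funext => y /=; rewrite ReD ReN.
  rewrite (_ : _ \o _ = (fun x => Im (f x) - Im (g x))).
    by apply: cvgB; [exact: fi|exact: gi].
  by apply/funext => y /=; rewrite ImD ImN.
by exists (C + M) => s; rewrite mulrDl (le_trans (normcB _ _))// lerD.
Qed.

Lemma decaying_cintegrable F : decaying F -> cintegrable F.
Proof. by move=> [mF _ [C FC]]; exact: decay_cintegrable mF FC. Qed.

Lemma square_integrable_conj f : square_integrable f -> square_integrable (fun x => conjc (f x)).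
Proof.
move=> [mf f2]; split; first exact: cmfun_conj.
by move: f2; congr rintegrable; apply/funext => x; rewrite normc_conj.
Qed.

Lemma square_integrable_shift f y : square_integrable f -> square_integrable (fun x => f (x + y)).
Proof.
by move=> [mf f2]; split; [exact: cmfun_shift|exact: (rintegrable_shift y f2)].
Qed.

Lemma square_integrable_expi f w : square_integrable f ->
  square_integrable (fun x => f x * expi (w * x)).
Proof.
move=> [mf f2]; split; first by apply: cmfunM => //; exact: cmfun_expi_lin.
by move: f2; congr rintegrable; apply/funext => x; rewrite normcM normc_expi mulr1.
Qed.

(* What the hypotheses of the theorem say about one function [f] and its
   transform [fh]. *)
Definition admissible f fh := [/\ decaying f, is_fourier f fh, square_integrable fh,
  absc3 fh & absc3 (mulX fh)].

Lemma absc3_integrable f : absc3 f -> cintegrable f.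
Proof. by move=> [hs [[jf _ _] _ _]]. Qed.

Lemma admissible_inversion f fh x : admissible f fh ->
  f x = cint (fun xi => fh xi * expi (2 * pi * x * xi)).
Proof.
by move=> [[_ cf _] F _ a3 _]; exact: fourier_inversion F cf (absc3_integrable a3).
Qed.

(** By inversion [f] is the inverse transform of an integrable function with two integrable
    derivatives; the bounds for zero and for two integrations by parts add up to the decay of
    [f]. *)
Lemma admissibleP f fh : in_Lp 2 f -> ccontinuous f -> is_fourier f fh ->
  sobolev 3 1 fh -> sobolev 3 1 (mulX fh) -> admissible f fh.
Proof.
move=> L2f cf F W1 XW1; have a3 := sobolev_absc W1; split=> //.
- split=> //; first exact: L2f.1.
  have [h2 [_ [c2 _]]] := absc3_chain a3; have jf := absc3_integrable a3.
  exists (rint (fun x => normc (fh x)) + rint (fun x => normc (h2 x))) => x.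
  have := absc_chain_decay (2 * pi * x) (absc_chain0 jf); have := absc_chain_decay (2 * pi * x) c2.
  rewrite -(fourier_inversion x F cf jf) expr0 mul1r real_normK ?num_real//.
  rewrite ler_pdivlMr ?oneDsqr_gt0//; have := normc_ge0 (f x); have := @pi_ge1 R.
  move: (normc _) (rint _) (rint _) (pi : R) => z a b p p1 z0 za zb.
  have : z * x ^+ 2 <= (2 * p * x) ^+ 2 * z.
    rewrite mulrC ler_wpM2r// exprMn ler_peMl ?sqr_ge0//; nra.
  by move=> zx; rewrite mulrDr mulr1 lerD// (le_trans zx).
- by apply: in_L2_square_integrable; have [_ + _] := F.
- exact: sobolev_absc.
Qed.

Definition coefficient fh gh l t := cint (fun xi => prod1 B fh gh l xi * expi (2 * pi * t * xi)).

(* Parseval for [g] against the transform [q] of the translated and modulated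
   conjugate of [f]. *)
Lemma cint_coefficient f fh g gh l t : admissible f fh -> admissible g gh ->
  cint (fun s => f (s + t) * conjc (g s) * expi (2 * pi / B * l%:~R * s)) =
  coefficient fh gh l t.
Proof.
move=> af ag; have [df Ff f2 a3 _] := af; have [dg Fg g2 b3 _] := ag.
have jf := absc3_integrable a3.
pose w : R := l%:~R * B^-1.
pose p xi := fh xi * expi (2 * pi * t * xi).
have jp : cintegrable p by exact: cintegrable_expi.
pose q xi := conjc (p (xi + - w)).
have jq : cintegrable q by apply: cintegrable_conj; exact: (cintegrable_shift (- w) jp).
have q2 : square_integrable q.
  apply: square_integrable_conj; apply: square_integrable_shift (- w) _.
  exact: square_integrable_expi.
have Q x : cint (fun xi => q xi * expi (- (2 * pi * xi * x))) =
    conjc (f (x + t) * expi (2 * pi / B * l%:~R * x)).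
  have jpx : cintegrable (fun xi => p xi * expi (2 * pi * x * xi)) by exact: cintegrable_expi.
  rewrite (admissible_inversion (x + t) af) -cintZr; last exact: cintegrable_expi.
  rewrite -cint_conj; last first.
    have := cintegrableZ (expi (2 * pi / B * l%:~R * x)) (cintegrable_expi (2 * pi * (x + t)) jf).
    by congr cintegrable; apply/funext => xi; rewrite mulrC.
  have j2 := cintegrableZ (expi (2 * pi * x * w)) jpx.
  rewrite -[RHS](cint_shift (- w)); last first.
    have := cintegrable_conj j2; congr cintegrable; apply/funext => xi; congr conjc.
    rewrite /p mulrCA -!mulrA; congr (_ * _); rewrite -!expiD; congr expi.
    by rewrite /w; ring.
  congr cint; apply/funext => xi; rewrite /q /p.
  rewrite -conj_expi -conjcM; congr conjc; rewrite -!mulrA; congr (_ * _).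
  by rewrite -!expiD; congr expi; rewrite /w; ring.
have dG : decaying (fun s => g s * conjc (f (s + t))).
  by apply: decaying_mul => //; apply: decaying_conj; exact: decaying_shift.
have jG := decaying_cintegrable dG.
have E x : g x * cint (fun xi => q xi * expi (- (2 * pi * xi * x))) =
    g x * conjc (f (x + t)) * expi (- (2 * pi / B * l%:~R) * x).
  by rewrite Q conjcM conj_expi mulrA mulNr.
have P := fourier_pairing Fg jq q2.
rewrite (eq_fun E) in P; have {}P := P (cintegrable_expi _ jG).
transitivity (conjc (cint (fun x => g x * conjc (f (x + t)) * expi (- (2 * pi / B * l%:~R) * x)))).
  rewrite -cint_conj; last exact: cintegrable_expi.
  congr cint; apply/funext => x; rewrite !conjcM conjcK conj_expi mulNr opprK.
  by rewrite [conjc _ * _]mulrC.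
rewrite -P -cint_conj; last exact: square_integrableM.
rewrite /coefficient -[LHS](cint_shift w); last first.
  by apply: cintegrable_conj; exact: square_integrableM.
congr cint; apply/funext => xi; rewrite conjcM conjcK /p addrK /prod1.
by rewrite mulrAC.
Qed.

End coefficients.

Section row_sums.
Context {R : realType} {B : R} (B0 : 0 < B).
Implicit Types (f g F : R -> R[i]) (s t u v C S e : R) (n J : nat) (j k l : int).

Lemma sum_translates F n :
  \sum_(k <- kbox n) F (- (B * k%:~R)) = translates (B := B) F n 0.
Proof.
rewrite sum_kbox; apply: eq_bigr => i _; rewrite /pair_translate !add0r.
by congr (F _ + F _); rewrite ?NegzE ?mulrNz ?mulrN ?opprK mulrC.
Qed.

(* [1 / (1 + (u - B k)^2)] is at most a constant times its mean over the cell
   centred at [u - B k], and these cells are disjoint. *)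
Lemma lorentz_sum : exists E, forall u n,
  \sum_(k <- kbox n) (1 + (- (B * k%:~R) + u) ^+ 2)^-1 <= E.
Proof.
pose L (s : R) := (1 + s ^+ 2)^-1.
have iL : rintegrable L by exact: rintegrable_oneDsqrV.
have L0 s : 0 <= L s by rewrite invr_ge0 ltW// oneDsqr_gt0.
pose K := 2 * (1 + B ^+ 2); exists (K * rint L / B) => u n.
pose F s := (L (s + u))%:C.
pose t s := \sum_(i < n) (L (s + - (i%:R * B) + u) + L (s + i.+1%:R * B + u)).
have tE s : translates (B := B) F n s = (t s)%:C.
  rewrite rmorph_sum; apply: eq_bigr => i _; exact: (esym (rmorphD (real_complex R) _ _)).
have iLu : rintegrable (fun s => L (s + u)) by exact: rintegrable_shift.
have mF : cmfun F by apply: cmfun_real; exact: rintegrable_measurable.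
have FC s : normc (F s) <= 2 * (1 + u ^+ 2) * 1 / (1 + s ^+ 2).
  have := @decay_shift R u 1 (fun s => (L s)%:C); apply=> s'.
  by rewrite normc_real ger0_norm// mul1r.
(* With a single frequency the Fejér kernel is constant, and [cint_translates] reduces to the bare
   tiling of the line. *)
have fe1 s : fejer (B := B) 1 s = 1.
  rewrite /fejer /dirichlet big_ord1 mulr0 mul0r expi0 invr1 mul1r.
  by rewrite -(@expi0 R) normc_expi expr1n.
have := cint_translates B0 mF FC 1 n.
have -> : (fun s => translates (B := B) F n s * (cell (B := B) s * fejer (B := B) 1 s)%:C) =
    (fun s => (cell (B := B) s * t s)%:C).
  by apply/funext => s; rewrite tE fe1 mulr1 -rmorphM/= mulrC.
have -> : (fun s => F s * (fejer (B := B) 1 s)%:C *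
     (box (B / 2 - n%:R * B) (B / 2 + n%:R * B) s)%:C) =
    (fun s => (L (s + u) * box (B / 2 - n%:R * B) (B / 2 + n%:R * B) s)%:C).
  by apply/funext => s; rewrite fe1 mulr1 -rmorphM.
rewrite !cint_real => -[ct].
have it a : rintegrable (fun s => L (s + a)) by exact: rintegrable_shift.
have ict : rintegrable (fun s => cell (B := B) s * t s).
  have jc : cintegrable (fun s => (cell (B := B) s)%:C).
    by apply: cintegrable_real; exact: rintegrable_box.
  have := cintegrable_Re (cintegrableMb jc (cmfun_translates (B := B) mF n) (translates_le FC n)).
  by congr rintegrable; apply/funext => s; rewrite tE -rmorphM.
have ib : rintegrable (fun s => L (s + u) * box (B / 2 - n%:R * B) (B / 2 + n%:R * B) s).
  apply: (@le_rintegrable _ _ (fun s => L (s + u))) => //.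
    apply: measurable_funM; [exact: rintegrable_measurable|exact: measurable_box].
  by move=> s; rewrite normrM ger0_norm// ler_piMr// box_le1.
have -> : \sum_(k <- kbox n) (1 + (- (B * k%:~R) + u) ^+ 2)^-1 = t 0.
  have := sum_translates F n; rewrite tE /F /L.
  by rewrite -(rmorph_sum (real_complex R)) => -[].
rewrite ler_pdivlMr// -(rint_cell B0) mulrC -[leLHS](_ : rint (fun s => t 0 * cell (B := B) s) = _).
  apply: (@le_trans _ _ (K * rint (fun s => cell (B := B) s * t s))); last first.
    rewrite ler_wpM2l ?mulr_ge0 ?addr_ge0 ?sqr_ge0// ct -(rint_shift u iL).
    by apply: le_rint => // s; rewrite ler_piMr// (le_trans (ler_norm _))// box_le1.
  rewrite -rintZl//; apply: le_rint; [exact: rintegrableZl (rintegrable_box _ _)|exact: rintegrableZl|].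
  move=> s; rewrite mulrC mulrCA.
  have [->|/eqP] := eqVneq (cell (B := B) s) 0; first by rewrite !mul0r.
  rewrite {1}/cell boxE; case: andP => // -[s1 s2] _.
  rewrite ler_wpM2l ?box_ge0// mulr_sumr; apply: ler_sum => i _.
  have H p : L p <= K * L (s + p).
    rewrite /L -ler_pdivrMr ?invr_gt0 ?oneDsqr_gt0// invrK mulrC ler_pdivrMr ?oneDsqr_gt0//.
    have b0 := B0; have s3 : s ^+ 2 <= B ^+ 2 by nra.
    have := sqr_ge0 (s - p); have := mulr_ge0 (sqr_ge0 B) (sqr_ge0 p).
    by rewrite /K; move: s3 (s ^+ 2) => + _; nra.
  by rewrite mulrDr !add0r -!addrA lerD ?H.
by rewrite rintZl; [exact: mulrC|exact: rintegrable_box].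
Qed.

(* Peetre: [1 + (p - q)^2 <= 2 (1 + p^2) + 2 (1 + q^2)]. *)
Lemma decaying_row_sum f g : decaying f -> decaying g -> exists D, 0 <= D /\ forall u v n,
  \sum_(k <- kbox n) normc (f (- (B * k%:~R) + u) * conjc (g (- (B * k%:~R) + v)))
    <= D / (1 + (u - v) ^+ 2).
Proof.
move=> [_ _ [C fC]] [_ _ [C' gC]]; have [E HE] := lorentz_sum.
have C0 : 0 <= C by have := fC 0; rewrite expr0n addr0 divr1; apply: le_trans; exact: normc_ge0.
have C'0 : 0 <= C' by have := gC 0; rewrite expr0n addr0 divr1; apply: le_trans; exact: normc_ge0.
have E0 : 0 <= E by apply: le_trans (HE 0 0); rewrite big_nil.
exists (C * C' * (2 * (E + E))); split; first by rewrite !mulr_ge0 ?addr_ge0.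
move=> u v n; set q := 1 + (u - v) ^+ 2; have q0 : 0 < q by exact: oneDsqr_gt0.
pose L (s : R) := (1 + s ^+ 2)^-1.
apply: (@le_trans _ _ (\sum_(k <- kbox n)
    (C * C' * 2 / q) * (L (- (B * k%:~R) + u) + L (- (B * k%:~R) + v)))).
  apply: ler_sum => k _; rewrite normcM normc_conj.
  apply: (le_trans (ler_pM (normc_ge0 _) (normc_ge0 _) (fC _) (gC _))).
  set x := - (B * k%:~R) + u; set y := - (B * k%:~R) + v.
  have qE : q = 1 + (x - y) ^+ 2 by rewrite /q /x /y; congr (1 + _ ^+ 2); ring.
  have X0 := oneDsqr_gt0 x; have Y0 := oneDsqr_gt0 y.
  have -> : C * C' * 2 / q * (L x + L y) = C * C' * (2 * (L x + L y) / q) by ring.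
  rewrite mulrACA; apply: ler_wpM2l; first exact: mulr_ge0.
  rewrite ler_pdivlMr// -invfM ler_pdivrMl ?mulr_gt0// /L.
  have -> : (1 + x ^+ 2) * (1 + y ^+ 2) * (2 * ((1 + x ^+ 2)^-1 + (1 + y ^+ 2)^-1)) =
     2 * (1 + x ^+ 2) + 2 * (1 + y ^+ 2) by field; rewrite !gt_eqF.
  by rewrite qE; have := sqr_ge0 (x + y); nra.
rewrite -mulr_sumr big_split/= [leRHS](_ : _ = C * C' * 2 / q * (E + E)); last by ring.
by rewrite ler_wpM2l ?lerD ?HE// !mulr_ge0// invr_ge0 ltW.
Qed.

Lemma row_bound F S (c e : R) : decaying F -> 0 < c -> 0 < e ->
  (forall r : seq int, uniq r ->
    \sum_(l <- r) normc (cint (fun s => F s * expi (2 * pi / B * l%:~R * s))) <= S) ->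
  exists m, forall n, (m <= n)%N ->
    B * normc (\sum_(k <- kbox n) c%:C * F (- (B * k%:~R))) <= c * S + e.
Proof.
move=> [mF cF [C FC]] c0 e0 HS; have ec : 0 < e / c by rewrite divr_gt0.
have [m Hm] := poisson_summation_bound B0 mF cF FC ec HS.
exists m => n mn; rewrite -mulr_sumr sum_translates normcM normc_real gtr0_norm// mulrCA.
rewrite -[e](divfK (lt0r_neq0 c0)) [_ / c * c]mulrC -mulrDr ler_wpM2l ?(ltW c0)//.
exact: Hm.
Qed.

End row_sums.

(** * Kernel estimates *)

Section kernel_estimates.
Context {R : realType} {A B : R} (A1 : 1 < `|A|) (B0 : 0 < B).
Implicit Types (f fh g gh F : R -> R[i]) (s t u v x y e : R) (j k l : int).

Let a : R := `|A|.

Let a0 : 0 < a.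
Proof. exact: lt_trans A1. Qed.

Let pi4 : 0 <= (4 * pi ^+ 2)^-1 :> R.
Proof. by rewrite invr_ge0; apply: mulr_ge0 => //; exact: sqr_ge0. Qed.

Lemma norm_dilation j : `|A ^ j| = a ^ j.
Proof. by case: j => n; rewrite /exprz ?normfV normrX. Qed.

Let aj0 j : 0 < a ^ j.
Proof. exact: exprz_gt0. Qed.

Lemma kernel_termE f g x y j k : kernel_term A B f g x y (j, k) =
  (a ^ j)%:C * (f (- (B * k%:~R) + A ^ j * x) * conjc (g (- (B * k%:~R) + A ^ j * y))).
Proof.
rewrite /kernel_term /wavelet/= conjcM conjc_real mulrACA -rmorphM/=; congr (_%:C * _).
  rewrite -powRD; last by apply/implyP => _; rewrite gt_eqF.
  by rewrite -splitr powR_intmul// ltW.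
by rewrite ![- _ + _]addrC.
Qed.

(** The Poisson bound says nothing about the sums of moduli. For these the row bound
    [D / (1 + d^2)], with [d = A^j (x - y)], is at most [D] and at most [D / d^2], and the two
    geometric series apply once more. *)
Lemma kernel_csummable f g x y : decaying f -> decaying g -> x != y ->
  csummable (kernel_term A B f g x y).
Proof.
move=> df dg xy; have [D [D0 HD]] := decaying_row_sum B0 df dg.
have r0 : 0 < `|x - y| by rewrite normr_gt0 subr_eq0.
pose b j := a ^ j * (D / (1 + (A ^ j * x - A ^ j * y) ^+ 2)).
pose M := 2 * a / (a - 1) * Num.sqrt (D * (D / `|x - y| ^+ 2)).
apply: (@double_csummable R (kernel_term A B f g x y) b M) => [j n|J].
  under eq_bigr do rewrite kernel_termE normcM normc_real gtr0_norm//.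
  by rewrite -mulr_sumr ler_wpM2l ?(ltW (aj0 j))// HD.
apply: (two_sided_sum1 J A1 D0 (divr_ge0 D0 (sqr_ge0 `|x - y|))) => j; rewrite /b -/a.
  rewrite mulrC ler_wpM2r ?(ltW (aj0 j))// ler_pdivrMr ?oneDsqr_gt0//.
  by rewrite ler_peMr// lerDl sqr_ge0.
have E : (A ^ j * x - A ^ j * y) ^+ 2 = (a ^ j) ^+ 2 * `|x - y| ^+ 2.
  by rewrite -mulrBr exprMn -(real_normK (num_real (A ^ j))) norm_dilation real_normK ?num_real.
rewrite E; move: r0 (aj0 j); move: (`|x - y|) (a ^ j) => z p z0 p0.
have -> : D / z ^+ 2 / p = p * (D / (p ^+ 2 * z ^+ 2)) by field; rewrite !gt_eqF.
have pz : 0 < p ^+ 2 * z ^+ 2 by rewrite mulr_gt0 ?exprn_gt0.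
by rewrite ler_wpM2l ?(ltW p0)// ler_wpM2l// lef_pV2 ?posrE ?ltr_wpDl// lerDr.
Qed.

(* Summing first over translations, by the Poisson bound, then over dilations. *)
Lemma double_series_bound (F : int -> R -> R[i]) (S : int -> R) M (u : int * int -> R[i]) :
  (forall j, decaying (F j)) -> csummable u ->
  (forall j k, u (j, k) = (a ^ j)%:C * F j (- (B * k%:~R))) ->
  (forall j (r : seq int), uniq r ->
    \sum_(l <- r) normc (cint (fun s => F j s * expi (2 * pi / B * l%:~R * s))) <= S j) ->
  (forall J, \sum_(j <- jbox J) a ^ j * S j <= M) -> B * normc (csum u) <= M.
Proof.
move=> dF su uE HS HM; apply: (double_csum_le B0 su) HM => j e e0.
have [m Hm] := row_bound B0 (dF j) (aj0 j) e0 (HS j).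
by exists m => n mn; under eq_bigr do rewrite uE; exact: Hm.
Qed.

Lemma translated_coefficient f fh g gh l u v : admissible f fh -> admissible g gh ->
  cint (fun s => f (s + u) * conjc (g (s + v)) * expi (2 * pi / B * l%:~R * s)) =
  expi (- (2 * pi / B * l%:~R * v)) * coefficient (B := B) fh gh l (u - v).
Proof.
move=> af ag; have [df _ _ _ _] := af; have [dg _ _ _ _] := ag.
rewrite -(cint_coefficient l (u - v) af ag) -cintZ; last first.
  apply: cintegrable_expi; apply: decaying_cintegrable; apply: decaying_mul.
    exact: decaying_shift.
  exact: decaying_conj.
rewrite -[RHS](cint_shift v); last first.
  apply: cintegrableZ; apply: cintegrable_expi; apply: decaying_cintegrable.
  by apply: decaying_mul; [exact: decaying_shift|exact: decaying_conj].
congr cint; apply/funext => s; rewrite mulrCA -expiD.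
by congr (f _ * _ * expi _); ring.
Qed.

Lemma prod1_absc f fh g gh l : admissible f fh -> admissible g gh -> absc3 (prod1 B fh gh l).
Proof.
move=> [_ _ _ a3 _] [_ _ _ b3 _].
by apply: absc3_mul a3 _; apply: absc3_conj; exact: absc3_shift.
Qed.

Lemma prod2_absc f fh g gh l : admissible f fh -> admissible g gh -> absc3 (prod2 B fh gh l).
Proof.
move=> [_ _ _ _ a3] [_ _ _ b3 _].
have b3' := absc3_conj (absc3_shift (l%:~R * B^-1) b3).
exact: (absc3_mul a3 b3').
Qed.

Lemma sum_le_esum (q : int -> R) (D : int -> \bar R) (c : R) (r : seq int) : 0 <= c ->
  (forall l, (q l)%:E <= D l)%E -> uniq r ->
  ((c * \sum_(l <- r) q l)%:E <= c%:E * \esum_(l in [set: int]) D l)%E.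
Proof.
move=> c0 qD ur; rewrite EFinM lee_wpmul2l// -sumEFin.
by apply: le_trans (ge_esum_seq D ur); exact: lee_sum.
Qed.

Lemma normc_cint_expi_le f (w : R) : cintegrable f ->
  ((normc (cint (fun x => f x * expi (w * x))))%:E <= cLnorm 1 f)%E.
Proof.
move=> jf; rewrite (cLnorm1_rint jf) lee_fin.
have := absc_chain_decay w (absc_chain0 jf); by rewrite expr0 mul1r.
Qed.

Lemma kernel_size f fh g gh x y : admissible f fh -> admissible g gh -> x != y ->
  const1 A B fh gh \is a fin_num ->
  normc (frame_kernel A B f g x y) <= fine (const1 A B fh gh) * (1 / `|x - y|).
Proof.
move=> af ag xy; have [df _ _ _ _] := af; have [dg _ _ _ _] := ag.
have K0 : 0 < 2 * a / (a - 1) by rewrite divr_gt0 ?subr_gt0// mulr_gt0.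
have s0 : (0 <= sigma1 B fh gh)%E by apply: esum_ge0 => l _; exact: Lnorm_ge0.
have t0 : (0 <= tau1 B fh gh)%E.
  by rewrite mule_ge0 ?esum_ge0// => l _; exact: Lnorm_ge0.
have st0 : (0 <= sigma1 B fh gh * tau1 B fh gh)%E by exact: mule_ge0.
rewrite /const1 -/a => fC.
have fst0 : (sigma1 B fh gh * tau1 B fh gh)%E \is a fin_num.
  rewrite -(sqrte_fin_num st0); move: fC; apply: contraLR.
  rewrite (ge0_fin_numE (sqrte_ge0 _)) -leNgt leye_eq => /eqP ->.
  by rewrite gt0_muley ?lte_fin.
have [s [t [s1 t1 stE Hst]]] := @real_bounds _ _ _ 1 isT s0 t0 fst0.
rewrite fineM//; last by rewrite (sqrte_fin_num st0).
have -> : fine (sqrte (sigma1 B fh gh * tau1 B fh gh)) = Num.sqrt (s * t).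
  rewrite -[s * t]/(s * t ^+ 1) -stE -[(_ ^+ 1)%E]/(tau1 B fh gh); move: fst0.
  by case: (_ * _)%E.
have r0 : 0 < `|x - y| by rewrite normr_gt0 subr_eq0.
rewrite /frame_kernel normcM normc_real gtr0_norm//=.
pose d j := A ^ j * x - A ^ j * y.
have dE j : `|d j| = a ^ j * `|x - y| by rewrite /d -mulrBr normrM norm_dilation.
have d0 j : 0 < `|d j| by rewrite dE mulr_gt0.
pose F j s := f (s + A ^ j * x) * conjc (g (s + A ^ j * y)).
pose S j := Num.min s (t * (`|d j| ^+ 2)^-1).
apply: (@double_series_bound F S).
- move=> j; apply: decaying_mul; first exact: decaying_shift.
  by apply: decaying_conj; exact: decaying_shift.
- exact: kernel_csummable.
- by move=> j k; exact: kernel_termE.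
- move=> j r ur; rewrite le_min; apply/andP.
  under eq_bigr do rewrite (translated_coefficient _ _ _ af ag) normcM normc_expi mul1r.
  apply: Hst; first by rewrite invr_gt0 exprn_gt0.
    rewrite -[X in (X%:E <= _)%E]mul1r -[sigma1 _ _ _]mul1e; apply: sum_le_esum => // l.
    exact: normc_cint_expi_le (absc3_integrable (prod1_absc l af ag)).
  rewrite /tau1 muleAC -EFinM.
  (* The weight attached by [weak_derivative_decay] to two integrations by parts; it cancels
     [(4 pi^2)^-1] and [|d j|^-2]. *)
  pose q l := `|2 * pi * d j| ^+ 2 * normc (coefficient (B := B) fh gh l (d j)).
  rewrite [X in (X%:E <= _)%E](_ : _ = (4 * pi ^+ 2)^-1 * (`|d j| ^+ 2)^-1 * \sum_(l <- r) q l).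
    apply: (sum_le_esum _ _ ur) => [|l].
      by apply: mulr_ge0 => //; rewrite invr_ge0 sqr_ge0.
    have [h2 [_ [c2 _]]] := absc3_chain (prod1_absc l af ag).
    exact: weak_derivative_decay c2.
  rewrite -mulr_sumr mulrA -[LHS]mul1r; congr (_ * _).
  rewrite !normrM !exprMn (gtr0_norm (pi_gt0 R)) normr_nat.
  move: (d0 j) (pi_gt0 R); move: (`|d j|) (pi : R) => z p z0 p0.
  by field; rewrite !gt_eqF.
- move=> J; apply: (@le_trans _ _ (2 * a / (a - 1) * Num.sqrt (s * (t / `|x - y| ^+ 2)))).
    apply: two_sided_sum1 => //; first by rewrite divr_ge0 ?sqr_ge0.
      by move=> j; rewrite mulrC ler_wpM2r ?(ltW (aj0 j))// ge_min lexx.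
    move=> j; rewrite -[leRHS](_ : a ^ j * (t * (`|d j| ^+ 2)^-1) = _).
      by rewrite ler_wpM2l ?(ltW (aj0 j))// ge_min lexx orbT.
    rewrite dE; move: r0 (aj0 j); move: (`|x - y|) (a ^ j) => z p z0 p0.
    by field; rewrite !gt_eqF.
  rewrite -[leRHS]mulrA ler_wpM2l ?(ltW K0)// mulrA sqrtrM ?mulr_ge0// div1r.
  by rewrite sqrtrV ?sqr_ge0// sqrtr_sqr normr_id.
Qed.

(* The bounds on the coefficients enter through [N] and [D] because the theorem
   takes weak derivatives of [prod2] in one variable and of its conjugate
   [prod3] in the other. *)
Lemma kernel_increment f fh g gh (N D : int -> \bar R) x x0 y :
  admissible f fh -> admissible g gh ->
  (forall l, cLnorm 1 (prod2 B fh gh l) = N l) ->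
  (forall l t, ((`|2 * pi * t| ^+ 3 *
     normc (cint (fun xi => prod2 B fh gh l xi * expi (2 * pi * t * xi))))%:E <= D l)%E) ->
  (forall l, (0 <= D l)%E) ->
  let C := ((4 * a * (2 * a + 1) / (a ^+ 2 - 1))%:E *
    (((2 * pi)%:E * (\esum_(l in [set: int]) N l)) *
     (((4 * pi ^+ 2)^-1)%:E * (\esum_(l in [set: int]) D l)) ^+ 2) `^ 3^-1)%E in
  C \is a fin_num -> x != y -> `|x - x0| <= 1 / 2 * `|x - y| ->
  normc (frame_kernel A B f g x0 y - frame_kernel A B f g x y)
    <= fine C * (`|x - x0| / `|x - y| ^+ 2).
Proof.
move=> af ag HN HD D0; set sig := ((2 * pi)%:E * _)%E; set tau := (_ * esum _ D)%E.
move=> C fC xy xx0; have [df _ _ _ _] := af; have [dg _ _ _ _] := ag.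
have a21 : 0 < a ^+ 2 - 1 by rewrite subr_gt0 exprn_egt1.
have K0 : 0 < 4 * a * (2 * a + 1) / (a ^+ 2 - 1).
  by rewrite divr_gt0// !mulr_gt0 ?addr_gt0 ?mulr_gt0.
have pi2 : 0 < 2 * pi :> R by rewrite mulr_gt0 ?pi_gt0.
have N0 l : (0 <= N l)%E by rewrite -HN Lnorm_ge0.
have s0 : (0 <= sig)%E by rewrite mule_ge0 ?esum_ge0// lee_fin ltW.
have t0 : (0 <= tau)%E by apply: mule_ge0; [by rewrite lee_fin|exact: esum_ge0].
have st0 : (0 <= sig * tau ^+ 2)%E by apply: mule_ge0 => //; exact: expe_ge0.
have fst0 : (sig * tau ^+ 2)%E \is a fin_num.
  move: fC; apply: contraLR; rewrite /C (ge0_fin_numE st0) -leNgt leye_eq => /eqP ->.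
  by rewrite poweRyr ?invr_eq0 ?pnatr_eq0// gt0_muley ?lte_fin.
have [s [t [s1 t1 stE Hst]]] := @real_bounds _ _ _ 2 isT s0 t0 fst0.
have CE : fine C = 4 * a * (2 * a + 1) / (a ^+ 2 - 1) * (s * t ^+ 2) `^ 3^-1.
  by rewrite /C fineM ?fine_poweR ?stE//; move: fst0; case: (_ * _)%E.
(* Separating the trivial case permits division by [|d' j - d j|] below. *)
have [->|nxx0] := eqVneq x x0; first by rewrite !subrr normc0 normr0 mul0r mulr0.
have r0 : 0 < `|x - y| by rewrite normr_gt0 subr_eq0.
have h0 : 0 < `|x - x0| by rewrite normr_gt0 subr_eq0.
have x0y : x0 != y.
  by apply/eqP => E; move: xx0; rewrite E; move: r0; lra.
rewrite /frame_kernel -mulrBr -csumB; [|exact: kernel_csummable|exact: kernel_csummable].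
rewrite normcM normc_real gtr0_norm//.
pose d j := A ^ j * x - A ^ j * y; pose d' j := A ^ j * x0 - A ^ j * y.
have dE j : `|d j| = a ^ j * `|x - y| by rewrite /d -mulrBr normrM norm_dilation.
have d0 j : 0 < `|d j| by rewrite dE mulr_gt0.
have ddE j : `|d' j - d j| = a ^ j * `|x - x0|.
  have -> : d' j - d j = A ^ j * (x0 - x) by rewrite /d /d'; ring.
  by rewrite normrM norm_dilation distrC.
have dd0 j : 0 < `|d' j - d j| by rewrite ddE mulr_gt0.

pose F j s := f (s + A ^ j * x0) * conjc (g (s + A ^ j * y)) -
  f (s + A ^ j * x) * conjc (g (s + A ^ j * y)).
have dF j z : decaying (fun s => f (s + A ^ j * z) * conjc (g (s + A ^ j * y))).
  by apply: decaying_mul; [|apply: decaying_conj]; exact: decaying_shift.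
(* Bounds the sum of the coefficient increments per unit of length of the segment; [8 / |d j|^3] is
   the inverse cube of [|d j| / 2]. *)
pose m j := Num.min s (t * (8 / `|d j| ^+ 3)).
apply: (@double_series_bound F (fun j => `|d' j - d j| * m j)).
- by move=> j; apply: decayingB.
- by apply: csummableB; exact: kernel_csummable.
- by move=> j k; rewrite !kernel_termE -mulrBr.
- move=> j r ur.
  pose q l := normc (coefficient (B := B) fh gh l (d' j) - coefficient (B := B) fh gh l (d j)).
  rewrite (eq_bigr q) => [|l _]; last first.
    rewrite (_ : (fun s => _) = (fun s =>
        f (s + A ^ j * x0) * conjc (g (s + A ^ j * y)) * expi (2 * pi / B * l%:~R * s) -
        f (s + A ^ j * x) * conjc (g (s + A ^ j * y)) * expi (2 * pi / B * l%:~R * s))); last first.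
      by apply/funext => z; rewrite /F mulrBl.
    rewrite cintB; [|by apply: cintegrable_expi; exact: decaying_cintegrable..].
    by rewrite !(translated_coefficient _ _ _ af ag) -mulrBr normcM normc_expi mul1r.
  rewrite mulrC -ler_pdivrMr// mulrC le_min; apply/andP.
  have inc l M := @fourier_increment R (prod1 B fh gh l) (prod2 B fh gh l) (d' j) (d j) M
    (absc3_integrable (prod1_absc l af ag)) (absc3_integrable (prod2_absc l af ag))
    (fun xi => esym (mulrA _ _ _)).
  have j2 l := absc3_integrable (prod2_absc l af ag).
  have pd0 : 0 < 2 * pi * `|d' j - d j| by exact: mulr_gt0.
  apply: Hst; first by rewrite divr_gt0// exprn_gt0.
    rewrite [X in (X%:E <= _)%E](_ : _ = 2 * pi * \sum_(l <- r) (q l / (2 * pi * `|d' j - d j|))).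
      apply: (sum_le_esum (ltW pi2) _ ur) => l; rewrite -HN (cLnorm1_rint (j2 l)) lee_fin.
      rewrite (ler_pdivrMr _ _ pd0) [leRHS]mulrC; apply: inc => z _.
      have := normc_cint_expi_le (2 * pi * (d j + (d' j - d j) * z)) (j2 l).
      by rewrite (cLnorm1_rint (j2 l)) lee_fin.
    rewrite -mulr_suml; move: (dd0 j) pi2; move: (2 * pi) (`|d' j - d j|) => p z z0 p0.
    by field; rewrite !gt_eqF.
  rewrite /tau muleAC -EFinM.
  pose c := (4 * pi ^+ 2)^-1 * (8 / `|d j| ^+ 3).
  have c0 : 0 < c.
    apply: mulr_gt0; last by rewrite divr_gt0// exprn_gt0.
    by rewrite invr_gt0; apply: mulr_gt0 => //; rewrite exprn_gt0// pi_gt0.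
  rewrite [X in (X%:E <= _)%E](_ : _ = c * \sum_(l <- r) (q l / (c * `|d' j - d j|))); last first.
    rewrite -mulr_suml; move: (dd0 j) c0; move: c (`|d' j - d j|) => p z z0 p0.
    by field; rewrite !gt_eqF.
  apply: (sum_le_esum (ltW c0) _ ur) => l.
  have [->|Dfin] := eqVneq (D l) +oo%E; first exact: leey.
  have DE : D l = (fine (D l))%:E by rewrite fineK// ge0_fin_numE// lt_neqAle Dfin leey.
  rewrite DE lee_fin (ler_pdivrMr _ _ (mulr_gt0 c0 (dd0 j))).
  (* One [2 pi] from the increment against three from the integrations by parts leaves the [4 pi^2]
     of [tau]. *)
  have -> : fine (D l) * (c * `|d' j - d j|) =
      2 * pi * `|d' j - d j| * (fine (D l) * 8 / (2 * pi * `|d j|) ^+ 3).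
    rewrite /c; move: (d0 j) (pi_gt0 R); move: (`|d j|) (pi : R) => z p z0 p0.
    by field; rewrite !gt_eqF.
  apply: inc => z /andP[z0 z1]; have := HD l (d j + (d' j - d j) * z).
  rewrite {1}DE lee_fin; set w := d j + _; set E := normc _ => HE.
  have E0 : 0 <= E by exact: normc_ge0.
  have half : `|d j| / 2 <= `|w|.
    have := lerB_normD (d j) ((d' j - d j) * z); rewrite -/w; apply: le_trans.
    rewrite normrM (ger0_norm z0) ddE dE.
    have := ler_pM (ltW h0) z0 xx0 z1; have := aj0 j.
    move: (a ^ j) (`|x - y|) (`|x - x0|) r0 h0 xx0 => p ry rx p1 p2 p3 p4; nra.
  have d30 : 0 < (2 * pi * `|d j|) ^+ 3 by apply: exprn_gt0; exact: mulr_gt0.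
  rewrite (ler_pdivlMr _ _ d30).
  have w0 : 0 < `|w| by apply: lt_le_trans half; rewrite divr_gt0.
  have : (2 * pi * `|d j|) ^+ 3 <= 8 * `|2 * pi * w| ^+ 3.
    rewrite normrM (gtr0_norm pi2).
    have -> : 8 * (2 * pi * `|w|) ^+ 3 = (2 * pi * (2 * `|w|)) ^+ 3 :> R by ring.
    have p1 := mulr_ge0 (ltW pi2) (normr_ge0 (d j)).
    have p2 : 0 <= 2 * pi * (2 * `|w|) by apply: mulr_ge0; [exact: ltW|exact: mulr_ge0].
    rewrite ler_pXn2r ?nnegrE//; apply: ler_wpM2l; first exact: ltW.
    by rewrite mulrC -ler_pdivrMr.
  move=> /(ler_wpM2l E0) /le_trans; apply.
  by rewrite mulrCA [fine _ * 8]mulrC ler_wpM2l// mulrC.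
(* The length [a ^ j * |x - x0|] of the segment supplies a second factor [a ^ j], so the low
   dilations now sum with ratio [a ^ 2]. *)
- move=> J; pose b j := (a ^ j) ^+ 2 * m j.
  rewrite (eq_bigr (fun j => `|x - x0| * b j)) => [|j _]; last by rewrite ddE /b; ring.
  rewrite -mulr_sumr CE mulrC -[leRHS](_ : 4 * a * (2 * a + 1) / (a ^+ 2 - 1) *
    (s * t ^+ 2) `^ 3^-1 / `|x - y| ^+ 2 * `|x - x0| = _); last by ring.
  rewrite ler_wpM2r ?(ltW h0)//.
  apply: (@le_trans _ _ (a * (2 * a + 1) / (a ^+ 2 - 1) * (s * (t * 8 / `|x - y| ^+ 3) ^+ 2) `^ 3^-1)).
    apply: two_sided_sum2 => //; first by rewrite !mulr_ge0// invr_ge0 exprn_ge0.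
      by move=> j; rewrite /b mulrC ler_wpM2r ?sqr_ge0// ge_min lexx.
    move=> j; rewrite -[leRHS](_ : (a ^ j) ^+ 2 * (t * (8 / `|d j| ^+ 3)) = _).
      by rewrite ler_wpM2l ?sqr_ge0// ge_min lexx orbT.
    rewrite dE; move: r0 (aj0 j); move: (`|x - y|) (a ^ j) => z p z0 p0.
    by field; rewrite !gt_eqF.
  (* Here [8 ^ 2 = 4 ^ 3]: the cube root gives the [4] of the constant and the power
     [|x - y|^-2]. *)
  have -> : s * (t * 8 / `|x - y| ^+ 3) ^+ 2 = s * t ^+ 2 * (4 / `|x - y| ^+ 2) ^+ 3.
    by move: r0; move: (`|x - y|) => z z0; field; rewrite !gt_eqF.
  have q0 : 0 <= 4 / `|x - y| ^+ 2 by rewrite divr_ge0 ?exprn_ge0.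
  rewrite powRM ?mulr_ge0 ?exprn_ge0// -[X in _ * X `^ _]powR_mulrn// -powRrM divff ?pnatr_eq0// powRr1//.
  by rewrite le_eqVlt; apply: predU1l; ring.
Qed.

Lemma frame_kernel_conj f g x y : decaying f -> decaying g -> x != y ->
  frame_kernel A B f g x y = conjc (frame_kernel A B g f y x).
Proof.
move=> df dg xy; rewrite /frame_kernel conjcM conjc_real; congr (_ * _).
rewrite -csum_conj; last by apply: kernel_csummable => //; rewrite eq_sym.
congr csum; apply/funext => -[j k].
by rewrite /kernel_term [RHS]conjcM conjcK mulrC.
Qed.

End kernel_estimates.

Section second_variable.
Context {R : realType} {B : R}.
Implicit Types (f fh g gh : R -> R[i]) (l : int) (t : R).

Lemma prod3_conj fh gh l xi : prod2 B gh fh l xi = conjc (prod3 B fh gh l xi).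
Proof. by rewrite /prod2 /prod3 !conjcM conjcK conjc_real mulrAC. Qed.

Lemma cLnorm_prod3 fh gh l : cLnorm 1 (prod2 B gh fh l) = cLnorm 1 (prod3 B fh gh l).
Proof.
by rewrite !cLnorm1E; apply: eq_integral => xi _; rewrite prod3_conj normc_conj.
Qed.

Lemma prod3_absc f fh g gh l : admissible f fh -> admissible g gh -> absc3 (prod3 B fh gh l).
Proof.
move=> af ag; have := absc3_conj (prod2_absc (B := B) l ag af).
by congr absc3; apply/funext => xi; rewrite prod3_conj conjcK.
Qed.

(** The representative chosen by [weak_derivative] need not commute with conjugation. The decay is
    therefore proved for [prod3] at the opposite frequency, and the integral is conjugated
    instead. *)
Lemma prod3_decay f fh g gh l t : admissible f fh -> admissible g gh ->
  ((`|2 * pi * t| ^+ 3 *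
     normc (cint (fun xi => prod2 B gh fh l xi * expi (2 * pi * t * xi))))%:E <=
   cLnorm 1 (weak_derivative 3 (prod3 B fh gh l)))%E.
Proof.
move=> af ag; have a3 := prod3_absc l af ag; have [_ [h3 [_ c3]]] := absc3_chain a3.
have := weak_derivative_decay (- (2 * pi * t)) c3; rewrite normrN.
rewrite -normc_conj -cint_conj; last exact: cintegrable_expi (absc3_integrable a3).
under [X in cint X]funext do rewrite conjcM -prod3_conj conj_expi mulNr opprK.
by [].
Qed.

End second_variable.

Theorem theorem4p6 (R : realType) (A B : R) (psi phi psih phih : R -> R[i])
  (hA : 1 < `|A|) (hB : 0 < B)
  (psiL2 : in_Lp 2 psi) (phiL2 : in_Lp 2 phi)
  (* the continuous representatives of psi and phi *)
  (psic : ccontinuous psi) (phic : ccontinuous phi)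
  (psiF : is_fourier psi psih) (phiF : is_fourier phi phih)
  (psih31 : sobolev 3 1 psih) (psih32 : sobolev 3 2 psih)
  (phih31 : sobolev 3 1 phih) (phih32 : sobolev 3 2 phih)
  (Xpsih31 : sobolev 3 1 (mulX psih)) (Xpsih32 : sobolev 3 2 (mulX psih))
  (Xphih31 : sobolev 3 1 (mulX phih)) (Xphih32 : sobolev 3 2 (mulX phih)) :
  let K := frame_kernel A B psi phi in
  let C1 := const1 A B psih phih in
  let C2 := const2 A B psih phih in
  let C3 := const3 A B psih phih in
  [/\ (* the series defining K(x, y) converges absolutely off the diagonal *)
      forall x y : R, x != y -> csummable (kernel_term A B psi phi x y),
      C1 \is a fin_num ->
        forall x y : R, x != y ->
          ComplexField.Normc.normc (K x y) <= fine C1 * (1 / `|x - y|),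
      C2 \is a fin_num ->
        forall x x0 y : R, x != y -> `|x - x0| <= 1 / 2 * `|x - y| ->
          ComplexField.Normc.normc (K x0 y - K x y)
            <= fine C2 * (`|x - x0| / `|x - y| ^+ 2)
    & C3 \is a fin_num ->
        forall x y y0 : R, x != y -> `|y0 - y| <= 1 / 2 * `|x - y| ->
          ComplexField.Normc.normc (K x y0 - K x y)
            <= fine C3 * (`|y0 - y| / `|x - y| ^+ 2)].
Proof.
have af := admissibleP psiL2 psic psiF psih31 Xpsih31.
have ag := admissibleP phiL2 phic phiF phih31 Xphih31.
have [df _ _ _ _] := af; have [dg _ _ _ _] := ag.
move=> K C1 C2 C3; split.
- by move=> x y; exact: kernel_csummable.
- by move=> fC x y xy; exact: kernel_size.
- move=> fC x x0 y xy xx0.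
  have decay l t : ((`|2 * pi * t| ^+ 3 *
      normc (cint (fun xi => prod2 B psih phih l xi * expi (2 * pi * t * xi))))%:E <=
      cLnorm 1 (weak_derivative 3 (prod2 B psih phih l)))%E.
    have [_ [h3 [_ c3]]] := absc3_chain (prod2_absc (B := B) l af ag).
    exact: weak_derivative_decay c3.
  exact: (kernel_increment hA hB af ag (fun=> erefl) decay (fun=> Lnorm_ge0 _ _ _) fC xy xx0).
- move=> fC x y y0 xy yy0; have xy0 : x != y0.
    apply/eqP => E; move: xy yy0; rewrite -E -subr_eq0 -normr_gt0.
    by move: (`|x - y|) => r; lra.
  rewrite /K !(frame_kernel_conj hA hB df dg)// -conjcN -rmorphD normc_conj.
  move: yy0; rewrite [`|y0 - y|]distrC [`|x - y|]distrC => yy0.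
  have yx : y != x by rewrite eq_sym.
  exact: (kernel_increment hA hB ag af (fun l => cLnorm_prod3 psih phih l)
    (fun l t => prod3_decay l t af ag) (fun=> Lnorm_ge0 _ _ _) fC yx yy0).
Qed.
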